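(* Let $A\subset\mathring K^n$ be definable. Then $A$ can be partitioned into finitely many definable sets, each of them satisfying the Whitney arc property.
   Context: Throughout, $K$ is an $\aleph_1$-saturated o-minimal structure expanding a field; ''definable'' means definable in $K$ with parameters; $|\cdot|$ is the Euclidean norm. $\mathring K$ is the set of finite elements of $K$ (those bounded in absolute value by a natural number), and $\operatorname{st}$ is the standard part map. Whitney arc property. A definable set $A\subset K^n$ satisfies the Whitney arc property if there is a constant $c\in\mathring K_{>0}$ such that for all $x,y\in A$ there is a definable curve (continuous definable map) $\gamma:[0,1]\to A$ with $\gamma(0)=x$, $\gamma(1)=y$ and $\operatorname{length}(\gamma):=\int_0^1|\gamma'|\le c|x-y|$. The integral is the one for the Berarducci-Otero measure $\mathcal L^1$: $\int_0^1|\gamma'|$ is the integral over $[0,1]\subset K$ of $\operatorname{st}(|\gamma'(t)|)$ with respect to $\mathcal L^1$, where $\mathcal L^1$ is the completed measure on the $\sigma$-ring generated by the definable subsets of $K$ of finite diameter, with $\mathcal L^1(S)$ equal to the Lebesgue measure of $\operatorname{st}(S)$ for definable $S\subset\mathring K$. It is a real number, and the inequality is understood with the right-hand side replaced by its standard part. *)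

(* Defs.v *)
From HB Require Import structures.
From mathcomp Require Import all_boot all_order all_algebra.
From mathcomp Require Import all_classical all_reals all_analysis.

Set Implicit Arguments.
Unset Strict Implicit.
Unset Printing Implicit Defensive.

Import Order.TTheory GRing.Theory Num.Theory.
Import numFieldNormedType.Exports.

Local Open Scope classical_set_scope.
Local Open Scope ring_scope.

(* The symbols added to the language of ordered rings.  The ring operations,
   the order and equality are built into the terms and formulas below, so a
   [structure L K] is an expansion of the ordered field K. *)
Record language := Language {
  fsym : Type;
  farity : fsym -> nat;
  rsym : Type;
  rarity : rsym -> nat
}.

Record structure (L : language) (K : realFieldType) := Structure {
  fint : forall f : fsym L, ('I_(farity f) -> K) -> K;
  rint : forall r : rsym L, ('I_(rarity r) -> K) -> Prop
}.

(* Variables are named by natural numbers; P is the type of the parameters,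
   used as additional constants. *)
Inductive term (L : language) (P : Type) :=
| Var of nat
| Par of P
| Zero
| One
| Add of term L P & term L P
| Opp of term L P
| Mul of term L P & term L P
| App (f : fsym L) of ('I_(farity f) -> term L P).

Inductive formula (L : language) (P : Type) :=
| Eq of term L P & term L P
| Lt of term L P & term L P
| Rel (r : rsym L) of ('I_(rarity r) -> term L P)
| Not of formula L P
| And of formula L P & formula L P
| Ex of nat & formula L P.

Section Semantics.
Context {L : language} {K : realFieldType} (M : structure L K).
Context {P : Type} (v : P -> K).

Fixpoint teval (e : nat -> K) (t : term L P) : K :=
  match t with
  | Var i => e i
  | Par c => v c
  | Zero => 0
  | One => 1
  | Add t1 t2 => teval e t1 + teval e t2
  | Opp t1 => - teval e t1
  | Mul t1 t2 => teval e t1 * teval e t2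
  | App f ts => fint M (fun i => teval e (ts i))
  end.

Fixpoint sat (e : nat -> K) (phi : formula L P) : Prop :=
  match phi with
  | Eq t1 t2 => teval e t1 = teval e t2
  | Lt t1 t2 => teval e t1 < teval e t2
  | Rel r ts => rint M (fun i => teval e (ts i))
  | Not phi1 => ~ sat e phi1
  | And phi1 phi2 => sat e phi1 /\ sat e phi2
  | Ex i phi1 => exists a : K, sat (fun j => if j == i then a else e j) phi1
  end.

End Semantics.

Section Definable.
Context {L : language} {K : realFieldType} (M : structure L K).

(* The variables from n on, which should not occur free in a formula in
   n variables, are evaluated at the constant 0. *)
Definition row_env n (x : 'rV[K]_n) (j : nat) : K :=
  if insub j is Some i then x 0 i else 0.

Definition definable n (S : set 'rV[K]_n) : Prop :=
  exists phi : formula L K, S = [set x | sat M id (row_env x) phi].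

Definition definable1 (S : set K) : Prop :=
  definable [set x : 'rV[K]_1 | S (x 0 0)].

Definition definable_map_on n (D : set K) (g : K -> 'rV[K]_n) : Prop :=
  definable [set row_mx (const_mx t : 'rV[K]_1) (g t) | t in D].

(* An [interval K] has endpoints in K or infinite; singletons are intervals. *)
Definition o_minimal : Prop :=
  forall S : set K, definable1 S ->
    exists s : seq (interval K), S = \bigcup_(I in [set` s]) [set` I].

(* Every set of formulas in the variable 0, with parameters in a countable
   set C, which is finitely satisfiable in M is realized in M. *)
Definition aleph1_saturated : Prop :=
  forall (C : set K) (p : set (formula L C)), countable C ->
    let holds (x : K) := sat M set_val (row_env (const_mx x : 'rV[K]_1)) in
    (forall F : set (formula L C), finite_set F -> F `<=` p ->
       exists x : K, forall phi, F phi -> holds x phi) ->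
    exists x : K, forall phi, p phi -> holds x phi.

Lemma definable0 n : definable (set0 : set 'rV[K]_n).
Proof.
exists (Lt (Zero L K) (Zero L K)).
by apply/seteqP; split=> x //=; rewrite ltxx.
Qed.

Lemma definableI n (S T : set 'rV[K]_n) :
  definable S -> definable T -> definable (S `&` T).
Proof. by move=> [phi ->] [psi ->]; exists (And phi psi). Qed.

Lemma definableD n (S T : set 'rV[K]_n) :
  definable S -> definable T -> definable (S `\` T).
Proof. by move=> [phi ->] [psi ->]; exists (And phi (Not psi)). Qed.

End Definable.

Section Finite.
Context {K : realFieldType}.

Definition finite_elt : set K := [set x | exists m : nat, `|x| <= m%:R].

Definition finite_diam (S : set K) : Prop :=
  exists2 d : K, finite_elt d & forall x y, S x -> S y -> `|x - y| <= d.

(* The nonnegative square root; it exists for every x >= 0 when K has an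
   o-minimal expansion. *)
Definition ksqrt (x : K) : K := xget 0 [set s | 0 <= s /\ s ^+ 2 = x].

Definition enorm n (x : 'rV[K]_n) : K := ksqrt (\sum_i x 0 i ^+ 2).

End Finite.

Section StandardPart.
Context (R : realType) {K : realFieldType}.

(* A real number if x is finite, +oo or -oo otherwise. *)
Definition st (x : K) : \bar R :=
  ereal_sup [set (ratr q : R)%:E | q in [set q : rat | ratr q <= x]].

Definition st_image (S : set K) : set R :=
  [set r | exists2 x, S x & st x = r%:E].

End StandardPart.

Arguments st R {K} x.
Arguments st_image R {K} S.

(* An alias of K which carries the ring of its definable subsets of finite
   diameter as semiring of sets. *)
Definition BO_type {L : language} {K : realFieldType} (M : structure L K) :
  Type := K.

Section BerarducciOtero.
Context (R : realType) {L : language} {K : realFieldType} (M : structure L K).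

Definition BO_ring : set (set (BO_type M)) :=
  [set S | definable1 M S /\ finite_diam (S : set K)].

Lemma BO_ring0 : BO_ring set0.
Proof.
split; first by rewrite /definable1; exact: definable0.
by exists 0 => //; exists 0%N; rewrite normr0.
Qed.

Lemma BO_ringI : setI_closed BO_ring.
Proof.
move=> S T [dS [d fd hS]] [dT _]; split; first exact: (definableI dS dT).
by exists d => // x y [Sx _] [Sy _]; exact: hS.
Qed.

Lemma BO_ringD : semi_setD_closed BO_ring.
Proof.
apply: setD_semi_setD_closed => S T [dS [d fd hS]] [dT _].
split; first exact: (definableD dS dT).
by exists d => // x y [Sx _] [Sy _]; exact: hS.
Qed.

Definition BO_display : Type -> measure_display. Proof. exact. Qed.

HB.instance Definition _ := Pointed.copy (BO_type M) K.
HB.instance Definition _ := @isSemiRingOfSets.Build (BO_display (BO_type M))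
  (BO_type M) BO_ring BO_ring0 BO_ringI BO_ringD.

Local Open Scope ereal_scope.

(* A set of finite diameter which is not contained in the finite part of K is
   first translated to a set which is. *)
Definition BO_premeasure (S : set (BO_type M)) : \bar R :=
  let a : K := if `[< S `<=` @finite_elt K >] then 0%R else xget 0%R S in
  lebesgue_measure (st_image R [set (x - a)%R | x in (S : set K)]).

Lemma BO_premeasure0 : BO_premeasure set0 = 0.
Proof.
rewrite /BO_premeasure image_set0 (_ : st_image R set0 = set0) ?measure0//.
by apply/seteqP; split=> r // [].
Qed.

Lemma BO_premeasure_ge0 S : 0 <= BO_premeasure S.
Proof. exact: measure_ge0. Qed.

Definition BO_outer : set (BO_type M) -> \bar R := mu_ext BO_premeasure.

HB.instance Definition _ := isOuterMeasure.Build R (BO_type M) BO_outer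
  (mu_ext0 BO_premeasure0 BO_premeasure_ge0)
  (mu_ext_ge0 BO_premeasure_ge0)
  (le_mu_ext BO_premeasure)
  (mu_ext_sigma_subadditive BO_premeasure_ge0).

(* The complete measure obtained from the premeasure by Caratheodory's
   extension, which extends the premeasure when M is o-minimal and
   aleph_1-saturated.  Its sigma-algebra may then be larger than the completed
   sigma-ring, but both have the same trace on each set of finite diameter. *)
Definition BO_measure : set (caratheodory_type BO_outer) -> \bar R := BO_outer.

HB.instance Definition _ := isMeasure.Build _ _ _ BO_measure
  (@caratheodory_measure0 R (BO_type M) BO_outer)
  (@caratheodory_measure_ge0 R (BO_type M) BO_outer)
  (@caratheodory_measure_sigma_additive R (BO_type M) BO_outer).

(* The values of the integrand at the finitely many points where a definable
   curve is not differentiable do not matter, finite sets having measure 0. *)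
Definition curve_length n (g : K -> 'rV[K]_n) : \bar R :=
  \int[BO_measure]_(t in (`[0%R, 1%R]%classic : set K))
    st R (enorm (derive1 g t)).

Definition whitney_arc n (A : set 'rV[K]_n) : Prop :=
  exists c : K, [/\ finite_elt c, (0 < c)%R &
    forall x y, A x -> A y -> exists g : K -> 'rV[K]_n,
      [/\ definable_map_on M `[0%R, 1%R] g,
          {within `[0%R, 1%R], continuous g},
          (forall t, t \in `[0%R, 1%R] -> A (g t)),
          g 0%R = x /\ g 1%R = y &
          curve_length g <= st R (c * enorm (x - y))%R]].

End BerarducciOtero.

(* Main.v *)
(* Everything is reduced to Lipschitz estimates: the length of a curve which is
   c |x - y|-Lipschitz on [0, 1] is at most st (c |x - y|), so it suffices to
   join x and y by a definable Lipschitz arc with a constant that is a natural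
   number times |x - y|.

   Call a definable set small if it contains no box.  By o-minimality and
   saturation, small sets form an ideal which is closed under unions that
   increase as a positive parameter decreases to 0.  Hence a property which
   holds at every point with some positive margin holds on a box with a uniform
   margin.  Off a small set, a definable function l is therefore continuous, and
   for each vector w the graph of l, moved by small multiples of w, locally lies
   on one side of itself.  The directions which move the graph to a given side
   form a convex cone, so near any direction there is another one, e, with a
   whole cube of standard size around it in such a cone: locally the secants of
   the graph stay away from e.

   Applying this to the functions which bound a cell, one coordinate after the
   other and each time inside the cube found before, yields a single direction
   e transversal to the whole boundary of the cell.  After a shear taking e to
   the first basis vector, the cell splits into graphs and bands whose bounding
   functions are locally Lipschitz with a standard constant; over a piece of the
   base in which points can be joined by Lipschitz arcs (induction on the
   dimension) such a function is Lipschitz, and the arcs lift. *)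

Require Import Defs.
From mathcomp Require Import all_boot all_order all_algebra.
From mathcomp Require Import all_classical all_reals all_analysis.
From mathcomp Require Import ring lra.

Set Implicit Arguments.
Unset Strict Implicit.
Unset Printing Implicit Defensive.

Import Order.TTheory GRing.Theory Num.Theory.
Import numFieldNormedType.Exports.

Local Open Scope classical_set_scope.
Local Open Scope ring_scope.

(** * Definable predicates and functions *)

Section RowVectors.
Context {K : realFieldType}.

(** The obstacle is uniformity: o-minimality alone yields constants in [K], which may be infinite,
    whereas the Whitney constant has to be finite. Hence apertures of cones are kept above the
    inverse of a natural number ([stdpos]), and every search for a direction costs only a factor
    depending on the dimension: a few halvings and a division by the number of coordinates. A
    direction transversal to each bounding function separately would not do, as a single change of
    coordinates has to serve all of them; this is why every stage produces a whole cube of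
    directions, inside which the next search can go on. Small pieces have no interior, but each is
    itself transversal to some direction and takes the role of its own boundary. Quasiconvexity does
    not pass to subsets, so in each dimension the induction hypothesis is applied to the base after
    all other refinements. Estimates use the sup norm, whose balls are products; the passage to the
    Euclidean norm costs a factor [n]. *)

Definition cns n (t : K) (x : 'rV[K]_n) : 'rV[K]_n.+1 :=
  \row_i (if unlift ord0 i is Some j then x 0 j else t).

Definition tl n (v : 'rV[K]_n.+1) : 'rV[K]_n := \row_i v 0 (lift ord0 i).

Lemma cns0 n t (x : 'rV[K]_n) : cns t x 0 ord0 = t.
Proof. by rewrite mxE unlift_none. Qed.

Lemma cnsS n t (x : 'rV[K]_n) i : cns t x 0 (lift ord0 i) = x 0 i.
Proof. by rewrite mxE liftK. Qed.

Lemma tl_cns n t (x : 'rV[K]_n) : tl (cns t x) = x.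
Proof. by apply/rowP => i; rewrite mxE cnsS. Qed.

Lemma cns_tl n (v : 'rV[K]_n.+1) : cns (v 0 ord0) (tl v) = v.
Proof.
by apply/rowP => i; case: (unliftP ord0 i) => [j ->|->];
  rewrite ?cnsS ?cns0 ?mxE.
Qed.

Lemma tlD n (u v : 'rV[K]_n.+1) : tl (u + v) = tl u + tl v.
Proof. by apply/rowP => i; rewrite !mxE. Qed.

Lemma tlN n (u : 'rV[K]_n.+1) : tl (- u) = - tl u.
Proof. by apply/rowP => i; rewrite !mxE. Qed.

Lemma tlZ n a (u : 'rV[K]_n.+1) : tl (a *: u) = a *: tl u.
Proof. by apply/rowP => i; rewrite !mxE. Qed.

Definition box n (x : 'rV[K]_n) (r : K) (y : 'rV[K]_n) : Prop :=
  forall i, `|y 0 i - x 0 i| < r.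

Lemma forall_ordS n (P : 'I_n.+1 -> Prop) :
  (forall i, P i) <-> P ord0 /\ forall i, P (lift ord0 i).
Proof.
split=> [h|[h0 hS] i]; first by split.
by case: (unliftP ord0 i) => [j ->|->].
Qed.

Lemma box_cns n t (x : 'rV[K]_n) r s y :
  box (cns t x) r (cns s y) <-> `|s - t| < r /\ box x r y.
Proof.
rewrite /box forall_ordS !cns0.
by split=> -[h0 hS]; split=> // i; have := hS i; rewrite !cnsS.
Qed.

Lemma box_refl n (x : 'rV[K]_n) r : 0 < r -> box x r x.
Proof. by move=> r0 i; rewrite subrr normr0. Qed.

Lemma box_le n (x y : 'rV[K]_n) r s : r <= s -> box x r y -> box x s y.
Proof. by move=> rs h i; exact: lt_le_trans (h i) rs. Qed.

End RowVectors.

(** * Substitution in formulas and closure properties of definability *)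

Section Definability.
Context {L : language} {K : realFieldType} (M : structure L K).
Implicit Types e : nat -> K.

Lemma teval_ext P (v : P -> K) t : exists N, forall e e',
  (forall i, (i < N)%N -> e i = e' i) -> teval M v e t = teval M v e' t.
Proof.
elim: t => [i|c|||t1 [N1 h1] t2 [N2 h2]|t1 [N1 h1]|t1 [N1 h1] t2 [N2 h2]|f ts
  IH];
  try by exists 0%N.
- by exists i.+1 => e e' /= ->.
- exists (maxn N1 N2) => e e' h /=; congr (_ + _); [apply: h1|apply: h2] =>
    i iN;
    by apply: h; rewrite leq_max iN ?orbT.
- by exists N1 => e e' h /=; congr (- _); exact: h1.
- exists (maxn N1 N2) => e e' h /=; congr (_ * _); [apply: h1|apply: h2] =>
    i iN;
    by apply: h; rewrite leq_max iN ?orbT.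
- have [N hN] := choice IH.
  exists (\max_i N i) => e e' h /=; congr (fint M _); apply/funext => i.
  by apply: hN => j jN; apply: h; apply: leq_trans jN _; exact: leq_bigmax.
Qed.

Lemma sat_ext P (v : P -> K) phi : exists N, forall e e',
  (forall i, (i < N)%N -> e i = e' i) -> sat M v e phi <-> sat M v e' phi.
Proof.
elim: phi => [t1 t2|t1 t2|r ts|phi [N h]|phi1 [N1 h1] phi2 [N2 h2]|i phi [N h]].
- have [N1 h1] := teval_ext v t1; have [N2 h2] := teval_ext v t2.
  exists (maxn N1 N2) => e e' h /=.
  by rewrite (h1 e e') ?(h2 e e')// => i iN; apply: h; rewrite leq_max iN ?orbT.
- have [N1 h1] := teval_ext v t1; have [N2 h2] := teval_ext v t2.
  exists (maxn N1 N2) => e e' h /=.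
  by rewrite (h1 e e') ?(h2 e e')// => i iN; apply: h; rewrite leq_max iN ?orbT.
- have [N hN] := choice (fun i => teval_ext v (ts i)).
  exists (\max_i N i) => e e' h /=.
  rewrite (_ : (fun i => teval M v e (ts i)) = (fun i =>
    teval M v e' (ts i)))//.
  apply/funext => i.
  by apply: hN => j jN; apply: h; apply: leq_trans jN _; exact: leq_bigmax.
- by exists N => e e' he /=; have := h _ _ he; tauto.
- exists (maxn N1 N2) => e e' h /=.
  have := h1 e e' (fun i iN => h i (leq_trans iN (leq_maxl _ _))).
  have := h2 e e' (fun i iN => h i (leq_trans iN (leq_maxr _ _))); tauto.
- exists N => e e' he /=.
  have E a : sat M v (fun j => if j == i then a else e j) phi <->
      sat M v (fun j => if j == i then a else e' j) phi.
    by apply: h => j jN; case: eqP => // _; exact: he.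
  by split=> -[a /E ha]; exists a.
Qed.

Fixpoint trename P (r : nat -> nat) (t : term L P) : term L P :=
  match t with
  | Var i => Var L P (r i)
  | Par c => Par L c
  | Zero => Zero L P
  | One => One L P
  | Add t1 t2 => Add (trename r t1) (trename r t2)
  | Opp t1 => Opp (trename r t1)
  | Mul t1 t2 => Mul (trename r t1) (trename r t2)
  | App f ts => App (fun i => trename r (ts i))
  end.

Lemma teval_trename P (v : P -> K) r t e :
  teval M v e (trename r t) = teval M v (e \o r) t.
Proof.
elim: t => //= [t1 -> t2 ->|t1 ->|t1 -> t2 ->|f ts IH] //.
by congr (fint M _); apply/funext.
Qed.

Lemma sat_rename P (v : P -> K) phi r :
  exists psi, forall e, sat M v e psi <-> sat M v (e \o r) phi.
Proof.
elim: phi r => [t1 t2|t1 t2|s ts|phi IH|phi1 IH1 phi2 IH2|i phi IH] r.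
- by exists (Eq (trename r t1) (trename r t2)) => e /=; rewrite !teval_trename.
- by exists (Lt (trename r t1) (trename r t2)) => e /=; rewrite !teval_trename.
- exists (Rel (fun i => trename r (ts i))) => e /=.
  rewrite (_ : (fun i => teval M v e (trename r (ts i))) =
    (fun i => teval M v (e \o r) (ts i)))//.
  by apply/funext => i; rewrite teval_trename.
- by have [psi h] := IH r; exists (Not psi) => e /=; have := h e; tauto.
- have [psi1 h1] := IH1 r; have [psi2 h2] := IH2 r.
  by exists (And psi1 psi2) => e /=; have := h1 e; have := h2 e; tauto.
- have [N hN] := sat_ext v phi.
  (* [m] exceeds the new names of all variables on which [phi] depends, so the quantifier over [m]
     captures none of them. *)
  pose m := (\max_(j < N) r j).+1.
  have [psi h] := IH (fun j => if j == i then m else r j).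
  have E e a : sat M v (fun j => if j == m then a else e j) psi <->
      sat M v (fun j => if j == i then a else (e \o r) j) phi.
    rewrite h; apply: hN => j jN; rewrite /comp; have [_|_] := eqVneq j i.
      by rewrite eqxx.
    rewrite ifN// ltn_eqF// ltnS.
    exact: (@leq_bigmax _ (fun j : 'I_N => r j) (Ordinal jN)).
  by exists (Ex m psi) => e /=; split=> -[a /E ha]; exists a.
Qed.

(* Definability is phrased for predicates, scalars and vectors depending on an
   assignment [e] of the variables.  Quantifiers use de Bruijn indices: the
   bound variable becomes variable 0 (a bound vector, variables 0 to n - 1) and
   the others are shifted, which lets [ddef] follow the syntax. *)
Definition dP (P : (nat -> K) -> Prop) : Prop :=
  exists phi : formula L K, forall e, P e <-> sat M id e phi.

Definition dK (t : (nat -> K) -> K) : Prop :=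
  dP (fun e => e 0%N = t (fun i => e i.+1)).

Definition dV n (v : (nat -> K) -> 'rV[K]_n) : Prop :=
  forall i, dK (fun e => v e 0 i).

Definition dF n (f : 'rV[K]_n -> K) : Prop :=
  definable M [set v : 'rV[K]_n.+1 | v 0 ord0 = f (tl v)].

Lemma dP_iff P Q : (forall e, P e <-> Q e) -> dP P -> dP Q.
Proof. by move=> PQ [phi h]; exists phi => e; rewrite -PQ. Qed.

Lemma dP_not P : dP P -> dP (fun e => ~ P e).
Proof. by move=> [phi h]; exists (Not phi) => e /=; rewrite h. Qed.

Lemma dP_and P Q : dP P -> dP Q -> dP (fun e => P e /\ Q e).
Proof.
by move=> [phi h] [psi k]; exists (And phi psi) => e /=; rewrite h k.
Qed.

Lemma dP_or P Q : dP P -> dP Q -> dP (fun e => P e \/ Q e).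
Proof.
move=> dp dq; apply: dP_iff (dP_not (dP_and (dP_not dp) (dP_not dq))) => e.
by split=> [/not_andP[] /contrapT|[]]; tauto.
Qed.

Lemma dP_imp P Q : dP P -> dP Q -> dP (fun e => P e -> Q e).
Proof.
move=> dp dq; apply: dP_iff (dP_not (dP_and dp (dP_not dq))) => e.
by split=> [/not_andP[|/contrapT]|]; tauto.
Qed.

Lemma dP_iff2 P Q : dP P -> dP Q -> dP (fun e => P e <-> Q e).
Proof. by move=> dp dq; apply: dP_and; apply: dP_imp. Qed.

Lemma dP_cst (Q : Prop) : dP (fun=> Q).
Proof.
case: (pselect Q) => q.
  by exists (Eq (Zero L K) (Zero L K)) => e /=; split.
by exists (Not (Eq (Zero L K) (Zero L K))) => e /=; split.
Qed.

Lemma dP_rename P r : dP P -> dP (fun e => P (fun i => e (r i))).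
Proof.
move=> [phi h]; have [psi k] := sat_rename id phi r.
by exists psi => e; rewrite h k.
Qed.

Lemma dP_ex (P : (nat -> K) -> K -> Prop) :
  dP (fun e => P (fun i => e i.+1) (e 0%N)) -> dP (fun e => exists a, P e a).
Proof.
move=> [phi h]; have [N hN] := sat_ext id phi.
(* The bound variable gets the name [N], which differs from the shifted names of all other variables
   on which [phi] depends. *)
have [psi k] := sat_rename id phi (fun i => if i is j.+1 then j else N).
exists (Ex N psi) => e /=.
have E a : P e a <-> sat M id (fun j => if j == N then a else e j) psi.
  rewrite k (hN _ (fun i => if i is j.+1 then e j else a)) -?h//.
  by case=> [|i] iN /=; rewrite ?eqxx// ltn_eqF// (leq_trans _ iN).
by split=> -[a /E ha]; exists a.
Qed.

Lemma dP_all (P : (nat -> K) -> K -> Prop) :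
  dP (fun e => P (fun i => e i.+1) (e 0%N)) -> dP (fun e => forall a, P e a).
Proof.
move=> dp.
apply: dP_iff (dP_not (dP_ex (P := fun e a => ~ P e a) (dP_not dp))) => e.
by split=> [/forallNP h a|h [a]//]; exact: contrapT.
Qed.

Lemma dP_exv n (P : (nat -> K) -> 'rV[K]_n -> Prop) :
  dP (fun e => P (fun i => e (n + i)%N) (\row_i e i)) ->
  dP (fun e => exists x, P e x).
Proof.
elim: n => [|n IH] in P *.
  apply: dP_iff => e; split=> [h|[x]]; first by exists (\row_i e i).
  rewrite (_ : x = \row_(i < 0) e i)//; first by apply/rowP; case.
move=> dp; apply: (@dP_iff (fun e => exists a, exists x : 'rV_n,
  P e (cns a x))).
  move=> e; split=> [[a [x]]|[x]]; first by exists (cns a x).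
  by rewrite -(cns_tl x); exists (x 0 ord0), (tl x).
apply: dP_ex; apply: IH.
(* At this point the head of the vector is variable [n] and its tail occupies variables 0 to
   [n - 1]; the renaming brings the head back to the front. *)
apply: dP_iff (dP_rename (fun i => if i is j.+1 then
  (if (j < n)%N then j else j.+1) else n) dp) => e.
suff [E1 E2] : (fun i => e (n + i.+1)%N) = (fun i =>
  e (if (n + i < n)%N then (n + i)%N else (n + i).+1))
  /\ cns (e (n + 0)%N) (\row_i e i) =  \row_(i < n.+1) e (if (i :
    nat) is j.+1 then if (j < n)%N then j else j.+1 else n).
  by rewrite E1 E2.
split; first by apply/funext => i /=; rewrite ltnNge leq_addr /= addnS.
apply/rowP; apply/forall_ordS; rewrite cns0 !mxE addn0; split=> // i.
by rewrite cnsS !mxE /= ltn_ord.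
Qed.

Lemma dP_allv n (P : (nat -> K) -> 'rV[K]_n -> Prop) :
  dP (fun e => P (fun i => e (n + i)%N) (\row_i e i)) ->
  dP (fun e => forall x, P e x).
Proof.
move=> dp.
apply: dP_iff (dP_not (dP_exv (P := fun e a => ~ P e a) (dP_not dp))) => e.
by split=> [/forallNP h a|h [a]//]; exact: contrapT.
Qed.

Lemma dP_allo n (P : (nat -> K) -> 'I_n -> Prop) :
  (forall i, dP (fun e => P e i)) -> dP (fun e => forall i, P e i).
Proof.
elim: n P => [|n IH] P h; first by apply: dP_iff (dP_cst True) => e;
  split=> // _ [].
apply: dP_iff (dP_and (h ord0) (IH (fun e i => P e (lift ord0 i)) (fun i =>
  h _))).
by move=> e; rewrite forall_ordS.
Qed.

Lemma dP_cons P t : dP P -> dK t ->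
  dP (fun e => P (fun i => if i is j.+1 then e j else t e)).
Proof.
move=> dp dt.
apply: (@dP_iff (fun e => exists a, a = t e /\
    P (fun i => if i is j.+1 then e j else a))).
  by move=> e; split=> [[a [->]]//|h]; exists (t e).
apply: dP_ex; apply: dP_and => //; apply: dP_iff dp => e.
by rewrite (_ : (fun i => _) = e)//; apply/funext => -[].
Qed.

(** Only the first [N] of the substituted functions matter. They are pushed in front of the
    assignment one at a time, which reduces simultaneous substitution to [dP_cons]; as [s i] ends up
    at position [N - 1 - i], a renaming reverses the order. *)
Lemma dP_comp P (s : nat -> (nat -> K) -> K) : dP P -> (forall i, dK (s i)) ->
  dP (fun e => P (fun i => s i e)).
Proof.
move=> dp ds; case: (dp) => phi h; have [N hN] := sat_ext id phi.
pose E := fix E (k : nat) (e : nat -> K) {struct k} : nat -> K :=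
  if k is k'.+1 then (fun i => if i is j.+1 then E k' e j else s k' e) else e.
have Edrop k e i : E k e (k + i)%N = e i by elim: k => //= k ->.
have EE k e i : (i < k)%N -> E k e (k.-1 - i)%N = s i e.
  elim: k i => //= k IH i; rewrite ltnS leq_eqVlt => /predU1P[->|ik].
    by rewrite subnn.
  by case: k IH ik => // k IH ik; rewrite subSn//; exact: IH.
have dE k Q : dP Q -> dP (fun e => Q (E k e)).
  elim: k Q => //= k IH Q dQ.
  pose t e := s k (fun i => e (k + i)%N).
  have dt : dK t.
    apply: dP_iff (dP_rename (fun i => if i is j.+1 then (k + j).+1 else 0%N)
      (ds k)).
    by move=> e /=; rewrite /t.
  apply: dP_iff (IH _ (dP_cons dQ dt)) => e.
  rewrite (_ : t (E k e) = s k e)// /t; congr (s k _).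
  by apply/funext => i; rewrite Edrop.
apply: dP_iff (dE N _ (dP_rename (fun i => N.-1 - i)%N dp)) => e.
by rewrite !h; apply: hN => i iN; rewrite EE.
Qed.

Lemma dK_comp t (s : nat -> (nat -> K) -> K) : dK t -> (forall i, dK (s i)) ->
  dK (fun e => t (fun i => s i e)).
Proof.
move=> dt ds.
pose s' i := if i is j.+1 then (fun e => s j (fun i => e i.+1))
  else (fun e : nat -> K => e 0%N).
have ds' i : dK (s' i).
  case: i => [|i] /=; first by exists (Eq (Var _ _ 0%N) (Var _ _ 1%N)).
  apply: dP_iff (dP_rename (fun i => if i is j.+1 then j.+2 else 0%N) (ds i)).
  by move=> e.
exact: dP_comp dt ds'.
Qed.

Lemma dK_var k : dK (fun e => e k).
Proof. by exists (Eq (Var _ _ 0%N) (Var _ _ k.+1)). Qed.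

Lemma dK_cst c : dK (fun=> c).
Proof. by exists (Eq (Var _ _ 0%N) (Par _ c)). Qed.

Lemma dK_op1 (F : K -> K) t :
  dP (fun e => e 0%N = F (e 1%N)) -> dK t -> dK (fun e => F (t e)).
Proof.
move=> dFF dt.
by apply: (@dK_comp (fun e => F (e 0%N)) (fun _ => t)).
Qed.

Lemma dK_op2 (F : K -> K -> K) t u :
  dP (fun e => e 0%N = F (e 1%N) (e 2%N)) -> dK t -> dK u ->
  dK (fun e => F (t e) (u e)).
Proof.
move=> dFF dt du.
apply: (@dK_comp (fun e => F (e 0%N) (e 1%N)) (fun i =>
  if i is 0%N then t else u)) => //.
by case.
Qed.

Lemma dK_add t u : dK t -> dK u -> dK (fun e => t e + u e).
Proof.
apply: dK_op2.
by exists (Eq (Var _ _ 0%N) (Add (Var _ _ 1%N) (Var _ _ 2%N))).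
Qed.

Lemma dK_mul t u : dK t -> dK u -> dK (fun e => t e * u e).
Proof.
apply: dK_op2.
by exists (Eq (Var _ _ 0%N) (Mul (Var _ _ 1%N) (Var _ _ 2%N))).
Qed.

Lemma dK_opp t : dK t -> dK (fun e => - t e).
Proof. by apply: dK_op1; exists (Eq (Var _ _ 0%N) (Opp (Var _ _ 1%N))). Qed.

Lemma dP_rel2 (F : K -> K -> Prop) t u :
  dP (fun e => F (e 0%N) (e 1%N)) -> dK t -> dK u -> dP (fun e => F (t e)
    (u e)).
Proof.
move=> dFF dt du.
apply: (@dP_comp (fun e => F (e 0%N) (e 1%N)) (fun i =>
  if i is 0%N then t else u)) => //.
by case.
Qed.

Lemma dP_eq t u : dK t -> dK u -> dP (fun e => t e = u e).
Proof.
by apply: (dP_rel2 (F := fun a b => a = b)); exists (Eq (Var _ _ 0%N)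
  (Var _ _ 1%N)).
Qed.

Lemma dP_lt t u : dK t -> dK u -> dP (fun e => t e < u e).
Proof.
by apply: (dP_rel2 (F := fun a b => a < b)); exists (Lt (Var _ _ 0%N)
  (Var _ _ 1%N)).
Qed.

Lemma dP_le t u : dK t -> dK u -> dP (fun e => t e <= u e).
Proof.
move=> dt du; apply: dP_iff (dP_not (dP_lt du dt)) => e.
by rewrite leNgt; split=> /negP.
Qed.

Lemma dP_andb P Q : dP (fun e => is_true (P e)) -> dP (fun e =>
  is_true (Q e)) ->
  dP (fun e => is_true (P e && Q e)).
Proof.
by move=> dp dq; apply: dP_iff (dP_and dp dq) => e; split=> /andP.
Qed.

Lemma dK_inv t : dK t -> dK (fun e => (t e)^-1).
Proof.
apply: dK_op1.
apply: (@dP_iff (fun e => e 1%N = 0 /\ e 0%N = 0 \/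
    ~ (e 1%N = 0) /\ e 0%N * e 1%N = 1)).
  move=> e; split=> [[[-> ->]|[/eqP h1 h2]]|->]; first by rewrite invr0.
    by rewrite -[LHS](mulfK h1) h2 mul1r.
  by have [->|h] := eqVneq (e 1%N) 0; [left; rewrite invr0|right;
    rewrite mulVf//;
    split=> //; exact/eqP].
apply: dP_or; apply: dP_and; first by apply: dP_eq;
  [exact: dK_var|exact: dK_cst].
- by apply: dP_eq; [exact: dK_var|exact: dK_cst].
- by apply: dP_not; apply: dP_eq; [exact: dK_var|exact: dK_cst].
- by apply: dP_eq; [apply: dK_mul; exact: dK_var|exact: dK_cst].
Qed.

Lemma dK_norm t : dK t -> dK (fun e => `|t e|).
Proof.
apply: dK_op1.
apply: (@dP_iff (fun e => 0 <= e 1%N /\ e 0%N = e 1%N \/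
    e 1%N < 0 /\ e 0%N = - e 1%N)).
  move=> e; split=> [[[h ->]|[h ->]]|->]; first by rewrite ger0_norm.
    by rewrite ltr0_norm.
  by case: ger0P => h; [left|right].
apply: dP_or; apply: dP_and; first by apply: dP_le;
  [exact: dK_cst|exact: dK_var].
- by apply: dP_eq; exact: dK_var.
- by apply: dP_lt; [exact: dK_var|exact: dK_cst].
- by apply: dP_eq; [exact: dK_var|apply: dK_opp; exact: dK_var].
Qed.

Lemma dV_add n (v w : _ -> 'rV[K]_n) : dV v -> dV w -> dV (fun e => v e + w e).
Proof.
move=> dv dw i; apply: dP_iff (dK_add (dv i) (dw i)) => e; by rewrite mxE.
Qed.

Lemma dV_opp n (v : _ -> 'rV[K]_n) : dV v -> dV (fun e => - v e).
Proof. by move=> dv i; apply: dP_iff (dK_opp (dv i)) => e; rewrite mxE. Qed.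

Lemma dV_scale n t (v : _ -> 'rV[K]_n) : dK t -> dV v -> dV (fun e =>
  t e *: v e).
Proof.
by move=> dt dv i; apply: dP_iff (dK_mul dt (dv i)) => e; rewrite mxE.
Qed.

Lemma dV_cst n (v : 'rV[K]_n) : dV (fun=> v).
Proof. by move=> i; exact: dK_cst. Qed.

Lemma dK_coord n (v : _ -> 'rV[K]_n) i : dV v -> dK (fun e => v e 0 i).
Proof. exact. Qed.

Lemma dV_row n (t : (nat -> K) -> 'I_n -> K) :
  (forall i, dK (fun e => t e i)) -> dV (fun e => \row_i t e i).
Proof. by move=> dt i; apply: dP_iff (dt i) => e; rewrite mxE. Qed.

Lemma dV_cns n t (v : _ -> 'rV[K]_n) : dK t -> dV v -> dV (fun e => cns (t e)
  (v e)).
Proof.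
move=> dt dv; apply/forall_ordS; split=> [|i].
  by apply: dP_iff dt => e; rewrite cns0.
by apply: dP_iff (dv i) => e; rewrite cnsS.
Qed.

Lemma dV_tl n (v : _ -> 'rV[K]_n.+1) : dV v -> dV (fun e => tl (v e)).
Proof. by move=> dv i; apply: dP_iff (dv (lift ord0 i)) => e; rewrite mxE. Qed.

Lemma dP_eqv n (v w : _ -> 'rV[K]_n) : dV v -> dV w -> dP (fun e => v e = w e).
Proof.
move=> dv dw; apply: dP_iff (dP_allo (fun i => dP_eq (dv i) (dw i))) => e.
by split=> [/rowP|->].
Qed.

Lemma dP_set n (S : set 'rV[K]_n) v : definable M S -> dV v -> dP (fun e =>
  S (v e)).
Proof.
move=> [phi ->] dv.
apply: (@dP_comp (fun e => sat M id e phi) (fun i e => row_env (v e) i)).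
  by exists phi.
by move=> i; rewrite /row_env; case: insubP => [j _ _|_];
  [exact: dv|exact: dK_cst].
Qed.

Lemma definableP n (S : set 'rV[K]_n) :
  dP (fun e => S (\row_i e i)) -> definable M S.
Proof.
move=> [phi h]; exists phi; apply/seteqP; split=> x /=; rewrite -h;
  (rewrite (_ : \row_i _ = x)//; apply/rowP => i; rewrite mxE /row_env valK//).
Qed.

Lemma dK_app n (f : 'rV[K]_n -> K) v : dF f -> dV v -> dK (fun e => f (v e)).
Proof.
move=> df dv.
have dw : dV (fun e => cns (e 0%N) (v (fun i => e i.+1))).
  apply: dV_cns; first exact: dK_var.
  move=> i.
  apply: dP_iff (dP_rename (fun i => if i is j.+1 then j.+2 else 0%N) (dv i)).
  by move=> e.
by apply: dP_iff (dP_set df dw) => e /=; rewrite cns0 tl_cns.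
Qed.

Lemma dF_intro n (f : 'rV[K]_n -> K) : dK (fun e => f (\row_i e i)) -> dF f.
Proof.
move=> df; apply: definableP; apply: dP_iff df => e /=.
rewrite mxE (_ : tl _ = \row_i e i.+1)//; apply/rowP => i.
by rewrite !mxE.
Qed.

Lemma dP_box n (v w : _ -> 'rV[K]_n) t : dV v -> dK t -> dV w ->
  dP (fun e => box (v e) (t e) (w e)).
Proof.
move=> dv dt dw; apply: dP_allo => i; apply: dP_lt => //; apply: dK_norm.
by apply: dK_add; [exact: dw|apply: dK_opp; exact: dv].
Qed.

End Definability.

(** Proves definability by recursion on the syntax of the goal. [dP_imp] is tried before [dP_all],
    as an implication also has the form [forall x : _, _]. *)
Ltac ddstep :=
  first
  [ assumption
  | lazymatch goal with
    | |- dP _ (fun e => _ /\ _) => apply: dP_and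
    | |- dP _ (fun e => _ \/ _) => apply: dP_or
    | |- dP _ (fun e => ~ _) => apply: dP_not
    | |- dP _ (fun e => _ <-> _) => apply: dP_iff2
    | |- dP _ (fun e => is_true (_ && _)) => apply: dP_andb
    | |- dP _ (fun e => is_true (_ < _)) => apply: dP_lt
    | |- dP _ (fun e => is_true (_ <= _)) => apply: dP_le
    | |- dP _ (fun e => box _ _ _) => apply: dP_box
    | |- dP _ (fun e => @eq (matrix _ _ _) _ _) => apply: dP_eqv
    | |- dP _ (fun e => @eq _ _ _) => apply: dP_eq
    | |- dP _ (fun e => exists x : matrix _ _ _, _) => apply: dP_exv
    | |- dP _ (fun e => exists x : _, _) => apply: dP_ex
    | |- dP _ (fun e => forall x : matrix _ _ _, _) => apply: dP_allv
    | |- dP _ (fun e => forall x : ordinal _, _) => apply: dP_allo => ?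
    | |- dP _ (fun e => forall x : _, _) =>
      first [apply: dP_imp | apply: dP_all]
    | |- dK _ (fun e => _ + _) => apply: dK_add
    | |- dK _ (fun e => - _) => apply: dK_opp
    | |- dK _ (fun e => _ * _) => apply: dK_mul
    | |- dK _ (fun e => _^-1) => apply: dK_inv
    | |- dK _ (fun e => `|_|) => apply: dK_norm
    | |- dK _ (fun e => fun_of_matrix _ _ ?i) => apply: dK_coord
    | |- dK _ (fun e => e _) => apply: dK_var
    | |- dV _ (fun e => cns _ _) => apply: dV_cns
    | |- dV _ (fun e => tl _) => apply: dV_tl
    | |- dV _ (fun e => _ + _) => apply: dV_add
    | |- dV _ (fun e => - _) => apply: dV_opp
    | |- dV _ (fun e => _ *: _) => apply: dV_scale
    | |- dV _ (fun e => \row_i _) => apply: dV_row => ?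
    end
  | apply: dP_cst | apply: dK_cst | apply: dV_cst
  | (eapply dK_app; [eassumption|])
  | (eapply dP_set; [eassumption|]) ].
Ltac ddef := rewrite /=; repeat ddstep.

(** * Definable subsets of the line *)

Lemma countable_setU T (A B : set T) :
  countable A -> countable B -> countable (A `|` B).
Proof.
move=> cA cB; rewrite -bigcup2E; apply: bigcup_countable => // i _.
by rewrite /bigcup2; case: i => [|[|i]] /=.
Qed.

(** * Formulas over a countable set of parameters *)

Section RestrictParameters.
Context {L : language} {K : realFieldType} (M : structure L K).

(** Definability allows all of [K] as parameters, saturation only a countable set of them.
    Countability survives the union over a sequence of formulas, and quantifying over [C'] lets all
    of these share one parameter set. *)
Lemma term_restrict (t : term L K) : exists2 C : set K, countable C &
  forall C' : set K, C `<=` C' ->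
    exists u : term L C', forall e, teval M set_val e u = teval M id e t.
Proof.
elim: t => [i|c|||t1 [C1 c1 h1] t2 [C2 c2 h2]|t1 [C1 c1 h1]|t1 [C1 c1 h1] t2
  [C2 c2 h2]|f ts IH].
- by exists set0 => // C' _; exists (Var _ _ i).
- exists [set c]; first exact: finite_set_countable.
  move=> C' /(_ c erefl) cC; exists (Par L (SigSub (mem_set cC))) => e //.
- by exists set0 => // C' _; exists (Zero _ _).
- by exists set0 => // C' _; exists (One _ _).
- exists (C1 `|` C2); first by exact: countable_setU.
  move=> C'; rewrite subUset => -[/h1[u1 e1] /h2[u2 e2]]; exists (Add u1 u2) =>
    e /=.
  by rewrite e1 e2.
- by exists C1 => // C' /h1[u1 e1]; exists (Opp u1) => e /=; rewrite e1.
- exists (C1 `|` C2); first by exact: countable_setU.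
  move=> C'; rewrite subUset => -[/h1[u1 e1] /h2[u2 e2]]; exists (Mul u1 u2) =>
    e /=.
  by rewrite e1 e2.
- have /choice[C hC] : forall i, exists C : set K, countable C /\
      forall C' : set K, C `<=` C' ->
      exists u : term L C', forall e, teval M set_val e u = teval M id e (ts i).
    by move=> i; have [C cC h] := IH i; exists C.
  exists (\bigcup_i C i).
    by apply: bigcup_countable => // i _; case: (hC i).
  move=> C' CC'.
  have /choice[u hu] : forall i, exists u : term L C', forall e,
      teval M set_val e u = teval M id e (ts i).
    by move=> i; case: (hC i) => _; apply; apply: subset_trans CC' => x;
      exists i.
  exists (App u) => e /=; congr (fint M _); apply/funext => i; exact: hu.
Qed.

Lemma formula_restrict (phi : formula L K) : exists2 C : set K, countable C &
  forall C' : set K, C `<=` C' ->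
    exists psi : formula L C', forall e, sat M set_val e psi <-> sat M id e phi.
Proof.
elim: phi => [t1 t2|t1 t2|r ts|phi [C c h]|phi1 [C1 c1 h1] phi2 [C2 c2 h2]|i
  phi [C c h]].
- have [C1 c1 h1] := term_restrict t1; have [C2 c2 h2] := term_restrict t2.
  exists (C1 `|` C2); first by exact: countable_setU.
  move=> C'; rewrite subUset => -[/h1[u1 e1] /h2[u2 e2]]; exists (Eq u1 u2) =>
    e /=.
  by rewrite e1 e2.
- have [C1 c1 h1] := term_restrict t1; have [C2 c2 h2] := term_restrict t2.
  exists (C1 `|` C2); first by exact: countable_setU.
  move=> C'; rewrite subUset => -[/h1[u1 e1] /h2[u2 e2]]; exists (Lt u1 u2) =>
    e /=.
  by rewrite e1 e2.
- have /choice[C hC] : forall i, exists C : set K, countable C /\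
      forall C' : set K, C `<=` C' ->
      exists u : term L C', forall e, teval M set_val e u = teval M id e (ts i).
    by move=> i; have [C cC h] := term_restrict (ts i); exists C.
  exists (\bigcup_i C i).
    by apply: bigcup_countable => // i _; case: (hC i).
  move=> C' CC'.
  have /choice[u hu] : forall i, exists u : term L C', forall e,
      teval M set_val e u = teval M id e (ts i).
    by move=> i; case: (hC i) => _; apply; apply: subset_trans CC' => x;
      exists i.
  exists (Rel u) => e /=.
  rewrite (_ : (fun i => teval M set_val e (u i)) = (fun i =>
    teval M id e (ts i)))//.
  by apply/funext => i; exact: hu.
- by exists C => // C' /h[psi k]; exists (Not psi) => e /=; have := k e; tauto.
- exists (C1 `|` C2); first by exact: countable_setU.
  move=> C'; rewrite subUset => -[/h1[u1 e1] /h2[u2 e2]]; exists (And u1 u2) =>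
    e /=.
  by have := e1 e; have := e2 e; tauto.
- exists C => // C' /h[psi k]; exists (Ex i psi) => e /=.
  by split=> -[a /k ha]; exists a.
Qed.

End RestrictParameters.

Section OneVariable.
Context {L : language} {K : realFieldType} (M : structure L K).

Definition D1 (S : K -> Prop) : Prop := dP M (fun e => S (e 0%N)).

Lemma dP_D1 S t : D1 S -> dK M t -> dP M (fun e => S (t e)).
Proof. by move=> dS dt; apply: (dP_comp (s := fun=> t) dS). Qed.

Lemma D1_definable1 S : D1 S -> definable1 M S.
Proof. by move=> dS; apply: definableP; apply: dP_iff dS => e /=;
  rewrite mxE. Qed.

(** The formulas have countably many parameters altogether, and by monotonicity any finitely many of
    the conditions follow from the one of greatest index; so saturation applies. *)
Lemma sat_sequence (X : nat -> K -> Prop) : aleph1_saturated M ->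
  (forall m, D1 (X m)) -> (forall m x, X m.+1 x -> X m x) ->
  (forall m, exists x, X m x) -> exists x, forall m, X m x.
Proof.
move=> asat dX Xdecr Xne.
have Xle m k x : (m <= k)%N -> X k x -> X m x.
  by move=> /subnK <-; elim: (k - m)%N => // j IH /Xdecr.
have /choice[phi hphi] := dX.
have /choice[C hC] : forall m, exists C : set K, countable C /\
    forall C' : set K, C `<=` C' -> exists psi : formula L C',
      forall e, sat M set_val e psi <-> sat M id e (phi m).
  by move=> m; have [D cD h] := formula_restrict M (phi m); exists D.
pose C' := \bigcup_m C m.
have cC' : countable C' by apply: bigcup_countable => // i _; case: (hC i).
have /choice[psi hpsi] : forall m, exists psi : formula L C',
      forall e, sat M set_val e psi <-> sat M id e (phi m).
  by move=> m; case: (hC m) => _; apply; move=> x; exists m.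
have E m x : sat M set_val (row_env (const_mx x : 'rV[K]_1)) (psi m) <-> X m x.
  by rewrite hpsi -hphi /row_env; case: insubP => //= i _ _; rewrite mxE.
have [|x hx] := asat C' (range psi) cC'; last first.
  by exists x => m; apply/E; apply: hx; exists m.
move=> F finF Fp.
have /choice[m hm] : forall f, exists m, F f -> f = psi m.
  move=> f; have [/Fp[m _ <-]|nF] := pselect (F f); first by exists m.
  by exists 0%N.
have /finite_seqP[s hs] := finite_image m finF.
have [x hx] := Xne (\max_(k <- s) k)%N.
exists x => f Ff; rewrite (hm _ Ff); apply/E; apply: Xle hx.
have : m f \in s by suff : [set` s] (m f) by []; rewrite -hs; exists f.
by move=> ms; exact: leq_bigmax_seq.
Qed.

(** Applied to the inverses of the positive integers it gives a positive infinitesimal; applied to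
    countably many margins, a common margin. *)
Lemma coinitial (c : nat -> K) : aleph1_saturated M -> (forall m, 0 < c m) ->
  exists2 d, 0 < d & forall m, d <= c m.
Proof.
move=> asat c0.
have [||m|d hd] := @sat_sequence
    (fun m x => 0 < x /\ forall k : 'I_m.+1, x <= c k) asat.
- move=> m; rewrite /D1; ddef.
- move=> m x [x0 h]; split=> // k.
  by have := h (widen_ord (leqnSn _) k).
- elim: m => [|m [x [x0 hx]]].
    by exists (c 0%N); split=> // k; rewrite (ord1 k).
  exists (Num.min x (c m.+1)); split; first by rewrite lt_min x0 c0.
  move=> k; rewrite ge_min; have [km|mk] := ltnP k m.+1.
    by rewrite (hx (Ordinal km)).
  by rewrite (_ : nat_of_ord k = m.+1) ?lexx ?orbT//; apply/eqP;
    rewrite eqn_leq mk -ltnS ltn_ord.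
- exists d; first by case: (hd 0%N).
  by move=> m; case: (hd m) => _ /(_ ord_max).
Qed.

(** Coordinates are chosen one at a time: some first coordinate is compatible with all the sets, and
    the fibres over it again form a decreasing sequence of nonempty sets. *)
Lemma sat_sequence_row n (X : nat -> 'rV[K]_n -> Prop) : aleph1_saturated M ->
  (forall m, definable M (X m)) -> (forall m x, X m.+1 x -> X m x) ->
  (forall m, exists x, X m x) -> exists x, forall m, X m x.
Proof.
move=> asat; elim: n X => [|n IH] X dX Xdecr Xne.
  exists 0 => m; have [x] := Xne m.
  by rewrite (_ : x = 0)//; apply/rowP; case.
have [|||t ht] := @sat_sequence (fun m t => exists x, X m (cns t x)) asat.
- by move=> m; have dXm := dX m; rewrite /D1; ddef.
- by move=> m t [x /Xdecr]; exists x.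
- by move=> m; have [x] := Xne m; rewrite -(cns_tl x); exists (x 0 ord0),
    (tl x).
have [|||x hx] := IH (fun m x => X m (cns t x)).
- by move=> m; have dXm := dX m; apply: definableP; ddef.
- by move=> m x /Xdecr.
- by [].
by exists (cns t x).
Qed.

(** The germ of [Q] to the right of [a] is decided. Such [Q] are closed under Boolean operations and
    include the rays, hence all finite unions of intervals. *)
Definition cstR (Q : K -> Prop) (a : K) := exists2 r : K, 0 < r &
  (forall t, a < t < a + r -> Q t) \/ (forall t, a < t < a + r -> ~ Q t).

Lemma cstR_not Q a : cstR Q a -> cstR (fun t => ~ Q t) a.
Proof.
by move=> [r r0 [h|h]]; exists r => //; [right=> t /h ?; apply|left].
Qed.

Lemma cstR_and P Q a : cstR P a -> cstR Q a -> cstR (fun t => P t /\ Q t) a.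
Proof.
move=> [r r0 hP] [s s0 hQ].
have E t : a < t < a + Num.min r s -> (a < t < a + r) && (a < t < a + s).
  by move=> /andP[-> /=]; rewrite -!ltrBlDl lt_min.
exists (Num.min r s); first by rewrite lt_min r0.
case: hP hQ => [hP|hP] [hQ|hQ]; [left|right|right|right] => t /E /andP[t1 t2].
- by split; [exact: hP|exact: hQ].
- by move=> [_]; exact: hQ.
- by move=> [+ _]; exact: hP.
- by move=> [+ _]; exact: hP.
Qed.

Lemma cstR_iff P Q a : (forall t, P t <-> Q t) -> cstR P a -> cstR Q a.
Proof.
by move=> PQ [r r0 [h|h]]; exists r => //; [left|right] => t /h; rewrite PQ.
Qed.

Lemma cstR_or P Q a : cstR P a -> cstR Q a -> cstR (fun t => P t \/ Q t) a.
Proof.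
move=> hP hQ; have := cstR_not (cstR_and (cstR_not hP) (cstR_not hQ)).
by apply: cstR_iff => t; split=> [/not_andP[] /contrapT|[]]; tauto.
Qed.

Lemma cstR_cst (Q : Prop) a : cstR (fun=> Q) a.
Proof. by exists 1 => //; have [q|q] := pselect Q; [left|right]. Qed.

Lemma cstR_lt c a : cstR (fun t => t < c) a.
Proof.
have [ac|ca] := ltP a c.
  exists (c - a); first by rewrite subr_gt0.
  by left=> t /andP[_]; rewrite addrC subrK.
by exists 1 => //; right=> t /andP[/(le_lt_trans ca)/ltW]; rewrite leNgt =>
  /negP.
Qed.

Lemma cstR_le c a : cstR (fun t => t <= c) a.
Proof.
have [ac|ca] := ltP a c.
  exists (c - a); first by rewrite subr_gt0.
  by left=> t /andP[_]; rewrite addrC subrK => /ltW.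
by exists 1 => //; right=> t /andP[/(le_lt_trans ca)]; rewrite ltNge => /negP.
Qed.

Lemma cstR_itv (I : interval K) a : cstR (fun t => t \in I) a.
Proof.
have neg Q : cstR (fun t => ~ Q t) a -> cstR Q a.
  move=> /cstR_not; apply: cstR_iff => t; split=> [/contrapT|]//; tauto.
case: I => l u; apply: (@cstR_iff (fun t => t \in Interval l +oo%O /\
    t \in Interval -oo%O u)).
  by move=> t; rewrite [in X in _ <-> X]itv_splitI; split=> /andP.
apply: cstR_and.
  case: l => [[] c|[]].
  - apply: neg; apply: cstR_iff (cstR_lt c a) => t.
    by rewrite in_itv/= andbT ltNge; split=> /negP.
  - apply: neg; apply: cstR_iff (cstR_le c a) => t.
    by rewrite in_itv/= andbT leNgt; split=> /negP.
  - by apply: cstR_iff (cstR_cst True a) => t; rewrite in_itv.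
  - by apply: cstR_iff (cstR_cst False a) => t; rewrite in_itv.
case: u => [[] c|[]].
- by apply: cstR_iff (cstR_lt c a) => t; rewrite in_itv.
- by apply: cstR_iff (cstR_le c a) => t; rewrite in_itv.
- by apply: cstR_iff (cstR_cst False a) => t; rewrite in_itv.
- by apply: cstR_iff (cstR_cst True a) => t; rewrite in_itv.
Qed.

Definition isup (S : K -> Prop) (a : K) :=
  (forall t, S t -> t <= a) /\ (forall b, (forall t, S t -> t <= b) -> a <= b).

(** [K] need not be complete, so suprema have to be read off from endpoints: a nonempty interval
    which is bounded above has its right endpoint as supremum. *)
Lemma isup_itv (I : interval K) : [\/ forall t, ~ t \in I,
  forall b, exists2 t, t \in I & b < t | exists a, isup (fun t => t \in I) a].
Proof.
have [|/existsNP[x /contrapT xI]] := pselect (forall t, ~ t \in I); first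
  by apply: Or31.
case: I xI => l u; rewrite itv_splitI => /andP[xl xu].
have up y : x <= y -> y \in Interval -oo%O u -> y \in Interval l u.
  move=> xy yu; rewrite itv_splitI yu andbT.
  case: l xl => [[] c|[]]; rewrite !in_itv /= ?andbT //.
    by move=> cx; exact: le_trans xy.
  by move=> cx; exact: lt_le_trans xy.
(* If the endpoint [c] were not the supremum, some upper bound [z < c] would be exceeded by
   [(z + c) / 2], a point of the interval. *)
have mid c : isup (fun t => t \in Interval l u) c \/ 
    (exists2 z, z < c & forall t, t \in Interval l u -> t <= z) \/
    exists2 t, t \in Interval l u & c < t.
  case: (pselect (forall t, t \in Interval l u -> t <= c)) => [h1|]; last first.
    by move=> /existsNP[t] /not_implyP[tI /negP]; rewrite -ltNge; right; right;
      exists t.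
  case: (pselect (exists2 z, z < c & forall t, t \in Interval l u -> t <= z)).
    by right; left.
  move=> h2; left; split=> // b hb; rewrite leNgt; apply/negP => bc.
  by apply: h2; exists b.
case: u xu up mid => [[] c|[]] xu up mid.
- apply: Or33; exists c; case: (mid c) => // -[[z zc hz]|[t]]; last first.
    by rewrite itv_splitI in_itv/= => /andP[_]; rewrite in_itv/=; lra.
  have xz : x <= z by apply: hz; apply: up.
  have : (z + c) / 2 <= z by apply: hz; apply: up; rewrite ?in_itv/=; lra.
  lra.
- apply: Or33; exists c; case: (mid c) => // -[[z zc hz]|[t]]; last first.
    by rewrite itv_splitI in_itv/= => /andP[_]; rewrite in_itv/=; lra.
  have xz : x <= z by apply: hz; apply: up.
  have : (z + c) / 2 <= z by apply: hz; apply: up; rewrite ?in_itv/=; lra.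
  lra.
- by move: xu; rewrite in_itv.
- apply: Or32 => b; exists (Num.max x (b + 1)); last
    by rewrite lt_max ltrDl ltr01 orbT.
  by apply: up; rewrite ?in_itv// le_max lexx.
Qed.

Lemma isup_union (s : seq (interval K)) : [\/ forall t, ~ has (fun I =>
  t \in I) s,
  forall b, exists2 t, has (fun I => t \in I) s & b < t |
  exists a, isup (fun t => has (fun I => t \in I) s) a].
Proof.
elim: s => [|I s IH] /=; first by apply: Or31.
case: (isup_itv I) => [h|h|[a [a1 a2]]].
- case: IH => [k|k|[b [b1 b2]]].
  + by apply: Or31 => t /orP[/h|/k].
  + by apply: Or32 => b; have [t ts bt] := k b; exists t => //; rewrite ts orbT.
  + apply: Or33; exists b; split=> [t /orP[/h//|/b1//]|c hc].
    by apply: b2 => t ts; apply: hc; rewrite ts orbT.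
- by apply: Or32 => b; have [t ts bt] := h b; exists t => //; rewrite ts.
- case: IH => [k|k|[b [b1 b2]]].
  + apply: Or33; exists a; split=> [t /orP[/a1//|/k//]|c hc].
    by apply: a2 => t ts; apply: hc; rewrite ts.
  + by apply: Or32 => b; have [t ts bt] := k b; exists t => //; rewrite ts orbT.
  + apply: Or33; exists (Num.max a b); split=> [t|c hc].
      by rewrite le_max => /orP[/a1 ->//|/b1 ->]; rewrite orbT.
    rewrite ge_max; apply/andP; split; [apply: a2|apply: b2] => t ts; apply: hc;
    by rewrite ts ?orbT.
Qed.

Lemma itv_open_or_point (I : interval K) :
  (exists a b, a < b /\ forall t, a < t < b -> t \in I) \/
  (exists c, forall t, t \in I -> t = c).
Proof.
case: I => [[bl l|[]] [br u|[]]].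
- have [lu|ul] := ltP l u.
    left; exists l, u; split=> // t /andP[lt tu]; rewrite in_itv/=.
    by case: bl; case: br; rewrite /= ?lt ?tu ?(ltW lt) ?(ltW tu).
  right; exists l => t; rewrite in_itv/= => /andP[h1 h2].
  by case: bl br h1 h2 => [] [] /=; lra.
- by right; exists 0 => t; rewrite in_itv /= andbF.
- left; exists l, (l + 1); split=> [|t /andP[lt _]]; first by rewrite ltrDl.
  by rewrite in_itv/= andbT; case: bl; rewrite /= ?ltW.
- left; exists (u - 1), u; split=> [|t /andP[_ tu]]; first
    by rewrite ltrBlDr ltrDl.
  by rewrite in_itv/=; case: br; rewrite /= ?ltW.
- by right; exists 0 => t; rewrite in_itv /=.
- by left; exists 0, 1; split=> // t _; rewrite in_itv.
- by right; exists 0 => t; rewrite in_itv.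
- by right; exists 0 => t; rewrite in_itv.
- by right; exists 0 => t; rewrite in_itv.
Qed.

Definition open_in (S : K -> Prop) :=
  exists a b, a < b /\ forall t, a < t < b -> S t.

Definition fin (S : K -> Prop) := exists s : seq K, forall t, S t -> t \in s.

Lemma fin_itv a b : a < b -> ~ fin (fun t => a < t < b).
Proof.
move=> ab [s hs].
pose f (n : nat) := a + (b - a) / (n.+2%:R).
have finj : injective f.
  move=> m n /addrI /(mulfI _); rewrite subr_eq0 gt_eqF// => /(_ isT) /invr_inj.
  by move=> /eqP; rewrite eqr_nat => /eqP [].
have fs n : f n \in s.
  apply: hs; rewrite /f; apply/andP; split.
    by rewrite ltrDl divr_gt0 ?subr_gt0.
  rewrite -ltrBrDl -[ltRHS]mulr1 ltr_pM2l ?subr_gt0// invf_lt1 ?ltr0n//.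
  by rewrite ltr1n.
have : (size (map f (iota 0 (size s).+1)) <= size s)%N.
  apply: uniq_leq_size; first by rewrite map_inj_uniq ?iota_uniq.
  by move=> _ /mapP[n _ ->].
by rewrite size_map size_iota ltnn.
Qed.

(** * Suprema, boundaries and definable connectedness on the line *)

Section OMinimal.
Hypothesis omin : o_minimal M.

Lemma D1_itvs S : D1 S -> exists s : seq (interval K),
  forall t, S t <-> has (fun I => t \in I) s.
Proof.
move=> /D1_definable1/omin[s hs]; exists s => t; split.
  rewrite hs => -[I /= Is tI].
  by apply/hasP; exists I.
by move=> /hasP[I Is tI]; rewrite hs; exists I.
Qed.

Lemma D1_cstR S a : D1 S -> cstR S a.
Proof.
move=> /D1_itvs[s hs]; apply: (@cstR_iff (fun t => has (fun I => t \in I) s)).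
  by move=> t; rewrite hs.
elim: s {hs} => [|I s IH] /=; first by apply: cstR_iff (cstR_cst False a).
by apply: cstR_iff (cstR_or (cstR_itv I a) IH) => t; split=> /orP.
Qed.

Lemma D1_fin S : D1 S -> open_in S \/ fin S.
Proof.
move=> /D1_itvs[s hs].
suff [[a [b [ab h]]]|[r h]] : open_in (fun t => has (fun I => t \in I) s) \/
    fin (fun t => has (fun I => t \in I) s).
- by left; exists a, b; split=> // t /h; rewrite hs.
- by right; exists r => t; rewrite hs; exact: h.
elim: s {hs} => [|I s [[a [b [ab h]]]|[r h]]] /=; first by right; exists [::].
  by left; exists a, b; split=> // t /h ->; rewrite orbT.
case: (itv_open_or_point I) => [[a [b [ab k]]]|[c k]].
  by left; exists a, b; split=> // t /k ->.
by right; exists (c :: r) => t /orP[/k ->|/h tr]; rewrite inE ?eqxx// tr orbT.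
Qed.

Lemma D1_sup S t0 b : D1 S -> S t0 -> (forall t, S t -> t <= b) ->
  exists a, isup S a.
Proof.
move=> /D1_itvs[s hs] St0 hb; case: (isup_union s) => [h|h|[a [a1 a2]]].
- by move: St0; rewrite hs => /h.
- by have [t /hs/hb] := h b; rewrite leNgt => /negP.
- exists a; split=> [t /hs/a1//|c hc]; apply: a2 => t /hs; exact: hc.
Qed.

Lemma isup_lt S a t : isup S a -> t < a -> exists2 s, S s & t < s.
Proof.
move=> [_ h] ta; apply: contrapT => /forall2NP k.
have : a <= t by apply: h => s Ss; case: (k s) => // /negP; rewrite -leNgt.
lra.
Qed.

Definition bd (S : K -> Prop) (t : K) := forall r : K, 0 < r ->
  (exists s : K, `|s - t| < r /\ S s) /\ (exists s : K, `|s - t| < r /\ ~ S s).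

Lemma D1_bd S : D1 S -> D1 (bd S).
Proof.
move=> dS; rewrite /D1 /bd.
have dS' k : dP M (fun e => S (e k)) by apply: dP_D1 => //; ddef.
ddef; exact: dS'.
Qed.

(** If boundary points filled an interval, [S] would have constant truth value just to the right of
    its midpoint; but the point at distance [d] to the right is a boundary point as well. *)
Lemma bd_fin S : D1 S -> fin (bd S).
Proof.
move=> dS; case: (D1_fin (D1_bd dS)) => // -[a [b [ab h]]]; exfalso.
have [r r0 hr] := D1_cstR ((a + b) / 2) dS.
pose d := Num.min r (b - a) / 4.
have d0 : 0 < d by rewrite divr_gt0// lt_min r0 subr_gt0.
have dr : 4 * d <= r by rewrite mulrC divfK// ge_min lexx.
have dba : 4 * d <= b - a by rewrite mulrC divfK// ge_min lexx orbT.
have mab : a < (a + b) / 2 + d < b by lra.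
have [[s [sd Ss]] [s' [sd' Ss']]] := h _ mab d d0.
case: hr => hr.
  by apply: Ss'; apply: hr; move: sd'; rewrite ltr_norml; lra.
by apply: hr Ss; move: sd; rewrite ltr_norml; lra.
Qed.

(** Intervals are definably connected: the supremum of the points up to which [S] persists is not a
    boundary point, so it cannot stop before [t']. *)
Lemma bd_cst S t t' s : D1 S -> (forall u, t <= u <= t' -> ~ bd S u) ->
  S t -> t <= s <= t' -> S s.
Proof.
move=> dS nbd St /andP[ts st'].
have dS' k : dP M (fun e => S (e k)) by apply: dP_D1 => //; ddef.
pose T u := t <= u <= t' /\ forall v, t <= v <= u -> S v.
have dT : D1 T by rewrite /D1 /T; ddef; exact: dS'.
have Tt : T t.
  split=> [|v]; first by lra.
  by rewrite -eq_le => /eqP <-.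
have [a ha] := @D1_sup T t t' dT Tt (fun u hu => proj2 (andP (proj1 hu))).
have ta : t <= a by case: ha => + _; apply.
have at' : a <= t' by case: ha => _; apply => u [/andP[]].
have /existsNP[r /not_implyP[r0 hr]] := nbd a (introT andP (conj ta at')).
have ar : a - r < a by lra.
have [u Tu ua] := isup_lt ha ar.
have ua' : u <= a by case: ha => + _; apply.
have Su : S u by case: Tu => /andP[h1 h2] h; apply: h; rewrite h1 lexx.
have near v : `|v - a| < r -> S v.
  move=> va; apply: contrapT => Sv; apply: hr; split; last by exists v.
  by exists u; split=> //; rewrite ltr_norml; lra.
have below v : t <= v < a -> S v.
  move=> /andP[tv va]; have [w [/andP[_ _] Tw] vw] := isup_lt ha va.
  by apply: Tw; rewrite tv ltW.
have [sa|as_] := ltP s a; first by apply: below; rewrite ts.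
pose w := Num.min (a + r / 2) t'.
have Tw : T w.
  split; first by rewrite /w le_min ge_min lexx orbT andbT; lra.
  move=> v /andP[tv]; rewrite /w le_min => /andP[va vt'].
  have [?|av] := ltP v a; first by apply: below; rewrite tv.
  by apply: near; rewrite ltr_norml; lra.
have : w <= a by case: ha => + _; apply.
rewrite /w ge_min => /orP[|t'a]; first by lra.
by apply: near; rewrite ltr_norml; lra.
Qed.

End OMinimal.
End OneVariable.

(** * Sets with interior and generic behaviour *)

Lemma D1_fiber {L : language} {K : realFieldType} (M : structure L K) n (X :
  set 'rV[K]_n.+1) x :
  definable M X -> D1 M (fun t => X (cns t x)).
Proof. by move=> dX; rewrite /D1; ddef. Qed.

Section Fat.
Context {L : language} {K : realFieldType} (M : structure L K).
Hypothesis omin : o_minimal M.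
Hypothesis asat : aleph1_saturated M.

Definition fat n (S : set 'rV[K]_n) : Prop :=
  exists (x : 'rV[K]_n) (r : K), 0 < r /\ forall y, box x r y -> S y.

Lemma fat_sub n (S T : set 'rV[K]_n) : S `<=` T -> fat S -> fat T.
Proof. by move=> ST [x [r [r0 h]]]; exists x, r; split=> // y /h/ST. Qed.

Lemma fat_nonempty n (S : set 'rV[K]_n) : fat S -> exists x, S x.
Proof. by move=> [x [r [r0 h]]]; exists x; apply: h; exact: box_refl. Qed.

Definition ideal n := forall X Y : set 'rV[K]_n, definable M X ->
  definable M Y -> fat (X `|` Y) -> fat X \/ fat Y.

(* Saturation gives the positive elements of K uncountable coinitiality: if
   S c contains a point of each term of a sequence for c depending on the term,
   then one S c contains the whole sequence. *)
Definition baire n := forall S : K -> set 'rV[K]_n,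
  (forall c, definable M (S c)) ->
  (forall c c' : K, 0 < c' -> c' <= c -> S c `<=` S c') ->
  fat [set x | exists c : K, 0 < c /\ S c x] -> exists c : K, 0 < c /\
    fat (S c).

(** For fixed [x] the [s] with [Y (cns s x)] form an initial segment, and the conclusion locates its
    end up to [h] on a whole box. A [t] less than [h] below the supremum of the heights with a fat
    slice works, because the slice at [t + h] is then small. *)
Lemma fat_jump n (Y : set 'rV[K]_n.+1) (a b h : K) : ideal n -> definable M Y ->
  (forall (s t : K) x, s <= t -> Y (cns t x) -> Y (cns s x)) ->
  fat [set x | Y (cns a x)] -> ~ fat [set x | Y (cns b x)] -> 0 < h ->
  exists t, fat [set x | Y (cns t x) /\ ~ Y (cns (t + h) x)].
Proof.
move=> idn dY anti fa fb h0.
have [||c hc] := @D1_sup _ _ M omin (fun t =>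
  fat [set x | Y (cns t x)]) a b _ fa.
- by rewrite /D1 /fat /=; ddef.
- move=> t ft; rewrite leNgt; apply/negP => bt; apply: fb.
  by apply: fat_sub ft => x /=; apply: anti; exact: ltW.
have ch : c - h < c by lra.
have [t ft ct] := isup_lt hc ch.
exists t.
have nft : ~ fat [set x | Y (cns (t + h) x)].
  move=> /(proj1 hc); lra.
have d1 : definable M [set x | Y (cns t x) /\ ~ Y (cns (t + h) x)].
  by apply: definableP; ddef.
have d2 : definable M [set x | Y (cns (t + h) x)] by apply: definableP; ddef.
case: (idn _ _ d1 d2) => //; apply: fat_sub ft => x /= Yx.
by have [?|?] := pselect (Y (cns (t + h) x)); [right|left].
Qed.

(** The intervals in the fibres have no common position: [baire] makes uniform a length [c] and a
    bound [1/c] on the left endpoints, and [fat_jump] locates a left endpoint up to [c / 2]. *)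
Lemma fubini_of n (X : set 'rV[K]_n.+1) : ideal n -> baire n -> definable M X ->
  fat [set x | open_in (fun t => X (cns t x))] -> fat X.
Proof.
move=> idn ban dX fX.
pose S (c : K) := [set x | exists a : K, c * `|a| <= 1 /\
  forall t : K, a < t < a + c -> X (cns t x)].
have [|||c [c0 fc]] := ban S.
- by move=> c; apply: definableP; rewrite /S /=; ddef.
- move=> c c' c'0 cc' x [a [ca h]]; exists a; split.
    by apply: le_trans ca; exact: ler_wpM2r.
  by move=> t ht; apply: h; lra.
- apply: fat_sub fX => x [a [b [ab h]]].
  have na : 0 < `|a| + 1 by rewrite ltr_wpDl.
  exists (Num.min (b - a) (`|a| + 1)^-1); split.
    by rewrite lt_min subr_gt0 ab invr_gt0.
  exists a; split.
    apply: (@le_trans _ _ ((`|a| + 1)^-1 * `|a|)).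
      by apply: ler_wpM2r => //; rewrite ge_min lexx orbT.
    by rewrite mulrC ler_pdivrMr// mul1r lerDl.
  move=> t /andP[at_ tb]; apply: h; rewrite at_/=.
  have : Num.min (b - a) (`|a| + 1)^-1 <= b - a by rewrite ge_min lexx.
  lra.
pose Y := [set v : 'rV[K]_n.+1 | exists a : K, v 0 ord0 <= a /\ c * `|a| <= 1 /\
  forall t : K, a < t < a + c -> X (cns t (tl v))].
have abs_bound (a : K) : c * `|a| <= 1 -> - c^-1 <= a <= c^-1.
  by rewrite mulrC -ler_pdivlMr// mul1r ler_norml.
have [|||||t ft] := @fat_jump n Y (- c^-1) (c^-1 + 1) (c / 2) idn.
- by apply: definableP; rewrite /Y /=; ddef.
- move=> s t x st [a]; rewrite cns0 tl_cns => -[ta h]; exists a.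
  by rewrite cns0 tl_cns; split=> //; exact: le_trans ta.
- apply: fat_sub fc => x [a [ca h]]; exists a; rewrite cns0 tl_cns.
  by have /andP[] := abs_bound a ca.
- move=> /fat_nonempty[x [a]]; rewrite cns0 => -[ha [/abs_bound]].
  by move=> /andP[_ h]; lra.
- lra.
have [x [r [r0 hr]]] := ft.
(* The left endpoints lie between [t] and [t + c / 2], so all these fibres contain the interval from
   [t + c / 2] to [t + c], whose centre is [t + c * 3 / 4]. *)
exists (cns (t + c * 3 / 4) x), (Num.min r (c / 4)).
split; first by rewrite lt_min r0; lra.
move=> v; rewrite -{1}(cns_tl v) box_cns => -[h1 h2].
have /hr[[a]] : box x r (tl v) by apply: box_le h2; rewrite ge_min lexx.
rewrite cns0 tl_cns => -[ta [ca h]] nY.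
have at_ : a < t + c / 2.
  rewrite ltNge; apply/negP => k; apply: nY; exists a.
  by rewrite cns0 tl_cns.
rewrite -(cns_tl v); apply: h.
have : `|v 0 ord0 - (t + c * 3 / 4)| < c / 4.
  by apply: lt_le_trans h1 _; rewrite ge_min lexx orbT.
rewrite ltr_norml; lra.
Qed.

Lemma definable_open_in n (X : set 'rV[K]_n.+1) :
  definable M X -> definable M [set x | open_in (fun t => X (cns t x))].
Proof. by move=> dX; apply: definableP; rewrite /open_in /=; ddef. Qed.

(** The two properties are proved by a simultaneous induction because [fubini_of] uses both in
    dimension [n]. For the ideal property, two finite sets cannot cover an interval in a fibre, so
    the fibre of [X] or that of [Y] contains an interval. *)
Lemma ideal_baire n : ideal n /\ baire n.
Proof.
elim: n => [|n [idn ban]].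
  have E (x y : 'rV[K]_0) : x = y by apply/rowP; case.
  have fatE (S : set 'rV[K]_0) x : S x -> fat S.
    by move=> Sx; exists x, 1; split=> // y _; rewrite (E y x).
  split=> [X Y _ _ /fat_nonempty[x [Xx|Yx]]|S _ _ /fat_nonempty[x [c [c0 Sx]]]].
  - by left; exact: fatE Xx.
  - by right; exact: fatE Yx.
  - by exists c; split=> //; exact: fatE Sx.
split.
  move=> X Y dX dY [v [r [r0 h]]].
  have [] : fat [set x | open_in (fun t => X (cns t x))] \/
      fat [set x | open_in (fun t => Y (cns t x))].
  - apply: idn; try exact: definable_open_in.
    exists (tl v), r; split=> // y hy.
    have [oX|[sX hX]] := D1_fin omin (D1_fiber y dX); first by left.
    have [oY|[sY hY]] := D1_fin omin (D1_fiber y dY); first by right.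
    exfalso; apply: (@fin_itv K (v 0 ord0 - r) (v 0 ord0 + r)); first lra.
    exists (sX ++ sY) => t ht; rewrite mem_cat.
    have [|/hX ->//|/hY ->] := h (cns t y); last by rewrite orbT.
    by rewrite -(cns_tl v) box_cns; split=> //; rewrite ltr_norml; lra.
  - by left; exact: fubini_of.
  - by right; exact: fubini_of.
move=> S dS Sdecr [v [r [r0 h]]].
have [|||c [c0 fc]] := ban (fun c => [set x | open_in (fun t =>
  S c (cns t x))]).
- by move=> c; exact: definable_open_in.
- move=> c c' c'0 cc' x [a [b [ab k]]]; exists a, b; split=> // t /k.
  exact: Sdecr.
- exists (tl v), r; split=> // y hy.
  (* Countably many points of the fibre have a common positive margin [d]; so the fibre of [S d] is
     infinite and contains an interval. *)
  pose q (m : nat) := v 0 ord0 + r / m.+2%:R.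
  have q0 m : 0 < r / m.+2%:R :> K by rewrite divr_gt0.
  have qinj : injective q.
    move=> m k /addrI /(mulfI _); rewrite gt_eqF// => /(_ isT) /invr_inj.
    by move=> /eqP; rewrite eqr_nat => /eqP [].
  have /choice[c hc] : forall m, exists c : K, 0 < c /\ S c (cns (q m) y).
    move=> m; apply: (h (cns (q m) y)); rewrite -(cns_tl v) box_cns; split=> //.
    rewrite /q addrC addKr gtr0_norm// ltr_pdivrMr// ltr_pMr// ltr1n //.
  have [d d0 hd] := coinitial asat (fun m => proj1 (hc m)).
  exists d; split=> //.
  have [//|[s hs]] := D1_fin omin (D1_fiber y (dS d)); exfalso.
  have qs m : q m \in s.
    by apply: hs; apply: Sdecr (proj2 (hc m)) => //; exact: hd.
  have : (size (map q (iota 0 (size s).+1)) <= size s)%N.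
    apply: uniq_leq_size; first by rewrite map_inj_uniq ?iota_uniq.
    by move=> _ /mapP[m _ ->].
  by rewrite size_map size_iota ltnn.
- by exists c; split=> //; exact: fubini_of.
Qed.

Lemma fatU n (X Y : set 'rV[K]_n) : definable M X -> definable M Y ->
  fat (X `|` Y) -> fat X \/ fat Y.
Proof. by have [+ _] := ideal_baire n; apply. Qed.

Lemma fat_fibers n (X : set 'rV[K]_n.+1) : definable M X ->
  fat [set x | open_in (fun t => X (cns t x))] -> fat X.
Proof. by have [? ?] := ideal_baire n; exact: fubini_of. Qed.

Lemma baire_fat n (Z : set 'rV[K]_n) (X : set 'rV[K]_n.+1) :
  definable M Z -> definable M X ->
  (forall (s t : K) x, 0 < s -> s <= t -> X (cns t x) -> X (cns s x)) ->
  fat [set x | Z x /\ exists c : K, 0 < c /\ X (cns c x)] ->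
  exists c : K, 0 < c /\ fat [set x | Z x /\ X (cns c x)].
Proof.
move=> dZ dX anti fZ; have [_ ban] := ideal_baire n.
apply: ban.
- by move=> c; apply: definableP; ddef.
- by move=> c c' c'0 cc' x [Zx h]; split=> //; exact: anti h.
- by apply: fat_sub fZ => x [Zx [c [c0 h]]]; exists c.
Qed.

Definition contAt n (l : 'rV[K]_n -> K) (x : 'rV[K]_n) : Prop :=
  forall r : K, 0 < r -> exists s : K,
    0 < s /\ forall y, box x s y -> `|l y - l x| < r.

Lemma definable_contAt n (l : 'rV[K]_n -> K) :
  dF M l -> definable M [set x | contAt l x].
Proof. by move=> dl; apply: definableP; rewrite /contAt /=; ddef. Qed.

(** Discontinuity on a fat set would give a box on which the oscillation is everywhere at least some
    [c > 0], and inside it a box on which [l] is bounded. There [fat_jump] finds a box on which [l]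
    varies by less than [c / 2]. *)
Lemma generic_contAt n (l : 'rV[K]_n -> K) :
  dF M l -> ~ fat [set x | ~ contAt l x].
Proof.
move=> dl fl; have [idn _] := ideal_baire n.
pose X := [set v : 'rV[K]_n.+1 | forall s : K, 0 < s -> exists y,
  box (tl v) s y /\ v 0 ord0 <= `|l y - l (tl v)|].
have dX : definable M X by apply: definableP; rewrite /X /=; ddef.
have dnc : definable M [set x | ~ contAt l x].
  by have := definable_contAt dl => d; apply: definableP; rewrite /=;
    apply: dP_not; apply: (dP_set d); ddef.
have [||c [c0 [x [r [r0 hr]]]]] := baire_fat dnc dX.
  move=> s t x s0 st h u /h[y]; rewrite !cns0 !tl_cns => -[xy ty].
  by exists y; split=> //; exact: le_trans ty.
  apply: fat_sub fl => x nx; split=> //; move: (nx) => /existsNP[c].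
  move=> /not_implyP[c0 h]; exists c; split=> // s s0; rewrite cns0 tl_cns.
  apply: contrapT => k; apply: h; exists s; split=> // y xy.
  by rewrite ltNge; apply/negP => q; apply: k; exists y.
pose B := [set y | box x r y].
have dB : definable M B by apply: definableP; rewrite /B /=; ddef.
pose X2 := [set v : 'rV[K]_n.+1 | v 0 ord0 * `|l (tl v)| <= 1].
have dX2 : definable M X2 by apply: definableP; rewrite /X2 /=; ddef.
have [||d [d0 [x2 [r2 [r20 hr2]]]]] := baire_fat dB dX2.
  move=> s t y s0 st; rewrite /X2 /= !cns0 !tl_cns; apply: le_trans.
  exact: ler_wpM2r.
  exists x, r; split=> // y xy; split=> //.
  exists (`|l y| + 1)^-1; rewrite invr_gt0 /X2 /= cns0 tl_cns.
  have ly : 0 < `|l y| + 1 by rewrite ltr_wpDl.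
  by split=> //; rewrite mulrC ler_pdivrMr// mul1r lerDl.
pose Y := [set v : 'rV[K]_n.+1 | box x2 r2 (tl v) /\ v 0 ord0 <= l (tl v)].
have bound y : box x2 r2 y -> - d^-1 <= l y <= d^-1.
  move=> /hr2[_]; rewrite /X2 /= cns0 tl_cns.
  by rewrite mulrC -ler_pdivlMr// mul1r ler_norml.
have [|||||t [z [s [s0 hz]]]] := @fat_jump n Y (- d^-1) (d^-1 + 1) (c / 2) idn.
- by apply: definableP; rewrite /Y /=; ddef.
- move=> s t y st; rewrite /Y /= !cns0 !tl_cns => -[xy ty]; split=> //.
  exact: le_trans ty.
- exists x2, r2; split=> // y xy; rewrite /Y /= cns0 tl_cns; split=> //.
  by have /andP[] := bound y xy.
- move=> /fat_nonempty[y]; rewrite /Y /= cns0 tl_cns => -[/bound].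
  by move=> /andP[_ h1] h2; lra.
- lra.
have osc y : box z s y -> box x2 r2 y /\ t <= l y < t + c / 2.
  move=> /hz; rewrite /Y /= !cns0 !tl_cns => -[[xy ->] h]; split=> //=.
  by rewrite ltNge; apply/negP => k; apply: h.
have [xz lz] := osc z (box_refl _ s0).
have [Bz _] := hr2 _ xz; have [_ /(_ s s0)[y]] := hr _ Bz.
by rewrite cns0 tl_cns => -[/osc[_ ly]]; rewrite ler_normr; lra.
Qed.

(* The first coordinate of [w] is the one along which the graph of [l] is a
   graph: the points of the graph translated by [t *: w] lie below it. *)
Definition incr n (l : 'rV[K]_n -> K) x r (w : 'rV[K]_n.+1) : Prop :=
  forall y, box x r y -> forall t : K, 0 < t < r ->
    l y + t * w 0 ord0 < l (y + t *: tl w).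

Definition inc n (l : 'rV[K]_n -> K) x (w : 'rV[K]_n.+1) : Prop :=
  exists r : K, 0 < r /\ incr l x r w.

Definition level n (l : 'rV[K]_n -> K) x (w : 'rV[K]_n.+1) : Prop :=
  exists r : K, 0 < r /\ forall y, box x r y -> forall t : K, 0 < t < r ->
    l (y + t *: tl w) = l y + t * w 0 ord0.

Definition decided n (l : 'rV[K]_n -> K) x (w : 'rV[K]_n.+1) : Prop :=
  [\/ inc l x w, inc l x (- w) | level l x w].

Lemma box_move n (x y a : 'rV[K]_n) (r s : K) : box x r y ->
  (forall i, `|a 0 i| <= s) -> box x (r + s) (y + a).
Proof.
move=> xy ha i; rewrite mxE addrAC (le_lt_trans (ler_normD _ _))//.
exact: ltr_leD.
Qed.

Lemma norm_row_bound n (x : 'rV[K]_n) : exists2 c, 0 < c & forall i,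
  `|x 0 i| <= c.
Proof.
exists (1 + \sum_i `|x 0 i|) => [|i].
  by rewrite ltr_wpDr// sumr_ge0.
rewrite (bigD1 i)//= addrCA lerDl addr_ge0// sumr_ge0//.
Qed.

(** The inequality is read backwards, at [y - t *: tl w]; the radius [r / (1 + c)] keeps this point
    in the box of radius [r]. *)
Lemma dec_inc n (l : 'rV[K]_n -> K) x (w : 'rV[K]_n.+1) r : 0 < r ->
  (forall y, box x r y -> forall t : K, 0 < t < r ->
    l (y + t *: tl w) < l y + t * w 0 ord0) -> inc l x (- w).
Proof.
move=> r0 h; have [c c0 hc] := norm_row_bound (tl w).
have s0 : 0 < r / (1 + c) by rewrite divr_gt0// addr_gt0.
have sr : r / (1 + c) + r / (1 + c) * c = r.
  by rewrite -{1}[r / _]mulr1 -mulrDr divfK// gt_eqF// addr_gt0.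
have sc0 : 0 <= r / (1 + c) * c by rewrite mulr_ge0// ltW.
exists (r / (1 + c)); split=> // y xy t /andP[t0 ts].
have := h (y - t *: tl w) _ t; rewrite subrK tlN scalerN mxE.
have -> : forall a b : K, a + t * - b = a - t * b by move=> a b; rewrite mulrN.
rewrite -ltrBlDr; apply; last by rewrite t0/=; lra.
rewrite -sr; apply: box_move => // i; rewrite mxE normrN mxE normrM gtr0_norm//.
by apply: ler_pM => //; [exact: ltW|exact: ltW].
Qed.

Lemma definable_inc n (l : 'rV[K]_n -> K) w :
  dF M l -> definable M [set x | inc l x w].
Proof. by move=> dl; apply: definableP; rewrite /inc /incr /=; ddef. Qed.

Lemma definable_level n (l : 'rV[K]_n -> K) w :
  dF M l -> definable M [set x | level l x w].
Proof. by move=> dl; apply: definableP; rewrite /level /=; ddef. Qed.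

(** By o-minimality the sign of [l (x + t *: tl w) - l x - t * w 0 ord0] is constant for small
    [t > 0]. If the undecided points were fat, one of the three signs would occur on a fat part of
    them, with a uniform margin by [baire_fat]; the centre of the resulting box would be decided. *)
Lemma generic_decided n (l : 'rV[K]_n -> K) w : dF M l ->
  ~ fat [set x | ~ decided l x w].
Proof.
move=> dl.
set Z := [set x | ~ decided l x w].
have dZ : definable M Z.
  have d1 := definable_inc w dl; have d2 := definable_inc (- w) dl.
  have d3 := definable_level w dl; apply: definableP.
  apply: (@dP_iff _ _ _ (fun e => ~ (inc l (\row_i e i) w \/
    (inc l (\row_i e i) (- w) \/ level l (\row_i e i) w)))).
    move=> e; rewrite /Z /decided/=; split=> h k; apply: h.
      by case: k => [k|k|k]; tauto.
    by case: k => [k|[k|k]]; [apply: Or31|apply: Or32|apply: Or33].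
  apply: dP_not; apply: dP_or; first by apply: (dP_set d1); ddef.
  by apply: dP_or; [apply: (dP_set d2)|apply: (dP_set d3)]; ddef.
pose X1 := [set v : 'rV[K]_n.+1 | forall t : K, 0 < t < v 0 ord0 ->
  l (tl v) + t * w 0 ord0 < l (tl v + t *: tl w)].
pose X2 := [set v : 'rV[K]_n.+1 | forall t : K, 0 < t < v 0 ord0 ->
  l (tl v + t *: tl w) < l (tl v) + t * w 0 ord0].
pose X3 := [set v : 'rV[K]_n.+1 | forall t : K, 0 < t < v 0 ord0 ->
  l (tl v + t *: tl w) = l (tl v) + t * w 0 ord0].
have dX1 : definable M X1 by apply: definableP; rewrite /X1 /=; ddef.
have dX2 : definable M X2 by apply: definableP; rewrite /X2 /=; ddef.
have dX3 : definable M X3 by apply: definableP; rewrite /X3 /=; ddef.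
pose Y (X : set 'rV[K]_n.+1) := [set x | Z x /\ exists c : K, 0 < c /\
  X (cns c x)].
have dY X : definable M X -> definable M (Y X).
  by move=> dX; apply: definableP; rewrite /Y /=; ddef.
have local X : definable M X ->
    (forall (s t : K) x, 0 < s -> s <= t -> X (cns t x) -> X (cns s x)) ->
      fat (Y X) ->
    exists x r, [/\ 0 < r, Z x & forall y, box x r y -> X (cns r y)].
  move=> dX anti fY; have [c [c0 [x [r [r0 h]]]]] := baire_fat dZ dX anti fY.
  exists x, (Num.min r c); split; first by rewrite lt_min r0.
    by have [] := h x (box_refl _ r0).
  move=> y xy; have [|_ Xy] := h y; first by apply: box_le xy;
    rewrite ge_min lexx.
  by apply: anti Xy; rewrite ?lt_min ?r0// ge_min lexx orbT.
move=> fZ; have : fat (Y X1 `|` (Y X2 `|` Y X3)).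
  apply: fat_sub fZ => x Zx.
  have D1' (S : K -> Prop) : D1 M S -> cstR S 0 by apply: D1_cstR.
  have [|r1 r10 [h1|h1]] := D1' (fun t =>
    l x + t * w 0 ord0 < l (x + t *: tl w)).
    by rewrite /D1; ddef.
    left; split=> //; exists r1; split=> // t; rewrite cns0 tl_cns => ht.
    by apply: h1; rewrite add0r.
  have [|r2 r20 [h2|h2]] := D1' (fun t =>
    l (x + t *: tl w) < l x + t * w 0 ord0).
    by rewrite /D1; ddef.
    right; left; split=> //; exists r2; split=> // t; rewrite cns0 tl_cns => ht.
    by apply: h2; rewrite add0r.
  right; right; split=> //; exists (Num.min r1 r2); split.
    by rewrite lt_min r10.
  move=> t; rewrite cns0 tl_cns lt_min => /andP[t0 /andP[tr1 tr2]].
  have /negP : ~ (l x + t * w 0 ord0 < l (x + t *: tl w)).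
    by apply: h1; rewrite add0r t0.
  have /negP : ~ (l (x + t *: tl w) < l x + t * w 0 ord0).
    by apply: h2; rewrite add0r t0.
  by rewrite -!leNgt => k1 k2; apply/eqP; rewrite eq_le k1 k2.
have dY3 := dY _ dX3; have dY2 := dY _ dX2; have dY1 := dY _ dX1.
have dY23 : definable M (Y X2 `|` Y X3) by apply: definableP; ddef.
move=> /(fatU dY1 dY23)[/(local _ dX1)|/(fatU dY2 dY3)[/(local _ dX2)|/(local _
  dX3)]].
- move=> [s t x s0 st h u|x [r [r0 Zx h]]].
    by rewrite !cns0 !tl_cns => hu; have := h u; rewrite cns0 tl_cns; apply;
      lra.
  apply: Zx; apply: Or31; exists r; split=> // y /h hy t ht.
  by have := hy t; rewrite cns0 tl_cns; apply.
- move=> [s t x s0 st h u|x [r [r0 Zx h]]].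
    by rewrite !cns0 !tl_cns => hu; have := h u; rewrite cns0 tl_cns; apply;
      lra.
  apply: Zx; apply: Or32; apply: (dec_inc r0) => y /h hy t ht.
  by have := hy t; rewrite cns0 tl_cns; apply.
- move=> [s t x s0 st h u|x [r [r0 Zx h]]].
    by rewrite !cns0 !tl_cns => hu; have := h u; rewrite cns0 tl_cns; apply;
      lra.
  apply: Zx; apply: Or33; exists r; split=> // y /h hy t ht.
  by have := hy t; rewrite cns0 tl_cns; apply.
Qed.

Definition interior n (S : set 'rV[K]_n) : set 'rV[K]_n :=
  [set x | exists r : K, 0 < r /\ forall y, box x r y -> S y].

End Fat.

(** * Decomposition into graphs and bands *)

Section Pieces.
Context {L : language} {K : realFieldType} (M : structure L K).

(** A binary tree of definable splittings: disjointness of the pieces is built in, and refinement is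
    substitution at the leaves ([piecewise_bind]), so that indexed families appear only in
    [piecewise_partition]. *)
Inductive piecewise n (Q : set 'rV[K]_n -> Prop) : set 'rV[K]_n -> Prop :=
| piecewise_leaf A : definable M A -> Q A -> piecewise Q A
| piecewise_split A B : definable M B -> piecewise Q (A `&` B) ->
  piecewise Q (A `\` B) -> piecewise Q A.

Lemma piecewise_bind n (Q Q' : set 'rV[K]_n -> Prop) A : piecewise Q A ->
  (forall B, definable M B -> B `<=` A -> Q B -> piecewise Q' B) ->
    piecewise Q' A.
Proof.
elim=> {A} [A dA QA h|A B dB _ IH1 _ IH2 h]; first exact: h.
apply: (piecewise_split dB); [apply: IH1|apply: IH2] => C dC CA; apply: h => //.
  by move=> x /CA[].
by move=> x /CA[].
Qed.

Lemma piecewise_mono n (Q Q' : set 'rV[K]_n -> Prop) A :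
  (forall B, definable M B -> B `<=` A -> Q B -> Q' B) -> piecewise Q A ->
    piecewise Q' A.
Proof.
by move=> h /piecewise_bind; apply=> B dB BA QB; apply: piecewise_leaf => //;
  exact: h.
Qed.

(** Decompositions are pulled back along a definable map: the projection [tl], the omission of
    another coordinate, or a linear change of coordinates. *)
Lemma piecewise_preimage m n (f : 'rV[K]_m -> 'rV[K]_n) Q Q'
    (A : set 'rV[K]_m) D :
  (forall S, definable M S -> definable M [set v | S (f v)]) -> piecewise Q D ->
  (forall B, definable M B -> B `<=` D -> Q B ->
    piecewise Q' [set v | A v /\ B (f v)]) ->
  piecewise Q' [set v | A v /\ D (f v)].
Proof.
move=> df; elim=> {D} [D dD QD h|D B dB _ IH1 _ IH2 h]; first exact: h.
apply: (piecewise_split (df _ dB)).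
  rewrite (_ : _ `&` _ = [set v | A v /\ (D `&` B) (f v)]).
    by apply: IH1 => C dC CD; apply: h => // x /CD[].
  by apply/seteqP; split=> x /=; tauto.
rewrite (_ : _ `\` _ = [set v | A v /\ (D `\` B) (f v)]).
  by apply: IH2 => C dC CD; apply: h => // x /CD[].
by apply/seteqP; split=> x /=; tauto.
Qed.

Lemma piecewise_over n Q Q' (A : set 'rV[K]_n.+1) D :
  definable M A -> (forall v, A v -> D (tl v)) -> piecewise Q D ->
  (forall B, definable M B -> B `<=` D -> Q B ->
    piecewise Q' [set v | A v /\ B (tl v)]) ->
  piecewise Q' A.
Proof.
move=> dA AD pD h.
rewrite (_ : A = [set v | A v /\ D (tl v)]); last first.
  by apply/seteqP; split=> v /= => [Av|[]//]; split=> //; exact: AD.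
by apply: piecewise_preimage pD h => S dS; apply: definableP; ddef.
Qed.

Lemma definable_over n (A : set 'rV[K]_n.+1) B : definable M A ->
  definable M B ->
  definable M [set v : 'rV[K]_n.+1 | A v /\ B (tl v)].
Proof. by move=> dA dB; apply: definableP; ddef. Qed.

(** Functions are total, so where the fibre is empty the graph takes the value 0 of [xget], a
    definable condition; elsewhere the value is unique and no choice is involved. *)
Lemma dF_xget n (X : set 'rV[K]_n.+1) : definable M X ->
  (forall x s t, X (cns s x) -> X (cns t x) -> s = t) ->
  dF M (fun x => xget 0 [set t | X (cns t x)]) /\
  forall x t, X (cns t x) -> xget 0 [set t | X (cns t x)] = t.
Proof.
move=> dX fX.
have E x t : X (cns t x) -> xget 0 [set t | X (cns t x)] = t.
  by move=> Xt; apply: (fX x) => //;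
    exact: (@xgetPex _ 0 [set t | X (cns t x)] (ex_intro _ t Xt)).
split=> //.
have d : definable M [set v : 'rV[K]_n.+1 | X v \/
    (~ (exists t, X (cns t (tl v)))) /\ v 0 ord0 = 0].
  by apply: definableP; ddef.
rewrite /dF (_ : mkset _ = [set v : 'rV[K]_n.+1 | X v \/
    (~ (exists t, X (cns t (tl v)))) /\ v 0 ord0 = 0])//.
apply/seteqP; split=> v /=.
  have [[t Xt]|nX ->] := pselect (exists t, X (cns t (tl v))).
    by rewrite (E _ _ Xt) => vt; left; rewrite -(cns_tl v) vt.
  by right; split=> //; apply: xgetPN => t Xt; apply: nX; exists t.
move=> [Xv|[nX ->]]; first by rewrite (E _ (v 0 ord0))// cns_tl.
by rewrite xgetPN// => t Xt; apply: nX; exists t.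
Qed.

Definition grph n (D : set 'rV[K]_n) (l : 'rV[K]_n -> K) : set 'rV[K]_n.+1 :=
  [set v | D (tl v) /\ v 0 ord0 = l (tl v)].

Definition band n (D : set 'rV[K]_n) (l u : 'rV[K]_n -> K) : set 'rV[K]_n.+1 :=
  [set v | D (tl v) /\ l (tl v) < v 0 ord0 < u (tl v)].

(** Cells without continuity of the bounding functions. That these run inside [N], a fibrewise
    boundary in the applications, is recorded because transversality will be known along the
    boundary only. *)
Definition fibre_leaf n (N A : set 'rV[K]_n.+1) : Prop :=
  exists2 D, definable M D &
    (exists2 l, dF M l & A = grph D l /\ A `<=` N) \/
    (exists l u, [/\ dF M l, dF M u, A = band D l u &
       forall x, D x -> [/\ l x < u x, N (cns (l x) x) & N (cns (u x) x)]]).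

Definition bdf n (A : set 'rV[K]_n.+1) : set 'rV[K]_n.+1 :=
  [set v | bd (fun t => A (cns t (tl v))) (v 0 ord0)].

Lemma definable_bdf n (A : set 'rV[K]_n.+1) : definable M A ->
  definable M (bdf A).
Proof. by move=> dA; apply: definableP; rewrite /bdf /bd; ddef. Qed.

(* At least [k] points of the fibre of [N] through [v] are smaller than [v]. *)
Fixpoint below n (N : set 'rV[K]_n.+1) k : set 'rV[K]_n.+1 :=
  if k is k'.+1 then [set v : 'rV[K]_n.+1 | exists s : K, s < v 0 ord0 /\
    N (cns s (tl v)) /\ below N k' (cns s (tl v))] else setT.

Lemma definable_below n (N : set 'rV[K]_n.+1) k :
  definable M N -> definable M (below N k).
Proof.
move=> dN; elim: k => [|k IH] /=; apply: definableP; ddef.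
Qed.

Lemma below_decr n (N : set 'rV[K]_n.+1) k : below N k.+1 `<=` below N k.
Proof.
elim: k => [//|k IH] v [s [sv [Ns /IH h]]]; by exists s.
Qed.

Lemma below_mono n (N : set 'rV[K]_n.+1) k s t x : s <= t ->
  below N k (cns s x) -> below N k (cns t x).
Proof.
case: k => // k st [u]; rewrite cns0 tl_cns => -[us h].
by exists u; rewrite cns0 tl_cns; split=> //; exact: lt_le_trans st.
Qed.

Lemma below_size n (N : set 'rV[K]_n.+1) k t x (s : seq K) :
  (forall u, u < t -> N (cns u x) -> u \in s) -> below N k (cns t x) ->
  (k <= size s)%N.
Proof.
elim: k t s => // k IH t s hs [u]; rewrite cns0 tl_cns => -[ut [Nu bu]].
have us := hs _ ut Nu.
have : (k <= size (rem u s))%N.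
  apply: IH bu => w wu Nw; have : w \in s by apply: hs => //;
    exact: lt_trans ut.
  by rewrite (perm_mem (perm_to_rem us)) inE lt_eqF.
rewrite size_rem//; case: s us {hs IH} => //.
Qed.

Lemma seq_max (r : seq K) (S : K -> Prop) : (exists2 s, s \in r & S s) ->
  exists m, S m /\ forall s, s \in r -> S s -> s <= m.
Proof.
elim: r => [[s]//|a r IH [s sr Ss]].
have [[m [Sm hm]]|nr] := pselect (exists m, S m /\ forall s, s \in r -> S s ->
  s <= m).
  have [Sa|nSa] := pselect (S a).
    exists (Num.max a m); split; first by rewrite /Num.max; case: ifP.
    move=> u; rewrite inE => /predU1P[->|ur Su]; rewrite le_max ?lexx//.
    by rewrite hm// orbT.
  by exists m; split=> // u; rewrite inE => /predU1P[->//|]; exact: hm.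
have nS u : u \in r -> ~ S u by move=> ur Su; apply: nr; apply: IH; exists u.
move: sr; rewrite inE => /predU1P[sa|/nS//]; exists s; split=> // u.
by rewrite inE => /predU1P[->|/nS//]; rewrite sa.
Qed.

Lemma itv_endpoints (a b c d : K) : a < b -> c < d ->
  (forall t, a < t < b <-> c < t < d) -> a = c /\ b = d.
Proof.
suff H (a' b' c' d' : K) : a' < b' -> c' < d' ->
    (forall t, a' < t < b' <-> c' < t < d') -> c' <= a' /\ b' <= d'.
  move=> ab cd h; have [h1 h2] := H _ _ _ _ ab cd h.
  have [h3 h4] := H _ _ _ _ cd ab (fun t => iff_sym (h t)).
  by split; apply: le_anti; apply/andP.
move=> ab cd h; split; rewrite leNgt; apply/negP => k.
  have /h : a' < (a' + Num.min c' b') / 2 < b'.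
    have : Num.min c' b' <= b' by rewrite ge_min lexx orbT.
    have : a' < Num.min c' b' by rewrite lt_min k ab.
    lra.
  have : Num.min c' b' <= c' by rewrite ge_min lexx.
  lra.
have /h : a' < (Num.max d' a' + b') / 2 < b'.
  have : a' <= Num.max d' a' by rewrite le_max lexx orbT.
  have : Num.max d' a' < b' by rewrite gt_max k ab.
  lra.
have : d' <= Num.max d' a' by rewrite le_max lexx.
lra.
Qed.

(** * Uniform finiteness, fibrewise decomposition and piecewise continuity *)

Section OMinimalPieces.
Hypothesis omin : o_minimal M.
Hypothesis asat : aleph1_saturated M.

(** Uniform finiteness: otherwise the sets [below N k] would be a decreasing sequence of nonempty
    definable sets, and a common point would have infinitely many points of [N] in its fibre. *)
Lemma below_bound n (N : set 'rV[K]_n.+1) : definable M N ->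
  (forall x, fin (fun t => N (cns t x))) -> exists k, forall v, ~ below N k v.
Proof.
move=> dN finN; apply: contrapT => /forallNP h.
have [|||v hv] := @sat_sequence_row _ _ M _ (below N) asat.
- by move=> k; exact: definable_below.
- by move=> k; exact: below_decr.
- by move=> k; have /existsNP[v /contrapT] := h k; exists v.
have [s hs] := finN (tl v).
have : ((size s).+1 <= size s)%N.
  apply: (@below_size _ N _ (v 0 ord0) (tl v)); last by rewrite cns_tl.
  by move=> u _; exact: hs.
by rewrite ltnn.
Qed.

Lemma bdf_fin n (A : set 'rV[K]_n.+1) x : definable M A ->
  fin (fun t => bdf A (cns t x)).
Proof.
move=> dA; have [s hs] := bd_fin omin (D1_fiber x dA).
by exists s => t; rewrite /bdf /= cns0 tl_cns; exact: hs.
Qed.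

(** Without a boundary point below [t], the complement of [A] would spread along the fibre from [b]
    up to [t]. *)
Lemma nearest_left n (A : set 'rV[K]_n.+1) x t b : definable M A ->
  A (cns t x) -> ~ bdf A (cns t x) -> (forall s, A (cns s x) -> b < s) ->
  exists l, [/\ bdf A (cns l x), l < t &
    forall s, l < s <= t -> ~ bdf A (cns s x)].
Proof.
move=> dA At nt hb.
have E s : bdf A (cns s x) = bd (fun t => A (cns t x)) s.
  by rewrite /bdf /= cns0 tl_cns.
have [r hr] := bdf_fin x dA.
have [|l [[lt Nl] hl]] := @seq_max r (fun s => s < t /\ bdf A (cns s x)).
  apply: contrapT => /forall2NP h.
  have bt := hb _ At.
  have nbd u : b <= u <= t -> ~ bd (fun t => A (cns t x)) u.
    move=> /andP[_ ut] bu; have Nu : bdf A (cns u x) by rewrite E.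
    have [ut'|tu] := ltP u t; first by case: (h u) => k; apply: k; [exact: hr|].
    by apply: nt; rewrite (_ : t = u)//; apply: le_anti; rewrite ut tu.
  have nAb : ~ A (cns b x) by move=> /hb; rewrite ltxx.
  have := bd_cst omin (S := fun t => ~ A (cns t x)) (t := b) (t' := t) (s :=
    t); apply => //.
  - by have := D1_fiber x dA => d; rewrite /D1; ddef.
  - move=> u ut bu; apply: (nbd u ut) => r0 r00;
      have [[s [h1 h2]] [s' [h3 h4]]] := bu r0 r00.
    by split; [exists s'; split=> //; exact: contrapT|exists s].
  - by rewrite (ltW bt) lexx.
exists l; split=> // s /andP[ls st] Ns.
have [st'|ts] := ltP s t; first by have := hl s (hr _ Ns) (conj st' Ns); lra.
by apply: nt; rewrite (_ : t = s)//; apply: le_anti; rewrite st ts.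
Qed.

Lemma bd_opp (S : K -> Prop) t : bd (fun s => S (- s)) t -> bd S (- t).
Proof.
move=> h r r0; have [[s [h1 h2]] [s' [h3 h4]]] := h r r0.
by split; [exists (- s)|exists (- s')]; rewrite -opprD normrN.
Qed.

Lemma nearest_right n (A : set 'rV[K]_n.+1) x t b : definable M A ->
  A (cns t x) -> ~ bdf A (cns t x) -> (forall s, A (cns s x) -> s < b) ->
  exists u, [/\ bdf A (cns u x), t < u &
    forall s, t <= s < u -> ~ bdf A (cns s x)].
Proof.
move=> dA At nt hb.
pose A' := [set v : 'rV[K]_n.+1 | A (cns (- v 0 ord0) (tl v))].
have dA' : definable M A' by apply: definableP; rewrite /A'; ddef.
have AE s : A' (cns s x) = A (cns (- s) x) by rewrite /A' /= cns0 tl_cns.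
have bE s : bdf A' (cns s x) <-> bdf A (cns (- s) x).
  rewrite /bdf /= !cns0 !tl_cns.
  have -> : (fun t => A' (cns t x)) = (fun t => A (cns (- t) x))
    by apply/funext.
  split=> [|h]; first exact: (@bd_opp (fun t => A (cns t x))).
  rewrite -[s]opprK; apply: (@bd_opp (fun t => A (cns (- t) x))).
  by rewrite (_ : (fun s => _) = (fun t => A (cns t x)))//; apply/funext => u;
    rewrite opprK.
have [|||l [Nl lt hl]] := @nearest_left _ A' x (- t) (- b) dA'.
- by rewrite AE opprK.
- by move/bE; rewrite opprK.
- by move=> s; rewrite AE => /hb; lra.
exists (- l); split; [exact/bE|lra|move=> s hs Ns].
by apply: (hl (- s)); [lra|apply/bE; rewrite opprK].
Qed.

Lemma below_eq n (N : set 'rV[K]_n.+1) k s t x : s <= t ->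
  (forall w, s <= w < t -> ~ N (cns w x)) ->
  below N k (cns t x) -> below N k (cns s x).
Proof.
case: k => // k st h [w]; rewrite cns0 tl_cns => -[wt [Nw bw]].
exists w; rewrite cns0 tl_cns; split=> //.
by rewrite ltNge; apply/negP => sw; apply: (h w) => //; rewrite sw.
Qed.

(** Points of [A] are sorted by the number [k] of boundary points below them in their fibre, which
    is bounded. In the layer of a given [k] the boundary points form a graph, and the others fill,
    in each fibre, at most one interval between consecutive boundary points. *)
Lemma fibre_pieces n (A : set 'rV[K]_n.+1) : definable M A ->
  (forall x, exists b : K, forall t, A (cns t x) -> `|t| < b) ->
  piecewise (fibre_leaf (bdf A)) A.
Proof.
move=> dA bA; set N := bdf A.
have dN : definable M N by exact: definable_bdf.
have dB k : definable M (below N k) by exact: definable_below.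
have [k0 hk0] := below_bound dN (fun x => bdf_fin x dA).
suff H k : piecewise (fibre_leaf N) (A `\` below N k).
  rewrite (_ : A = A `\` below N k0)//; apply/seteqP; split=> [x Ax|x []//].
  by split=> //; exact: hk0.
elim: k => [|k IH].
  rewrite /= setDT; apply: piecewise_leaf; first exact: definable0.
  exists set0; first exact: definable0.
  left; exists (fun=> 0); first by apply: dF_intro; ddef.
  by split=> //; apply/seteqP; split=> x // [].
apply: (piecewise_split (dB k)); last first.
  rewrite (_ : _ `\` _ = A `\` below N k)//; apply/seteqP; split=> x; first
    by move=> [[Ax _] ?].
  by move=> [Ax h]; split=> //; split=> // /below_decr.
have dR : definable M ((A `\` below N k.+1) `&` below N k).
  by apply: definableI => //; apply: definableD.
set R := _ `&` _ in dR *.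
apply: (piecewise_split dN).
  apply: piecewise_leaf; first exact: definableI.
  have fR x s t : (R `&` N) (cns s x) -> (R `&` N) (cns t x) -> s = t.
    wlog st : s t / s < t.
      move=> H h1 h2; have [st|ts|//] := ltgtP s t; first exact: H.
      by apply/esym; exact: H.
    move=> [[_ bs] Ns] [[[_ nt] _] _]; exfalso; apply: nt; exists s.
    by rewrite cns0 tl_cns.
  have dRN : definable M (R `&` N) by exact: definableI.
  have [dl hl] := dF_xget dRN fR.
  exists [set x | exists t, (R `&` N) (cns t x)]; first by apply: definableP;
    ddef.
  left; eexists; first exact: dl.
  split; last by move=> x [].
  apply/seteqP; split=> v.
    rewrite -{1}(cns_tl v) => RNv; split; first by exists (v 0 ord0).
    by rewrite (hl _ _ RNv).
  move=> [[t RNt]]; rewrite (hl _ _ RNt) => vt.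
  by rewrite -(cns_tl v) vt.
have dR' : definable M (R `\` N) by exact: definableD.
set R' := _ `\` _ in dR' *.
have R'itv x t : R' (cns t x) -> exists l u, [/\ N (cns l x), N (cns u x),
  l < t < u &
    forall s, R' (cns s x) <-> l < s < u].
  move=> [[[At nbt] bt] Nt]; have [b hb] := bA x.
  have [|l [Nl lt hl]] := nearest_left dA At Nt (b := - b).
    by move=> s /hb; rewrite ltr_norml => /andP[].
  have [|u [Nu tu hu]] := nearest_right dA At Nt (b := b).
    by move=> s /hb; rewrite ltr_norml => /andP[].
  exists l, u; split=> //; first by rewrite lt.
  move=> s; split.
    move=> [[[As nbs] bs] Ns]; apply/andP; split; rewrite ltNge; apply/negP =>
      h.
      have sl : s < l.
        by rewrite lt_neqAle h andbT; apply/negP => /eqP E; apply: Ns;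
          rewrite E.
      apply: nbt; exists l; rewrite cns0 tl_cns; split=> //; split=> //.
      exact: below_mono bs.
    have us : u < s.
      by rewrite lt_neqAle h andbT; apply/negP => /eqP E; apply: Ns; rewrite -E.
    apply: nbs; exists u; rewrite cns0 tl_cns; split=> //; split=> //.
    exact: below_mono (ltW tu) bt.
  move=> /andP[ls su].
  have nN w : l < w < u -> ~ N (cns w x).
    move=> /andP[lw wu]; have [wt|tw] := leP w t; first by apply: hl;
      rewrite lw.
    by apply: hu; rewrite (ltW tw).
  have nb w : l < w < u -> ~ bd (fun t => A (cns t x)) w.
    by move=> /nN; rewrite /N /bdf /= cns0 tl_cns.
  have [st|/ltW ts] := leP s t.
    have As : A (cns s x).
      apply: contrapT => nAs.
      have := bd_cst omin (S := fun t => ~ A (cns t x)) (t := s) (t' := t)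
        (s := t).
      apply=> //.
      - by have := D1_fiber x dA => d; rewrite /D1; ddef.
      - move=> w wst bw; have /nb : l < w < u by lra.
        apply=> r r0; have [[z [h1 h2]] [z' [h3 h4]]] := bw r r0.
        by split; [exists z'; split=> //; exact: contrapT|exists z].
      - by rewrite st lexx.
    split; last by apply: nN; rewrite ls.
    split; last by apply: below_eq bt => // w ?; apply: nN; lra.
    by split=> // /(below_mono st).
  have As : A (cns s x).
    apply: (bd_cst omin (D1_fiber x dA) (t := t) (t' := s)) => //.
      by move=> w wst; apply: nb; lra.
    by rewrite ts lexx.
  split; last by apply: nN; rewrite ls.
  split; last exact: below_mono bt.
  by split=> // bs; apply: nbt; apply: below_eq bs => // w ?; apply: nN; lra.
(* The endpoints are described by the fibre of [R'] alone, hence are definable functions of the base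
   point. *)
pose Xl := [set v : 'rV[K]_n.+1 | exists u : K, v 0 ord0 < u /\
  forall s, R' (cns s (tl v)) <-> v 0 ord0 < s < u].
pose Xu := [set v : 'rV[K]_n.+1 | exists l : K, l < v 0 ord0 /\
  forall s, R' (cns s (tl v)) <-> l < s < v 0 ord0].
have dXl : definable M Xl by apply: definableP; rewrite /Xl; ddef.
have dXu : definable M Xu by apply: definableP; rewrite /Xu; ddef.
have [|dl hl] := dF_xget dXl.
  move=> x s t [u]; rewrite cns0 tl_cns => -[su h1] [u'];
    rewrite cns0 tl_cns => -[tu' h2].
  have [|//] := @itv_endpoints s u t u' su tu' _.
  by move=> w; rewrite -h1 h2.
have [|du hu] := dF_xget dXu.
  move=> x s t [l]; rewrite cns0 tl_cns => -[su h1] [l'];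
    rewrite cns0 tl_cns => -[tu' h2].
  have [|//] := @itv_endpoints l s l' t su tu' _.
  by move=> w; rewrite -h1 h2.
apply: piecewise_leaf => //.
exists [set x | exists t, R' (cns t x)]; first by apply: definableP; ddef.
right; eexists; eexists; split; [exact: dl|exact: du| |].
  apply/seteqP; split=> v; last first.
    move=> [[t R't]]; have [l [u [Nl Nu /andP[lt tu] h]]] := R'itv _ _ R't.
    rewrite (hl _ l) ?(hu _ u); last 2 first.
    - by exists l; rewrite cns0 tl_cns; split=> //; exact: lt_trans lt tu.
    - by exists u; rewrite cns0 tl_cns; split=> //; exact: lt_trans lt tu.
    by rewrite -h cns_tl.
  rewrite -{1}(cns_tl v) => R'v; have [l [u [Nl Nu /andP[lt tu] h]]] :=
    R'itv _ _ R'v.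
  split; first by exists (v 0 ord0).
  rewrite (hl _ l) ?(hu _ u) ?lt ?tu//.
  - by exists l; rewrite cns0 tl_cns; split=> //; exact: lt_trans lt tu.
  - by exists u; rewrite cns0 tl_cns; split=> //; exact: lt_trans lt tu.
move=> x [t R't]; have [l [u [Nl Nu /andP[lt tu] h]]] := R'itv _ _ R't.
have lu := lt_trans lt tu.
rewrite (hl _ l) ?(hu _ u)//.
- by exists l; rewrite cns0 tl_cns.
- by exists u; rewrite cns0 tl_cns.
Qed.

Definition small_leaf n (A : set 'rV[K]_n.+1) : Prop :=
  (exists E, [/\ definable M E, ~ fat E & forall v, A v -> E (tl v)]) \/
  (exists D l, [/\ definable M D, dF M l & A = grph D l]).

(** The base points whose fibre contains an interval form a small set by [fat_fibers]. Over the
    others the fibres are finite, thus bounded, and a nonempty band cannot occur. *)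
Lemma small_pieces n (A : set 'rV[K]_n.+1) : definable M A -> ~ fat A ->
  piecewise (@small_leaf n) A.
Proof.
move=> dA nA; pose E := [set x | open_in (fun t => A (cns t x))].
have dE : definable M E by exact: definable_open_in.
have nE : ~ fat E by move=> /(fat_fibers omin asat dA).
have dE' : definable M [set v : 'rV[K]_n.+1 | E (tl v)] by apply: definableP;
  ddef.
apply: (piecewise_split dE').
  apply: piecewise_leaf; first exact: definableI.
  by left; exists E; split=> // v [].
have dA' := definableD dA dE'.
apply: piecewise_mono (fibre_pieces dA' _) => [B dB BA|x].
  move=> [D dD [[l dl [-> _]]|[l [u [dl du EB lu]]]]]; right; exists D, l;
    split=> //.
  have nD x : ~ D x.
    move=> Dx; have [lux _ _] := lu _ Dx.
    have [_] : (A `\` [set v | E (tl v)]) (cns ((l x + u x) / 2) x).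
      by apply: BA; rewrite EB /band /= cns0 tl_cns; split=> //; lra.
    rewrite /= tl_cns; apply; exists (l x), (u x); split=> // t ht.
    suff : (A `\` [set v | E (tl v)]) (cns t x) by case.
    by apply: BA; rewrite EB /band /= cns0 tl_cns.
  by rewrite EB; apply/seteqP; split=> v [/nD].
have [Ex|nEx] := pselect (E x).
  by exists 0 => t [_]; rewrite /= tl_cns.
have [//|[s hs]] := D1_fin omin (D1_fiber x dA).
exists (1 + \sum_(t <- s) `|t|) => t [/hs ts _].
rewrite (big_rem t)//= addrCA ltrDl ltr_wpDr// sumr_ge0//.
Qed.

(** Omission of the coordinate [i] is injective on [B], so that a function on [B] becomes one of
    fewer variables. *)
Definition thin n (B : set 'rV[K]_n) : Prop := (forall x, ~ B x) \/
  exists i : 'I_n, forall x y, B x -> B y ->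
    (forall j, j != i -> x 0 j = y 0 j) -> x = y.

Lemma thin_pieces n (A : set 'rV[K]_n) : definable M A -> ~ fat A ->
  piecewise (@thin n) A.
Proof.
elim: n A => [|n IH] A dA nA.
  apply: piecewise_leaf => //; left=> x Ax; apply: nA; exists x, 1;
    split=> // y _.
  by rewrite (_ : y = x)//; apply/rowP; case.
apply: piecewise_bind (small_pieces dA nA) _ =>
  B dB _ [[E [dE nE BE]]|[D [l [dD dl ->]]]].
  apply: (piecewise_over dB BE (IH _ dE nE)) => C dC CE [nC|[i hi]].
    by apply: piecewise_leaf; [exact: definable_over|left=> x [_ /nC]].
  apply: piecewise_leaf; first exact: definable_over.
  right; exists (lift ord0 i) => x y [_ Cx] [_ Cy] h.
  have txy : tl x = tl y.
    apply: hi => // j ji; rewrite !mxE; apply: h.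
    by rewrite (inj_eq lift_inj).
  by rewrite -(cns_tl x) -(cns_tl y) txy h.
apply: piecewise_leaf; first by apply: definableP; rewrite /grph; ddef.
right; exists ord0 => x y [_ hx] [_ hy] h.
have txy : tl x = tl y by apply/rowP => j; rewrite !mxE h.
by rewrite -(cns_tl x) -(cns_tl y) hx hy txy.
Qed.

Definition contOn n (l : 'rV[K]_n -> K) (B : set 'rV[K]_n) : Prop :=
  forall x, B x -> forall r : K, 0 < r ->
    exists s : K, 0 < s /\ forall y, B y -> box x s y -> `|l y - l x| < r.

Lemma contOn_sub n (l : 'rV[K]_n -> K) B C : C `<=` B -> contOn l B ->
  contOn l C.
Proof.
move=> CB h x /CB Bx r r0; have [s [s0 hs]] := h x Bx r r0.
by exists s; split=> // y /CB; exact: hs.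
Qed.

(** The points of discontinuity form a small set. On a thin piece of it [l] factors through the
    omission of a coordinate, and the induction hypothesis applies to the factor [g]; continuity is
    thus relative to the piece. *)
Lemma contOn_pieces n (l : 'rV[K]_n -> K) D : dF M l -> definable M D ->
  piecewise (contOn l) D.
Proof.
elim: n l D => [|n IH] l D dl dD.
  apply: piecewise_leaf => // x _ r r0; exists 1; split=> // y _ _.
  by rewrite (_ : y = x) ?subrr ?normr0//; apply/rowP; case.
have dc := definable_contAt dl.
apply: (piecewise_split dc).
  apply: piecewise_leaf; first exact: definableI.
  move=> x [_ cx] r r0; have [s [s0 hs]] := cx r r0.
  by exists s; split=> // y _; exact: hs.
have dD' := definableD dD dc.
apply: piecewise_bind (thin_pieces dD' _) _.
  move=> fD; apply: (generic_contAt omin asat dl).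
  by apply: fat_sub fD => x [].
move=> B dB _ [nB|[i hi]].
  by apply: piecewise_leaf => // x /nB.
pose drop (x : 'rV[K]_n.+1) : 'rV[K]_n := \row_j x 0 (lift i j).
pose X := [set v : 'rV[K]_n.+1 | exists x : 'rV[K]_n.+1,
  B x /\ drop x = tl v /\ v 0 ord0 = l x].
have dX : definable M X by apply: definableP; rewrite /X /drop; ddef.
have dropI x y : B x -> B y -> drop x = drop y -> x = y.
  move=> Bx By /rowP h; apply: hi => // j; case: (unliftP i j) => [k -> _|->].
    by have := h k; rewrite !mxE.
  by rewrite eqxx.
have [|dg hg] := dF_xget dX.
  move=> y s t [x]; rewrite cns0 tl_cns => -[Bx [xy ->]] [x'].
  rewrite cns0 tl_cns => -[Bx' [x'y ->]].
  by rewrite (dropI x x')// xy.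
set g := (fun x => _) in dg.
have gE x : B x -> g (drop x) = l x.
  by move=> Bx; apply: hg; exists x; rewrite cns0 tl_cns.
have dT : definable M [set: 'rV[K]_n] by apply: definableP; ddef.
rewrite (_ : B = [set v | B v /\ setT (drop v)]); last first.
  by apply/seteqP; split=> v // [].
apply: piecewise_preimage (IH g setT dg dT) _ => [S dS|C dC _ cC].
  by apply: definableP; rewrite /drop; ddef.
apply: piecewise_leaf; first by apply: definableP; rewrite /drop; ddef.
move=> x [Bx Cx] r r0; have [s [s0 hs]] := cC _ Cx r r0.
exists s; split=> // y [By Cy] xy; rewrite -!gE//; apply: hs => //.
by move=> j; rewrite !mxE; exact: xy.
Qed.

End OMinimalPieces.
End Pieces.

(** * Transversal directions *)

Section Directions.
Context {L : language} {K : realFieldType} (M : structure L K).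

(** Positive and not infinitesimal: [m] bounds the inverse of [d], and it is through [m] that an
    aperture enters a Lipschitz constant. *)
Definition stdpos (d : K) : Prop := exists m : nat, 1 <= m%:R * d.

Lemma stdpos_gt0 d : stdpos d -> 0 < d.
Proof.
move=> [m h]; rewrite ltNge; apply/negP => d0.
have : m%:R * d <= 0 by rewrite mulr_ge0_le0.
lra.
Qed.

Lemma stdpos_div d (n : nat) : stdpos d -> stdpos (d / n.+1%:R).
Proof.
move=> [m h]; exists (m * n.+1)%N.
by rewrite natrM -mulrA (mulrC d) mulVKf ?pnatr_eq0.
Qed.

Lemma stdpos1 : stdpos 1.
Proof. by exists 1%N; rewrite mulr1. Qed.

(* Locally no secant of [N] lies in the cone of aperture [d] around [e].  Over
   the projection along [e], continuous sections of [N] are then locally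
   Lipschitz with a constant controlled by [d]. *)
Definition transversal n (N : set 'rV[K]_n) (e : 'rV[K]_n) (d : K) : Prop :=
  forall p, N p -> exists r : K, 0 < r /\ forall y z, N y -> N z ->
    box p r y -> box p r z -> forall t : K, 0 < t < r ->
    ~ (forall i, `|y 0 i - z 0 i - t * e 0 i| < d * t).

Lemma transversal_sub n (N N' : set 'rV[K]_n) e d : N' `<=` N ->
  transversal N e d -> transversal N' e d.
Proof.
move=> sN h p /sN Np; have [r [r0 hr]] := h p Np.
by exists r; split=> // y z /sN Ny /sN; exact: hr.
Qed.

Lemma transversal0 n (e : 'rV[K]_n) d : transversal set0 e d.
Proof. by move=> p. Qed.

Lemma transversal_cylinder n (N : set 'rV[K]_n) (e : 'rV[K]_n.+1) d :
  transversal N (tl e) d -> transversal [set v | N (tl v)] e d.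
Proof.
move=> h p Np; have [r [r0 hr]] := h _ Np; exists r;
  split=> // y z Ny Nz py pz t ht k.
apply: (hr _ _ Ny Nz _ _ t ht) => i; rewrite !mxE.
- exact: py.
- exact: pz.
- exact: k.
Qed.

Lemma incr_le n (l : 'rV[K]_n -> K) x r r' w :
  r' <= r -> incr l x r w -> incr l x r' w.
Proof.
move=> rr h y xy t /andP[t0 tr]; apply: h; first exact: box_le xy.
by rewrite t0 (lt_le_trans tr).
Qed.

Lemma incr_scale n (l : 'rV[K]_n -> K) x r w a :
  0 < a <= 1 -> incr l x r w -> incr l x r (a *: w).
Proof.
move=> /andP[a0 a1] h y xy t /andP[t0 tr]; rewrite tlZ scalerA mxE mulrA.
by apply: h => //; rewrite mulr_gt0//= (le_lt_trans _ tr)// ler_piMr// ltW.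
Qed.

Lemma shrink_radius (r c : K) : 0 < r -> 0 < c ->
  [/\ 0 < r / (1 + c), r / (1 + c) <= r & r / (1 + c) + r / (1 + c) * c = r].
Proof.
move=> r0 c0; have c1 : 0 < 1 + c by rewrite addr_gt0.
have rc : r / (1 + c) + r / (1 + c) * c = r.
  by rewrite -{1}[r / _]mulr1 -mulrDr divfK// gt_eqF.
have rp : 0 < r / (1 + c) by rewrite divr_gt0.
by split=> //; rewrite -[leRHS]rc lerDl mulr_ge0// ltW.
Qed.

(** Moving by [w1 + w2] is moving by [w1] and then by [w2]. The radius keeps the intermediate point
    in the box; it depends on [w1] only through the bound [c], whence the uniform radii of
    [incr_sum]. *)
Lemma incr_add n (l : 'rV[K]_n -> K) x r w1 w2 c : 0 < r -> 0 < c ->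
  (forall i, `|tl w1 0 i| <= c) -> incr l x r w1 -> incr l x r w2 ->
  incr l x (r / (1 + c)) (w1 + w2).
Proof.
move=> r0 c0 hc h1 h2 y xy t /andP[t0 tr]; have [s0 sr E] :=
  shrink_radius r0 c0.
have t0r : 0 < t < r by rewrite t0 (lt_le_trans tr).
rewrite tlD mxE mulrDr scalerDr !addrA.
apply: (@lt_trans _ _ (l (y + t *: tl w1) + t * w2 0 ord0)).
  by rewrite ltrD2r; apply: h1 => //; exact: box_le xy.
apply: h2 => //; rewrite -E; apply: box_move => // i.
by rewrite mxE normrM gtr0_norm//; apply: ler_pM => //; exact: ltW.
Qed.

Lemma inc_add n (l : 'rV[K]_n -> K) x w1 w2 :
  inc l x w1 -> inc l x w2 -> inc l x (w1 + w2).
Proof.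
move=> [r1 [r10 h1]] [r2 [r20 h2]].
have [c c0 hc] := norm_row_bound (tl w1).
have r0 : 0 < Num.min r1 r2 by rewrite lt_min r10.
have [s0 _ _] := shrink_radius r0 c0.
exists (Num.min r1 r2 / (1 + c)); split=> //; apply: incr_add => //.
  by apply: incr_le h1; rewrite ge_min lexx.
by apply: incr_le h2; rewrite ge_min lexx orbT.
Qed.

Lemma inc_scale n (l : 'rV[K]_n -> K) x w a :
  0 < a -> inc l x w -> inc l x (a *: w).
Proof.
move=> a0 [r [r0 h]]; exists (Num.min r (r / a)).
have ra : 0 < r / a by rewrite divr_gt0.
split; first by rewrite lt_min r0.
move=> y xy t /andP[t0]; rewrite lt_min => /andP[tr tra].
rewrite tlZ scalerA mxE mulrA; apply: h.
  by apply: box_le xy; rewrite ge_min lexx.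
by rewrite mulr_gt0//= -ltr_pdivlMr.
Qed.

Lemma inc_level n (l : 'rV[K]_n -> K) x w1 w2 :
  inc l x w1 -> level l x w2 -> inc l x (w1 + w2).
Proof.
move=> [r1 [r10 h1]] [r2 [r20 h2]].
have [c c0 hc] := norm_row_bound (tl w1).
have r0 : 0 < Num.min r1 r2 by rewrite lt_min r10.
have [s0 sr E] := shrink_radius r0 c0.
exists (Num.min r1 r2 / (1 + c)); split=> // y xy t /andP[t0 tr].
have tr12 : t < Num.min r1 r2 by exact: lt_le_trans sr.
move: (tr12); rewrite lt_min => /andP[tr1 tr2].
rewrite tlD scalerDr addrA h2.
- rewrite mxE mulrDr addrA ltrD2r; apply: h1; last by rewrite t0.
  by apply: box_le xy; rewrite (le_trans sr)// ge_min lexx.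
- apply: (@box_le _ _ _ _ (Num.min r1 r2)); first by rewrite ge_min lexx orbT.
  rewrite -E; apply: box_move => // i.
  by rewrite mxE normrM gtr0_norm//; apply: ler_pM => //; exact: ltW.
- by rewrite t0.
Qed.

Lemma level_opp n (l : 'rV[K]_n -> K) x w : level l x w -> level l x (- w).
Proof.
move=> [r [r0 h]]; have [c c0 hc] := norm_row_bound (tl w).
have [s0 sr E] := shrink_radius r0 c0.
exists (r / (1 + c)); split=> // y xy t /andP[t0 tr].
have := h (y - t *: tl w) _ t; rewrite subrK tlN scalerN mxE mulrN.
move=> -> //; rewrite ?addrK// ?t0 ?(lt_le_trans tr)//.
rewrite -E; apply: box_move => // i.
by rewrite mxE normrN mxE normrM gtr0_norm//; apply: ler_pM => //; exact: ltW.
Qed.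

(** If [w] is not a direction of increase, then [- w] is one or is level, and [v - w] inherits the
    increase from [v]. *)
Lemma decided_alt n (l : 'rV[K]_n -> K) x v w :
  inc l x v -> decided l x w -> inc l x w \/ inc l x (v - w).
Proof.
move=> hv [hw|hw|hw]; [by left|right..]; first exact: inc_add.
by apply: inc_level => //; exact: level_opp.
Qed.

(** The radius is chosen before [v], because [transversal] compares all secants near a point at a
    single scale. *)
Definition one_sided n (l : 'rV[K]_n -> K) (D : set 'rV[K]_n) (e : 'rV[K]_n.+1)
  (d : K) :=
  exists s : K, (s = 1 \/ s = - 1) /\ forall x, D x -> exists r : K, 0 < r /\
    forall v : 'rV[K]_n.+1, (forall i, `|v 0 i - e 0 i| < d) ->
      incr l x r (s *: v).

Definition cube_in n (e : 'rV[K]_n) d (e0 : 'rV[K]_n) d0 :=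
  forall i, `|e 0 i - e0 0 i| + d <= d0.

Lemma cube_in_refl n (e : 'rV[K]_n) d : cube_in e d e d.
Proof. by move=> i; rewrite subrr normr0 add0r. Qed.

Lemma cube_in_trans n (e : 'rV[K]_n) d e1 d1 e2 d2 :
  cube_in e d e1 d1 -> cube_in e1 d1 e2 d2 -> cube_in e d e2 d2.
Proof.
move=> h1 h2 i; have := h1 i; have := h2 i.
have := ler_distD (e1 0 i) (e 0 i) (e2 0 i); lra.
Qed.

Lemma cube_in_lt n (e : 'rV[K]_n) d e0 d0 (v : 'rV[K]_n) : cube_in e d e0 d0 ->
  (forall i, `|v 0 i - e 0 i| < d) -> forall i, `|v 0 i - e0 0 i| < d0.
Proof.
move=> h1 h2 i; have := h1 i; have := h2 i.
have := ler_distD (e 0 i) (v 0 i) (e0 0 i); lra.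
Qed.

Lemma one_sided_sub n (l : 'rV[K]_n -> K) D D' e d e' d' : D' `<=` D ->
  cube_in e' d' e d -> one_sided l D e d -> one_sided l D' e' d'.
Proof.
move=> DD c [s [s1 h]]; exists s; split=> // x /DD/h[r [r0 hr]].
by exists r; split=> // v hv; apply: hr; exact: cube_in_lt hv.
Qed.

(** A forbidden secant is [t *: v] with [v] in the cube around [e]. Translation by it, or by its
    opposite if [s = -1], takes a point of the graph to a point of the graph, contrary to the strict
    inequality in [incr]. *)
Lemma one_sided_transversal n (l : 'rV[K]_n -> K) D e d : one_sided l D e d ->
  transversal (grph D l) e d.
Proof.
move=> [s [s1 h]] p [Dp pl]; have [r [r0 hr]] := h _ Dp.
exists r; split=> // y z [_ yl] [_ zl] py pz t /andP[t0 tr] k.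
have tn0 : t != 0 by rewrite gt_eqF.
have [v tv] : exists v, t *: v = y - z.
  by exists (t^-1 *: (y - z)); rewrite scalerA mulfV// scale1r.
have hv i : `|v 0 i - e 0 i| < d.
  rewrite -(ltr_pM2r t0) -{1}(gtr0_norm t0) -normrM mulrBl [e 0 i * t]mulrC.
  have -> : v 0 i * t = y 0 i - z 0 i; last exact: k.
  by have /rowP/(_ i) := tv; rewrite !mxE mulrC.
have tlb q : box p r q -> box (tl p) r (tl q) by move=> pq i; rewrite !mxE.
have t0r : 0 < t < r by rewrite t0.
have v0 : t * v 0 ord0 = y 0 ord0 - z 0 ord0.
  by have /rowP/(_ ord0) := tv; rewrite !mxE.
have tlv : t *: tl v = tl y - tl z by rewrite -tlZ tv tlD tlN.
have Ez : tl z + t *: tl v = tl y by rewrite tlv addrC subrK.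
have Ey : tl y + t *: tl (- v) = tl z
  by rewrite tlN scalerN tlv opprB addrC subrK.
have := hr v hv; case: s1 => ->.
  by rewrite scale1r => /(_ (tl z) (tlb _ pz) t t0r); rewrite Ez -yl -zl v0;
    lra.
rewrite scaleN1r => /(_ (tl y) (tlb _ py) t t0r).
by rewrite Ey -yl -zl mxE mulrN v0; lra.
Qed.

Notation unit_row i := (delta_mx (0 : 'I_1) i).

(** One radius serves all choices [f]. The list is nonempty because the zero vector is not a
    direction of increase. *)
Lemma incr_sum n (l : 'rV[K]_n -> K) x N (W : 'I_N -> set 'rV[K]_n.+1) c :
  0 < c -> (forall i w, W i w -> forall j, `|w 0 j| <= c) ->
  (forall i, exists r : K, 0 < r /\ forall w, W i w -> incr l x r w) ->
  forall (s : seq 'I_N) i0, exists r : K, 0 < r /\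
    forall f, (forall i, W i (f i)) -> incr l x r (\sum_(i <- i0 :: s) f i).
Proof.
move=> c0 hc hW; elim=> [|i1 s IH] i0.
  have [r [r0 hr]] := hW i0; exists r; split=> // f hf.
  by rewrite big_seq1; exact: hr.
have [r1 [r10 hr1]] := hW i0; have [r2 [r20 hr2]] := IH i1.
have r0 : 0 < Num.min r1 r2 by rewrite lt_min r10.
have [s0 sr E] := shrink_radius r0 c0.
exists (Num.min r1 r2 / (1 + c)); split=> // f hf; rewrite big_cons.
apply: incr_add => //.
- by move=> i; rewrite mxE; exact: hc (hf i0) _.
- by apply: incr_le (hr1 _ (hf i0)); rewrite ge_min lexx.
- by apply: incr_le (hr2 f hf); rewrite ge_min lexx orbT.
Qed.

(* A vector of the small cube is an average of points of the segments from
   [e - d u_i] to [e + d u_i], [u_i] the unit vectors, and the directions of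
   increase form a convex cone.  The radius [r] does not depend on the vector. *)
Lemma cross_cube n (l : 'rV[K]_n -> K) x (e : 'rV[K]_n.+1) (d s : K) : 0 < d ->
  (s = 1 \/ s = -1) ->
  (forall i, inc l x (s *: (e + d *: unit_row i)) /\
             inc l x (s *: (e - d *: unit_row i))) ->
  exists r : K, 0 < r /\ forall v : 'rV[K]_n.+1,
    (forall i, `|v 0 i - e 0 i| < d / n.+1%:R) -> incr l x r (s *: v).
Proof.
move=> d0 s1 hx; have [ce ce0 hce] := norm_row_bound e.
have N0 : 0 < n.+1%:R :> K by [].
have Nn0 : n.+1%:R != 0 :> K by rewrite pnatr_eq0.
have dn0 : d != 0 by rewrite gt_eqF.
have ns : `|s| = 1 by case: s1 => ->; rewrite ?normrN normr1.
pose W (i : 'I_n.+1) := [set w : 'rV[K]_n.+1 | exists a : K, `|a| < d /\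
   w = s *: (n.+1%:R^-1 *: (e + a *: unit_row i))].
have coord (i j : 'I_n.+1) (a : K) : (e + a *: unit_row i) 0 j =
    e 0 j + a * (j == i)%:R by rewrite !mxE eqxx.
have hcoord (i j : 'I_n.+1) (a : K) : `|a| <= d ->
  `|(e + a *: unit_row i) 0 j| <= ce + d.
  move=> ad; rewrite coord (le_trans (ler_normD _ _))// lerD// normrM.
  by rewrite normr_nat; case: (j == i); rewrite ?mulr1// mulr0 ltW.
have cd0 : 0 < ce + d by rewrite addr_gt0.
have [||r [r0 hr]] := @incr_sum n l x _ W (ce + d) cd0 _ _ (behead (enum
  'I_n.+1)) ord0.
- move=> i w [a [ad ->]] j; rewrite !mxE -[X in `|_ * (_ * X)|]coord.
  rewrite normrM ns mul1r normrM ger0_norm ?invr_ge0//.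
  rewrite -[leRHS]mul1r; apply: ler_pM; rewrite ?invr_ge0//.
    by rewrite invf_le1// ler1n.
  exact: hcoord (ltW ad).
- move=> i; have [[r1 [r10 h1]] [r2 [r20 h2]]] := hx i.
  have r0 : 0 < Num.min r1 r2 by rewrite lt_min r10.
  have [s0 sr E] := shrink_radius r0 cd0.
  exists (Num.min r1 r2 / (1 + (ce + d))); split=> // w [a [ad ->]].
  have /andP[ad1 ad2] : - d < a < d by rewrite -ltr_norml.
  (* The point of the segment with parameter [a] is a convex combination of its ends, with positive
     coefficients because [a] is strictly between [- d] and [d]. *)
  have [b1 [b2 [b12 b1d b10 b20]]] : exists b1 b2 : K,
      [/\ b1 + b2 = 1, b1 * d - b2 * d = a, 0 < b1 & 0 < b2].
    have d20 : 0 < 2 * d by rewrite mulr_gt0.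
    exists ((d + a) / (2 * d)), ((d - a) / (2 * d)); split;
      [by field|by field| |];
      by rewrite divr_gt0//; lra.
  rewrite scalerA [s * _]mulrC -scalerA; apply: incr_scale.
    by rewrite invr_gt0 N0 invf_le1// ler1n.
  rewrite (_ : s *: _ = b1 *: (s *: (e + d *: unit_row i)) +
      b2 *: (s *: (e - d *: unit_row i))); last first.
    apply/rowP => j; rewrite !mxE -b1d.
    set q := (_ && _)%:R; have -> : s * (e 0 j + (b1 * d - b2 * d) * q) =
      s * (((b1 + b2) * e 0 j + (b1 * d - b2 * d) * q)) by rewrite b12 mul1r.
    by ring.
  apply: incr_add => //.
  + move=> j; rewrite mxE mxE mxE !normrM ns mul1r gtr0_norm//.
    rewrite -[leRHS]mul1r; apply: ler_pM => //; first exact: ltW.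
      lra.
    by apply: hcoord; rewrite gtr0_norm.
  + apply: incr_scale; first by apply/andP; split=> //; lra.
    by apply: incr_le h1; rewrite ge_min lexx.
  + apply: incr_scale; first by apply/andP; split=> //; lra.
    by apply: incr_le h2; rewrite ge_min lexx orbT.
exists r; split=> // v hv.
(* The point chosen on the [i]-th segment overshoots the [i]-th coordinate of [v - e] by the factor
   [n.+1], so that the average is [v]; hence the division of [d] by [n.+1]. *)
have := hr (fun i => s *: (n.+1%:R^-1 *: (e + (n.+1%:R * (v 0 i - e 0 i)) *:
  unit_row i))).
rewrite (_ : ord0 :: behead (enum 'I_n.+1) = enum 'I_n.+1); last first.
  by rewrite enum_ordSl.
rewrite big_enum /= -scaler_sumr -scaler_sumr big_split /= sumr_const card_ord.
rewrite (_ : \sum_i _ = n.+1%:R *: (v - e)); last first.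
  apply/rowP => j; rewrite summxE (bigD1 j)//= !mxE !eqxx /= mulr1 big1
    ?addr0//.
  by move=> i ij; rewrite !mxE eqxx eq_sym (negPf ij) mulr0.
rewrite (_ : _ *: (_ + _) = v); last first.
  by apply/rowP => j; rewrite !mxE mulmxnE -(mulr_natl (e 0 j)) -mulrDr [e 0 j
    + _]addrC subrK mulKf.
apply.
move=> i; eexists; split; last by [].
by rewrite normrM ger0_norm// mulrC -ltr_pdivlMr.
Qed.

(** * Cubes of directions found by successive splitting *)

Section OMinimalDirections.
Hypothesis omin : o_minimal M.
Hypothesis asat : aleph1_saturated M.

Lemma decided_pieces n (l : 'rV[K]_n -> K) w D : dF M l -> definable M D ->
  piecewise M (fun D' => ~ fat D' \/ forall x, D' x -> decided l x w) D.
Proof.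
move=> dl dD.
have d1 := definable_inc w dl; have d2 := definable_inc (- w) dl.
have d3 := definable_level w dl.
apply: (piecewise_split d1).
  apply: piecewise_leaf; first exact: definableI.
  by right=> x [_ ix]; apply: Or31.
apply: (piecewise_split d2).
  apply: piecewise_leaf; first by apply: definableI => //; exact: definableD.
  by right=> x [_ ix]; apply: Or32.
apply: (piecewise_split d3).
  by apply: piecewise_leaf; [apply: definableI => //; apply: definableD => //;
    exact: definableD
    |right=> x [_ ix]; apply: Or33].
apply: piecewise_leaf; first by do 3 apply: definableD => //.
left=> f; have nf := @generic_decided _ _ _ omin asat _ l w dl.
apply: nf; apply: fat_sub f.
by move=> x [[[_ n1] n2] n3] [].
Qed.

(** The first [k] arms of the cross required by [cross_cube]. The centre [e] itself has to be a
    direction of increase, for it becomes the end of an arm at the next stage. *)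
Definition half_cross n (l : 'rV[K]_n -> K) (e0 : 'rV[K]_n.+1) d0 k D :=
  exists e d s, [/\ stdpos d, cube_in e d e0 d0, s = 1 \/ s = - 1 &
    forall x, D x -> inc l x (s *: e) /\ forall i : 'I_n.+1, (i < k)%N ->
      inc l x (s *: (e + d *: unit_row i)) /\
      inc l x (s *: (e - d *: unit_row i))].

(* From [e] and the next unit vector [u]: if [s (e + d u)] is not a direction of
   increase, then [s (e - d u)] is one, as their sum [2 s e] is.  Call [q] the
   one which is; the midpoint of [e] and [q] is the new centre, with [d / 2]. *)
Lemma half_cross_pieces n (l : 'rV[K]_n -> K) e0 d0 k D :
  dF M l -> definable M D -> stdpos d0 ->
  piecewise M (fun D' => ~ fat D' \/ half_cross l e0 d0 k D') D.
Proof.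
move=> dl dD sd0; have d00 := stdpos_gt0 sd0.
elim: k => [|k IH].
  apply: piecewise_bind (decided_pieces e0 dl dD) _ => B dB _ [nB|hB].
    by apply: piecewise_leaf => //; left.
  have sd2 := stdpos_div 1 sd0.
  have c0 : cube_in e0 (d0 / 2) e0 d0 by move=> i; rewrite subrr normr0; lra.
  have d1 := definable_inc e0 dl; have d2 := definable_inc (- e0) dl.
  apply: (piecewise_split d1).
    apply: piecewise_leaf; first exact: definableI.
    right; exists e0, (d0 / 2), 1; split=> //; first by left.
    by move=> x [_ ix]; rewrite scale1r.
  apply: (piecewise_split d2).
    apply: piecewise_leaf; first by apply: definableI => //; exact: definableD.
    right; exists e0, (d0 / 2), (- 1); split=> //; first by right.
    by move=> x [_ ix]; rewrite scaleN1r.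
  apply: piecewise_leaf; first by do 2 apply: definableD => //.
  (* Where [e0] is level, lowering its first coordinate moves the graph strictly below itself. *)
  right; exists (- ((d0 / 2) *: unit_row ord0) + e0), (d0 / 2), 1; split=> //.
  - move=> i; rewrite !mxE addrK normrN normrM normr_nat gtr0_norm; last lra.
    by case: (_ && _) => /=; lra.
  - by left.
  - move=> x [[Bx n1] n2]; split=> //; rewrite scale1r; apply: inc_level.
      exists 1; split=> // y _ t /andP[t0 _].
      have -> : tl (- (d0 / 2 *: unit_row ord0)) = 0 :> 'rV[K]_n.
        by apply/rowP => j; rewrite !mxE /= mulr0 oppr0.
      by rewrite scaler0 addr0 !mxE eqxx /= mulr1 mulrN gtrBl mulr_gt0//; lra.
    by case: (hB x Bx).
have [kn|kn] := ltnP k n.+1; last first.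
  apply: piecewise_mono IH => B _ _ [nB|[e [d [s [h1 h2 h3 h4]]]]];
    [by left|right].
  exists e, d, s; split=> // x /h4[h5 h6]; split=> // i _; apply: h6.
  exact: leq_trans (ltn_ord i) kn.
pose ik := Ordinal kn.
apply: piecewise_bind IH _ => B dB _ [nB|[e [d [s [sd ce s1 he]]]]].
  by apply: piecewise_leaf => //; left.
have d0' := stdpos_gt0 sd.
pose w := s *: (e + d *: unit_row ik).
have half_inc x (u v : 'rV[K]_n.+1) : inc l x (s *: u) -> inc l x (s *: v) ->
    inc l x (s *: (2^-1 *: (u + v))).
  move=> hu hv; rewrite scalerA mulrC -scalerA; apply: inc_scale.
    by rewrite invr_gt0.
  by rewrite scalerDr; exact: inc_add.
have key q (B' : set 'rV[K]_n) b : (b = 1 \/ b = -1) ->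
  q = e + (b * d) *: unit_row ik ->
    definable M B' -> B' `<=` B -> (forall x, B' x -> inc l x (s *: q)) ->
    half_cross l e0 d0 k.+1 B'.
  move=> b1 qE dB' BB' hq.
  have nb : `|b| = 1 by case: b1 => ->; rewrite ?normrN normr1.
  exists (2^-1 *: (e + q)), (d / 2), s; split=> //; first exact: (stdpos_div 1).
    apply: cube_in_trans ce => i; rewrite qE !mxE.
    set z := (_ && _)%:R; rewrite (_ : _ - _ = b * (d * 2^-1 * z)); last
      by field.
    rewrite normrM nb mul1r normrM normr_nat gtr0_norm; last lra.
    by rewrite /z; case: (_ && _) => /=; lra.
  move=> x B'x; have [h1 h2] := he x (BB' x B'x); have h3 := hq x B'x.
  split=> [|i]; first exact: half_inc.
  (* For an old coordinate the arms of the new cross end at the midpoints of [q] and the old ends;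
     for the new one they end at [q] and [e] themselves. *)
  rewrite ltnS leq_eqVlt => /predU1P[ik_eq|ik_lt]; last first.
    have [h4 h5] := h2 i ik_lt; split.
      have := half_inc x _ _ h4 h3; congr (inc l x (s *: _)).
      by apply/rowP => j; rewrite !mxE; field.
    have := half_inc x _ _ h5 h3; congr (inc l x (s *: _)).
    by apply/rowP => j; rewrite !mxE; field.
  have -> : i = ik by apply: val_inj.
  have E1 : 2^-1 *: (e + q) + (b * (d / 2)) *: unit_row ik = q.
    by rewrite qE; apply/rowP => j; rewrite !mxE; field.
  have E2 : 2^-1 *: (e + q) - (b * (d / 2)) *: unit_row ik = e.
    by rewrite qE; apply/rowP => j; rewrite !mxE; field.
  case: b1 E1 E2 => ->; rewrite ?mul1r ?mulN1r ?scaleNr ?opprK => -> ->;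
    by split.
apply: piecewise_bind (decided_pieces w dl dB) _ => C dC CB [nC|hC].
  by apply: piecewise_leaf => //; left.
have dw := definable_inc w dl.
apply: (piecewise_split dw).
  apply: piecewise_leaf; first exact: definableI.
  right; apply: (key (e + d *: unit_row ik) _ 1) => //.
  - by left.
  - by rewrite mul1r.
  - exact: definableI.
  - by move=> x [/CB].
  - by move=> x [].
apply: piecewise_leaf; first exact: definableD.
right; apply: (key (e - d *: unit_row ik) _ (-1)) => //.
- by right.
- by rewrite mulN1r scaleNr.
- exact: definableD.
- by move=> x [/CB].
move=> x [Cx nw]; have [h1 _] := he x (CB _ Cx).
have h2 : inc l x (2 *: (s *: e)) by apply: inc_scale.
have [//|] := decided_alt h2 (hC x Cx); congr (inc l x _).
by rewrite /w; apply/rowP => j; rewrite !mxE; ring.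
Qed.

Lemma one_sided_pieces n (l : 'rV[K]_n -> K) e0 d0 D :
  dF M l -> definable M D -> stdpos d0 ->
  piecewise M (fun D' => ~ fat D' \/ exists e d,
    [/\ stdpos d, cube_in e d e0 d0 & one_sided l D' e d]) D.
Proof.
move=> dl dD sd0.
apply: piecewise_mono (half_cross_pieces e0 n.+1 dl dD sd0) => B _ _ [nB|];
  first by left.
move=> [e [d [s [sd ce s1 he]]]]; right; exists e, (d / n.+1%:R).
have d0' := stdpos_gt0 sd.
split; first exact: stdpos_div.
  apply: cube_in_trans ce => i; rewrite subrr normr0 add0r.
  by rewrite ler_pdivrMr// ler_pMr// ler1n.
exists s; split=> // x Bx; apply: cross_cube => // i.
by have [_ /(_ i (ltn_ord i))] := he x Bx.
Qed.

End OMinimalDirections.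
End Directions.

(** * Cells with transversal boundary *)

Section Faces.
Context {L : language} {K : realFieldType} (M : structure L K).
Hypothesis omin : o_minimal M.
Hypothesis asat : aleph1_saturated M.

Lemma fat_tl n (A : set 'rV[K]_n.+1) (D : set 'rV[K]_n) :
  (forall v, A v -> D (tl v)) -> fat A -> fat D.
Proof.
move=> AD [v [r [r0 h]]]; exists (tl v), r; split=> // x vx.
have /AD : A (cns (v 0 ord0) x); last by rewrite tl_cns.
apply: h; rewrite -(cns_tl v) box_cns cns0; split=> //; by rewrite subrr normr0.
Qed.

Lemma grph_not_fat n (D : set 'rV[K]_n) l : ~ fat (grph D l).
Proof.
move=> [v [r [r0 h]]].
have [_ vl] := h v (box_refl _ r0).
have [|_] := h (cns (v 0 ord0 + r / 2) (tl v)).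
  rewrite -{1}(cns_tl v) box_cns; split; last exact: box_refl.
  by rewrite addrC addKr gtr0_norm; lra.
by rewrite cns0 tl_cns -vl; lra.
Qed.

Lemma definable_grph n (D : set 'rV[K]_n) l :
  definable M D -> dF M l -> definable M (grph D l).
Proof. by move=> dD dl; apply: definableP; rewrite /grph; ddef. Qed.

Definition bounded n (A : set 'rV[K]_n) : Prop :=
  exists b : K, forall x, A x -> forall i, `|x 0 i| < b.

Lemma bounded_sub n (A B : set 'rV[K]_n) : B `<=` A -> bounded A -> bounded B.
Proof. by move=> BA [b h]; exists b => x /BA; exact: h. Qed.

Lemma bounded_fibre n (A : set 'rV[K]_n.+1) x : bounded A ->
  exists b : K, forall t, A (cns t x) -> `|t| < b.
Proof. by move=> [b h]; exists b => t /h /(_ ord0); rewrite cns0. Qed.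

Lemma bounded_base n (A : set 'rV[K]_n.+1) D : bounded A ->
  (forall x, D x -> exists t, A (cns t x)) -> bounded D.
Proof.
move=> [b h] AD; exists b => x /AD[t /h k] i.
by have := k (lift ord0 i); rewrite cnsS.
Qed.

(** The frontier of an open set is covered by finitely many sets, all transversal to the same
    direction with the same aperture. *)
Definition faced n (A : set 'rV[K]_n) e d : Prop :=
  (forall x, A x -> interior A x) /\
  exists k (N : nat -> set 'rV[K]_n),
    (forall j, definable M (N j) /\ transversal (N j) e d) /\
    forall p, ~ A p -> (forall r : K, 0 < r -> exists y, A y /\ box p r y) ->
      exists j, (j < k)%N /\ N j p.

(** A frontier point of the band lies over a frontier point of [D], or over [D] and then, by
    continuity of [l] and [u], on one of their graphs. The former are covered by cylinders, whose
    transversality concerns only [tl e]. *)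
Lemma faced_band n (D : set 'rV[K]_n) l u (e : 'rV[K]_n.+1) d :
  definable M D -> dF M l -> dF M u ->
  (forall x, D x -> contAt l x) -> (forall x, D x -> contAt u x) ->
  one_sided l D e d -> one_sided u D e d -> faced D (tl e) d ->
    faced (band D l u) e d.
Proof.
move=> dD dl du cl cu sl su [oD [k [N [hN cov]]]]; split.
  move=> v [Dv /andP[lv vu]].
  have [r0 [r00 h0]] := oD _ Dv.
  have [|r1 [r10 h1]] := cl _ Dv ((v 0 ord0 - l (tl v)) / 2); first lra.
  have [|r2 [r20 h2]] := cu _ Dv ((u (tl v) - v 0 ord0) / 2); first lra.
  pose r := Num.min (Num.min (v 0 ord0 - l (tl v)) (u (tl v) - v 0 ord0) / 2)
    (Num.min r0 (Num.min r1 r2)).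
  have ra : r <= (v 0 ord0 - l (tl v)) / 2.
    by rewrite /r ge_min ler_pM2r// ge_min lexx.
  have rb : r <= (u (tl v) - v 0 ord0) / 2.
    by rewrite /r ge_min ler_pM2r// ge_min lexx orbT.
  exists r; split.
    by rewrite /r !lt_min divr_gt0 ?lt_min ?subr_gt0 ?lv ?vu ?r00 ?r10 ?r20.
  move=> w; rewrite -{1}(cns_tl v) -{1}(cns_tl w) box_cns => -[w0 wt].
  have rr0 : r <= r0 by rewrite /r !ge_min lexx ?orbT.
  have rr1 : r <= r1 by rewrite /r !ge_min lexx ?orbT.
  have rr2 : r <= r2 by rewrite /r !ge_min lexx ?orbT.
  split; first by apply: h0; exact: box_le wt.
  have := h1 _ (box_le rr1 wt); have := h2 _ (box_le rr2 wt).
  by move: w0; rewrite !ltr_norml; lra.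
exists k.+2, (fun j => if j is j'.+2 then [set v | N j' (tl v)] else
  if j is 1%N then grph D u else grph D l); split.
  case=> [|[|j]].
  - by split; [exact: definable_grph|exact: one_sided_transversal].
  - by split; [exact: definable_grph|exact: one_sided_transversal].
  - have [dN TN] := hN j; split; last exact: transversal_cylinder.
    by apply: definableP; ddef.
move=> p np close.
have [Dp|nDp] := pselect (D (tl p)); last first.
  have [r r0|j [jk Nj]] := cov _ nDp.
    have [y [[Dy _] py]] := close r r0; exists (tl y); split=> // i.
    by rewrite !mxE; exact: py.
  by exists j.+2.
have lp : l (tl p) <= p 0 ord0.
  rewrite leNgt; apply/negP => h.
  have [|r1 [r10 h1]] := cl _ Dp ((l (tl p) - p 0 ord0) / 2); first lra.
  have [|y [[Dy /andP[ly _]]]] :=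
    close (Num.min r1 ((l (tl p) - p 0 ord0) / 2)).
    by rewrite lt_min r10; lra.
  rewrite -{1}(cns_tl p) -{1}(cns_tl y) box_cns => -[y0 yt].
  have rr : Num.min r1 ((l (tl p) - p 0 ord0) / 2) <= r1 by rewrite ge_min lexx.
  have := h1 _ (box_le rr yt).
  have rr' : Num.min r1 ((l (tl p) - p 0 ord0) / 2) <= (l (tl p) - p 0 ord0) /
    2.
    by rewrite ge_min lexx orbT.
  have := lt_le_trans y0 rr'; rewrite !ltr_norml; lra.
have pu : p 0 ord0 <= u (tl p).
  rewrite leNgt; apply/negP => h.
  have [|r1 [r10 h1]] := cu _ Dp ((p 0 ord0 - u (tl p)) / 2); first lra.
  have [|y [[Dy /andP[_ uy]]]] :=
    close (Num.min r1 ((p 0 ord0 - u (tl p)) / 2)).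
    by rewrite lt_min r10; lra.
  rewrite -{1}(cns_tl p) -{1}(cns_tl y) box_cns => -[y0 yt].
  have rr : Num.min r1 ((p 0 ord0 - u (tl p)) / 2) <= r1 by rewrite ge_min lexx.
  have := h1 _ (box_le rr yt).
  have rr' : Num.min r1 ((p 0 ord0 - u (tl p)) / 2) <= (p 0 ord0 - u (tl p)) /
    2.
    by rewrite ge_min lexx orbT.
  have := lt_le_trans y0 rr'; rewrite !ltr_norml; lra.
have [pl|lp'] := eqVneq (p 0 ord0) (l (tl p)); first by exists 0%N.
have [pu'|up'] := eqVneq (p 0 ord0) (u (tl p)); first by exists 1%N.
exfalso; apply: np; split=> //.
by rewrite !lt_neqAle lp pu eq_sym lp' up'.
Qed.

Lemma contAt_pieces n (l : 'rV[K]_n -> K) D : dF M l -> definable M D ->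
  piecewise M (fun D' => ~ fat D' \/ forall x, D' x -> contAt l x) D.
Proof.
move=> dl dD; have dc := definable_contAt dl.
apply: (piecewise_split dc).
  by apply: piecewise_leaf; [exact: definableI|right=> x []].
apply: piecewise_leaf; first exact: definableD.
left=> f; have nf := generic_contAt omin asat dl.
by apply: nf; apply: fat_sub f => x [].
Qed.

(** The induction on the base supplies the last [n] coordinates of a direction; the first one is
    kept from [v]. *)
Definition cap n (v : 'rV[K]_n.+1) (e : 'rV[K]_n) : 'rV[K]_n.+1 :=
  cns (v 0 ord0) e.

Lemma cube_in_cap n (v : 'rV[K]_n.+1) e d d0 : d <= d0 ->
  cube_in e d (tl v) d0 -> cube_in (cap v e) d v d0.
Proof.
move=> dd h; apply/forall_ordS; split; first by rewrite cns0 subrr normr0 add0r.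
by move=> i; have := h i; rewrite cnsS mxE.
Qed.

(** The clause [d <= d0] does not follow from [cube_in] in dimension 0, and the induction step needs
    it for the coordinate which [cap] leaves unchanged. *)
Theorem faced_pieces n (A : set 'rV[K]_n) e0 d0 : definable M A -> bounded A ->
  stdpos d0 ->
  piecewise M (fun B => ~ fat B \/ exists e d,
    [/\ stdpos d, d <= d0, cube_in e d e0 d0 & faced B e d]) A.
Proof.
elim: n A e0 d0 => [|n IH] A e0 d0 dA bA sd0.
  apply: piecewise_leaf => //; right; exists e0, d0; split=> //;
    first exact: cube_in_refl.
  have E (x y : 'rV[K]_0) : x = y by apply/rowP; case.
  split=> [x Ax|]; first by exists 1; split=> // y _; rewrite (E y x).
  exists 0%N, (fun=> set0); split=> [j|p np h].
    by split; [exact: definable0|exact: transversal0].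
  by have [y [Ay _]] := h 1 ltr01; case: np; rewrite (E p y).
have := fibre_pieces omin asat dA (fun x => bounded_fibre x bA).
move=> /piecewise_bind; apply=> B dB BA [D dD [[l dl [BE _]]|[l [u [dl du BE
  lu]]]]].
  by apply: piecewise_leaf => //; left; rewrite BE; exact: grph_not_fat.
have bD : bounded D.
  apply: (@bounded_base _ B); first exact: bounded_sub bA.
  move=> x Dx; have [lux _ _] := lu x Dx.
  by exists ((l x + u x) / 2); rewrite BE /band /= cns0 tl_cns; split=> //; lra.
pose Q D' := ~ fat D' \/ exists e d, [/\ stdpos d, d <= d0, cube_in e d e0 d0 &
  [/\ forall x, D' x -> contAt l x, forall x, D' x -> contAt u x,
      one_sided l D' e d, one_sided u D' e d & faced D' (tl e) d]].
have pD : piecewise M Q D.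
  apply: piecewise_bind (contAt_pieces dl dD) _ => D1 dD1 s1 [n1|c1].
    by apply: piecewise_leaf => //; left.
  apply: piecewise_bind (contAt_pieces du dD1) _ => D2 dD2 s2 [n2|c2].
    by apply: piecewise_leaf => //; left.
  apply: piecewise_bind (one_sided_pieces omin asat e0 dl dD2 sd0) _ =>
    D3 dD3 s3 [n3|].
    by apply: piecewise_leaf => //; left.
  move=> [e1 [d1 [sd1 ce1 sg1]]].
  apply: piecewise_bind (one_sided_pieces omin asat e1 du dD3 sd1) _ =>
    D4 dD4 s4 [n4|].
    by apply: piecewise_leaf => //; left.
  move=> [e2 [d2 [sd2 ce2 sg2]]].
  have b4 : bounded D4.
    by apply: bounded_sub bD; apply: subset_trans s4 _;
      apply: subset_trans s3 _;
      exact: subset_trans s2 s1.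
  apply: piecewise_mono (IH D4 (tl e2) d2 dD4 b4 sd2) => D5 dD5 s5 [n5|]; first
    by left.
  move=> [e3 [d3 [sd3 d32 ce3 f5]]]; right.
  have c32 := cube_in_cap d32 ce3; have c31 := cube_in_trans c32 ce2.
  have c30 := cube_in_trans c31 ce1.
  exists (cap e2 e3), d3; split=> //.
    by have := c30 ord0; rewrite -lerBrDl; move/le_trans; apply; rewrite gerBl.
  split.
  - by move=> x /s5/s4/s3/s2; exact: c1.
  - by move=> x /s5/s4/s3; exact: c2.
  - by apply: one_sided_sub sg1 => // x /s5/s4.
  - by apply: one_sided_sub sg2.
  - by rewrite tl_cns.
have BD v : B v -> D (tl v) by rewrite BE => -[].
apply: (piecewise_over dB BD pD) => C dC CD [nC|].
  apply: piecewise_leaf; first exact: definable_over.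
  by left => f; apply: nC; apply: fat_tl f => v [].
move=> [e [d [sd dd ce [cl cu sl su fC]]]].
apply: piecewise_leaf; first exact: definable_over.
right; exists e, d; split=> //.
rewrite (_ : mkset _ = band C l u); first exact: faced_band.
rewrite BE; apply/seteqP; split=> v [] /=; first by move=> [].
by move=> Cv h; split=> //; split=> //; exact: CD.
Qed.

(** These bounds give the linear map which takes the first basis vector to [e], and its inverse,
    standard norms. The index is compared in [nat] so that [n] may be 0. *)
Definition steep n (e : 'rV[K]_n) : Prop :=
  (forall i, `|e 0 i| <= 2) /\ forall i : 'I_n, i = 0%N :> nat -> 2^-1 <= e 0 i.

Lemma steep_cube n (e : 'rV[K]_n.+1) d : 0 < d ->
  cube_in e d (delta_mx 0 ord0) 2^-1 -> steep e.
Proof.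
move=> d0 ce; split=> [i|i i0].
  have := ce i; rewrite !mxE; set b := (_ && _)%:R.
  have : `|b| <= 1 :> K by rewrite /b normr_nat; case: (_ && _).
  have := ler_normD (e 0 i - b) b; rewrite subrK; lra.
have := ce i; rewrite !mxE (_ : i = ord0) ?eqxx /=; last exact: val_inj.
by have := ler_norm (- (e 0 ord0 - 1)); rewrite normrN; lra.
Qed.

Lemma stdpos_half : stdpos (2^-1 : K).
Proof. by rewrite -[2^-1]mul1r; apply: (stdpos_div 1); exact: stdpos1. Qed.

(** Piecewise, a small set lies over a small base, where the dimension drops, or on a graph, where
    [one_sided_pieces] applies off a small part of the base. *)
Theorem transversal_pieces n (A : set 'rV[K]_n) : definable M A -> ~ fat A ->
  piecewise M (fun B => (forall x, ~ B x) \/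
    exists e d, [/\ stdpos d, steep e & transversal B e d]) A.
Proof.
elim: n A => [|n IH] A dA nA.
  apply: piecewise_leaf => //; left=> x Ax; apply: nA; exists x, 1;
    split=> // y _.
  by rewrite (_ : y = x)//; apply/rowP; case.
have cyl (B : set 'rV[K]_n.+1) E : definable M B -> definable M E -> ~ fat E ->
    (forall v, B v -> E (tl v)) -> piecewise M (fun B => (forall x, ~ B x) \/
    exists e d, [/\ stdpos d, steep e & transversal B e d]) B.
  move=> dB dE nE BE; apply: (piecewise_over dB BE (IH _ dE nE)) =>
    C dC CE [nC|].
    by apply: piecewise_leaf; [exact: definable_over|left=> x [_ /nC]].
  move=> [e [d [sd [se1 se2] TC]]].
  apply: piecewise_leaf; first exact: definable_over.
  (* A cylinder constrains only the tail of the direction; the first coordinate 1 makes it steep. *)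
  right; exists (cns 1 e), d; split=> //.
    split; first by apply/forall_ordS; split=> [|i];
      rewrite ?cns0 ?cnsS ?normr1//; lra.
    by move=> i i0; rewrite (_ : i = ord0) ?cns0//; [lra|exact: val_inj].
  by apply: (@transversal_sub _ _ [set v | C (tl v)]) => [v []//|];
    apply: transversal_cylinder; rewrite tl_cns.
apply: piecewise_bind (small_pieces omin asat dA nA) _ => B dB _.
move=> [[E [dE nE BE]]|[D [l [dD dl BE]]]]; first exact: cyl BE.
pose e0 : 'rV[K]_n.+1 := delta_mx 0 ord0.
have BD v : B v -> D (tl v) by rewrite BE => -[].
apply: (piecewise_over dB BD (one_sided_pieces omin asat e0 dl dD stdpos_half))
  => C dC CD [nC|].
  by apply: (cyl _ C) => //; [exact: definable_over|move=> v []].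
move=> [e [d [sd' ce sC]]]; apply: piecewise_leaf; first exact: definable_over.
right; exists e, d; split=> //; first exact: steep_cube (stdpos_gt0 sd') ce.
apply: transversal_sub (one_sided_transversal sC) => v; rewrite BE /= =>
  -[[_ vl] Cv].
by split.
Qed.

End Faces.

(** * Lipschitz arcs *)

Section Arcs.
Context {L : language} {K : realFieldType} (M : structure L K).

Definition lipschitz n (g : K -> 'rV[K]_n) (k : K) : Prop :=
  forall s t : K, 0 <= s <= 1 -> 0 <= t <= 1 ->
    forall i, `|g s 0 i - g t 0 i| <= k * `|s - t|.

(* The bound [r] on the coordinates stands for the sup norm of x - y; the
   constant [c] is a natural number, hence finite in K. *)
Definition quasiconvex n (A : set 'rV[K]_n) : Prop :=
  exists c : nat, forall x y, A x -> A y -> forall r : K, 0 <= r ->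
    (forall i, `|x 0 i - y 0 i| <= r) ->
    exists g : K -> 'rV[K]_n, [/\ dV M (fun e => g (e 0%N)),
      forall t, 0 <= t <= 1 -> A (g t), g 0 = x, g 1 = y &
      lipschitz g (c%:R * r)].

Lemma cover_pieces n (C : nat -> set 'rV[K]_n) k D :
  (forall j, definable M (C j)) -> definable M D ->
  (forall x, D x -> exists j, (j < k)%N /\ C j x) ->
  piecewise M (fun D' => exists j, D' `<=` C j) D.
Proof.
move=> dC; elim: k D => [|k IH] D dD DC.
  by apply: piecewise_leaf => //; exists 0%N => x /DC[j []].
apply: (piecewise_split (dC k)).
  by apply: piecewise_leaf; [exact: definableI|exists k => x []].
apply: IH; first exact: definableD.
move=> x [/DC[j [+ Cj]] nC]; rewrite ltnS leq_eqVlt => /predU1P[jk|jk].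
  by rewrite jk in Cj.
by exists j.
Qed.

(** * Lifting Lipschitz arcs to graphs and bands *)

Section OMinimalArcs.
Hypothesis omin : o_minimal M.
Hypothesis asat : aleph1_saturated M.

(** Compactness of the interval is replaced by definability: the [t] such that the estimate holds
    from [a] up to [t] have a supremum, past which the local estimate continues. *)
Lemma lipschitz_of_local (h : K -> K) k : dK M (fun e => h (e 0%N)) ->
  (forall t, 0 <= t <= 1 -> exists r : K, 0 < r /\
    forall s s', 0 <= s <= 1 -> 0 <= s' <= 1 -> `|s - t| < r -> `|s' - t| < r ->
      `|h s - h s'| <= k * `|s - s'|) ->
  forall s t, 0 <= s <= 1 -> 0 <= t <= 1 -> `|h s - h t| <= k * `|s - t|.
Proof.
move=> dh loc.
have dhc t : dK M t -> dK M (fun e => h (t e)).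
  by move=> dt; apply: (dK_comp (s := fun=> t) dh).
suff H a b : 0 <= a <= 1 -> 0 <= b <= 1 -> a <= b ->
  `|h b - h a| <= k * (b - a).
  move=> s t s01 t01; have [st|/ltW ts] := leP s t.
    by rewrite distrC [X in _ * X]distrC [X in _ * X]ger0_norm ?subr_ge0//;
      exact: H.
  by rewrite [X in _ * X]ger0_norm ?subr_ge0//; exact: H.
move=> a01 b01 ab.
pose T t := a <= t <= 1 /\ forall v, a <= v <= t -> `|h v - h a| <= k * (v - a).
have dT : D1 M T by rewrite /D1 /T; ddef; apply: dhc; ddef.
have Ta : T a.
  split=> [|v]; first by move: a01 => /andP[_ ->]; rewrite lexx.
  by rewrite -eq_le => /eqP <-; rewrite !subrr normr0 mulr0.
have [c hc] := @D1_sup _ _ M omin T a 1 dT Ta (fun u hu =>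
  proj2 (andP (proj1 hu))).
have ac : a <= c by case: hc => + _; apply.
have c1 : c <= 1 by case: hc => _; apply => u [/andP[]].
have c01 : 0 <= c <= 1 by lra.
have [r [r0 hr]] := loc c c01.
have cr : c - r < c by lra.
have [u [/andP[au u1] Tu] ur] := isup_lt hc cr.
have uc : u <= c by case: hc => + _; apply; split=> //; rewrite au.
pose w := Num.min (c + r / 2) 1.
have w1 : w <= 1 by rewrite /w ge_min lexx orbT.
have wc : w <= c + r / 2 by rewrite /w ge_min lexx.
have Tw v : a <= v <= w -> `|h v - h a| <= k * (v - a).
  move=> /andP[av vw]; have [vu|uv] := leP v u; first by apply: Tu; rewrite av.
  have h1 : `|h v - h u| <= k * `|v - u|.
    by apply: hr; rewrite ?ltr_norml; lra.
  have h2 : `|h u - h a| <= k * (u - a) by apply: Tu; rewrite au lexx.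
  rewrite [X in _ <= _ * X]gtr0_norm ?subr_gt0// in h1.
  have := ler_distD (h u) (h v) (h a); lra.
have aw : a <= w by rewrite /w le_min; lra.
have : w <= c by case: hc => + _; apply; split=> //; rewrite aw.
rewrite /w ge_min => /orP[|c1']; first lra.
by apply: Tw; rewrite ab /w le_min; lra.
Qed.

Notation e0 := (delta_mx (0 : 'I_1) ord0).

(** Transversality to the first basis vector says that a small increment of [f] is at most [d^-1]
    times the increment of some base coordinate; along [g] this is a local Lipschitz estimate.
    Continuity of [f] brings the secants into the box where transversality applies. *)
Lemma comp_lipschitz n (f : 'rV[K]_n -> K) D (N : set 'rV[K]_n.+1) d
    (g : K -> 'rV[K]_n) k :
  dF M f -> contOn f D -> transversal N e0 d -> 0 < d ->
  (forall x, D x -> N (cns (f x) x)) -> dV M (fun e => g (e 0%N)) -> 0 <= k ->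
  (forall t, 0 <= t <= 1 -> D (g t)) -> lipschitz g k ->
  forall s t, 0 <= s <= 1 -> 0 <= t <= 1 ->
    `|f (g s) - f (g t)| <= d^-1 * k * `|s - t|.
Proof.
move=> df cf TN d0 fN dg k0 Dg lg.
apply: (lipschitz_of_local (h := fun t => f (g t))); first by ddef.
move=> t t01; have Dt := Dg t t01.
have [r [r0 hr]] := TN _ (fN _ Dt).
have [|s1 [s10 hs1]] := cf _ Dt (r / 2); first lra.
have m0 : 0 < Num.min s1 r by rewrite lt_min s10.
have k1 : 0 < k + 1 by rewrite ltr_wpDl.
(* The divisor is [k + 1] because [k] may be 0. *)
exists (Num.min s1 r / (k + 1)); split; first by rewrite divr_gt0.
have near s : 0 <= s <= 1 -> `|s - t| < Num.min s1 r / (k + 1) ->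
    box (g t) (Num.min s1 r) (g s).
  move=> s01 st i; apply: le_lt_trans (lg _ _ s01 t01 i) _.
  rewrite ltr_pdivlMr// in st; apply: le_lt_trans st.
  by rewrite mulrC; apply: ler_wpM2l => //; rewrite lerDl.
have half s : 0 <= s <= 1 -> `|s - t| < Num.min s1 r / (k + 1) ->
    `|f (g s) - f (g t)| < r / 2.
  move=> s01 st; apply: hs1; first exact: Dg.
  by apply: box_le (near s s01 st); rewrite ge_min lexx.
suff H s s' : 0 <= s <= 1 -> 0 <= s' <= 1 ->
  `|s - t| < Num.min s1 r / (k + 1) ->
    `|s' - t| < Num.min s1 r / (k + 1) -> 0 < f (g s) - f (g s') ->
    f (g s) - f (g s') <= d^-1 * k * `|s - s'|.
  move=> s s' s01 s'01 st s't; have [h|h|h] := ltgtP (f (g s) - f (g s')) 0.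
  - by rewrite ltr0_norm// opprB distrC; apply: H => //;
      rewrite subr_gt0 -subr_lt0.
  - by rewrite gtr0_norm//; exact: H.
  - by rewrite h normr0 !mulr_ge0 ?invr_ge0// ltW.
move=> s01 s'01 st s't sg0.
have sgr : f (g s) - f (g s') < r.
  have := half s s01 st; have := half s' s'01 s't; rewrite !ltr_norml; lra.
have inb q : 0 <= q <= 1 -> `|q - t| < Num.min s1 r / (k + 1) ->
    box (cns (f (g t)) (g t)) r (cns (f (g q)) (g q)).
  move=> q01 qt; apply/box_cns; split; first by have := half q q01 qt; lra.
  by apply: box_le (near q q01 qt); rewrite ge_min lexx orbT.
have sgb : 0 < f (g s) - f (g s') < r by rewrite sg0.
(* With [t] the increment of [f], the first coordinate of the secant agrees exactly with that of
   [t *: e0], so the violated inequality concerns a base coordinate. *)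
have /existsNP[i /negP] := hr _ _ (fN _ (Dg _ s01)) (fN _ (Dg _ s'01))
  (inb _ s01 st) (inb _ s'01 s't) _ sgb.
case: (unliftP ord0 i) => [j ->|->]; rewrite -leNgt.
  rewrite !cnsS !mxE /= mulr0 subr0 => h.
  rewrite -mulrA mulrC ler_pdivlMr// mulrC; apply: le_trans h _; exact: lg.
by rewrite !cns0 !mxE !eqxx mulr1 subrr normr0 leNgt mulr_gt0.
Qed.

Lemma quasiconvex_grph n (f : 'rV[K]_n -> K) D (N : set 'rV[K]_n.+1) d :
  dF M f -> contOn f D -> transversal N e0 d -> stdpos d ->
  (forall x, D x -> N (cns (f x) x)) -> quasiconvex D -> quasiconvex (grph D f).
Proof.
move=> df cf TN sd fN [c hc]; have d0 := stdpos_gt0 sd.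
(* [m] bounds [d^-1]: the base coordinates move with constant [c], the value of [f] with [m * c]. *)
have [m md] := sd; exists (c + m * c)%N => x y [Dx xf] [Dy yf] r r0 xyr.
have [|g [dg Dg g0 g1 lg]] := hc _ _ Dx Dy r r0.
  by move=> i; have := xyr (lift ord0 i); rewrite !mxE.
have cr0 : 0 <= c%:R * r by rewrite mulr_ge0.
have lf := comp_lipschitz df cf TN d0 fN dg cr0 Dg lg.
have dm : d^-1 <= m%:R by rewrite -[d^-1]mul1r ler_pdivrMr.
exists (fun t => cns (f (g t)) (g t)); split.
- by ddef.
- by move=> t /Dg Dt; rewrite /grph /= cns0 tl_cns.
- by rewrite g0 -xf cns_tl.
- by rewrite g1 -yf cns_tl.
move=> s t s01 t01; apply/forall_ordS; rewrite !cns0; split=> [|i].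
  apply: le_trans (lf s t s01 t01) _; apply: ler_wpM2r => //.
  rewrite natrD natrM mulrDl; apply: ler_wpDl => //.
  by rewrite -mulrA; apply: ler_wpM2r.
rewrite !cnsS; apply: le_trans (lg s t s01 t01 i) _; apply: ler_wpM2r => //.
by apply: ler_wpM2r => //; rewrite ler_nat leq_addr.
Qed.

(* Over an arc of the base, the arc joining x and y divides the segment from [l]
   to [u] in a ratio which varies linearly with the parameter. *)
Lemma quasiconvex_band n (l u : 'rV[K]_n -> K) D (N N' : set 'rV[K]_n.+1) d :
  dF M l -> dF M u -> contOn l D -> contOn u D ->
  transversal N e0 d -> transversal N' e0 d -> stdpos d -> (forall x, D x ->
    l x < u x) ->
  (forall x, D x -> N (cns (l x) x)) -> (forall x, D x -> N' (cns (u x) x)) ->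
  quasiconvex D -> quasiconvex (band D l u).
Proof.
move=> dl du cl cu TN TN' sd luD lN uN [c hc]; have d0 := stdpos_gt0 sd.
have [m md] := sd.
(* The base contributes [c]. With [k = m * c * r], the first coordinate contributes [k] from [l],
   [r + 5 * k] from the change of the ratio and [2 * k] from the change of the width. *)
exists (c + (1 + 8 * (m * c)))%N =>
  x y [Dx /andP[lx ux]] [Dy /andP[ly uy]] r r0 xyr.
have [|g [dg Dg g0 g1 lg]] := hc _ _ Dx Dy r r0.
  by move=> i; have := xyr (lift ord0 i); rewrite !mxE.
have cr0 : 0 <= c%:R * r by rewrite mulr_ge0.
have dm : d^-1 <= m%:R by rewrite -[d^-1]mul1r ler_pdivrMr.
pose k := (m * c)%:R * r.
have k0 : 0 <= k by rewrite mulr_ge0.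
have dk : d^-1 * (c%:R * r) <= k.
  by rewrite /k natrM -mulrA; apply: ler_wpM2r.
have ll s t (s01 : 0 <= s <= 1) (t01 : 0 <= t <= 1) :
    `|l (g s) - l (g t)| <= k * `|s - t|.
  apply: le_trans (comp_lipschitz dl cl TN d0 lN dg cr0 Dg lg s01 t01) _.
  exact: ler_wpM2r.
have lu s t (s01 : 0 <= s <= 1) (t01 : 0 <= t <= 1) :
    `|u (g s) - u (g t)| <= k * `|s - t|.
  apply: le_trans (comp_lipschitz du cu TN' d0 uN dg cr0 Dg lg s01 t01) _.
  exact: ler_wpM2r.
pose W t := u (g t) - l (g t).
have wl s t : 0 <= s <= 1 -> 0 <= t <= 1 -> `|W s - W t| <= 2 * k * `|s - t|.
  move=> s01 t01; have h1 := ll s t s01 t01; have h2 := lu s t s01 t01.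
  have -> : W s - W t = (u (g s) - u (g t)) - (l (g s) - l (g t))
    by rewrite /W; ring.
  by rewrite (le_trans (ler_normB _ _))//; lra.
have i0 : 0 <= (0 : K) <= 1 by rewrite lexx ler01.
have i1 : 0 <= (1 : K) <= 1 by rewrite lexx ler01.
have W0 : 0 < W 0 by rewrite /W g0; lra.
have W1 : 0 < W 1 by rewrite /W g1; lra.
have [a [a0 a1 aE]] : exists a : K, [/\ 0 < a,
  a < 1 & l (g 0) + a * W 0 = x 0 ord0].
  exists ((x 0 ord0 - l (g 0)) / W 0); split.
  - by rewrite divr_gt0// g0 subr_gt0.
  - by rewrite ltr_pdivrMr// mul1r /W g0 ltrD2r.
  - by rewrite divfK ?gt_eqF// addrC subrK.
have [b [b0 b1 bE]] : exists b : K, [/\ 0 < b,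
  b < 1 & l (g 1) + b * W 1 = y 0 ord0].
  exists ((y 0 ord0 - l (g 1)) / W 1); split.
  - by rewrite divr_gt0// g1 subr_gt0.
  - by rewrite ltr_pdivrMr// mul1r /W g1 ltrD2r.
  - by rewrite divfK ?gt_eqF// addrC subrK.
pose lam t := a + (b - a) * t.
have lam01 t : 0 <= t <= 1 -> 0 < lam t < 1.
  move=> /andP[t0 t1].
  have -> : lam t = a * (1 - t) + b * t by rewrite /lam; ring.
  have [->|tn] := eqVneq t 0; first by rewrite subr0 mulr1 mulr0 addr0 a0.
  have tp : 0 < t by rewrite lt_neqAle eq_sym tn.
  have u1 : 0 <= a * (1 - t) by apply: mulr_ge0; rewrite ?subr_ge0// ltW.
  have u2 : 0 <= (1 - a) * (1 - t) by apply: mulr_ge0; rewrite ?subr_ge0// ltW.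
  have u3 : 0 < b * t by rewrite mulr_gt0.
  have u4 : 0 < (1 - b) * t by rewrite mulr_gt0// subr_gt0.
  lra.
have Wpos t : 0 <= t <= 1 -> 0 < W t by move=> /Dg/luD; rewrite /W subr_gt0.
pose tau t := l (g t) + lam t * W t.
have ba1 : `|b - a| <= 1 by rewrite ler_norml; lra.
(* In a narrow band [b - a] need not be of the order of [r], but its product with the width is
   controlled, and only this product enters the speed. *)
have baW0 : `|b - a| * W 0 <= r + 3 * k.
  rewrite -{1}(gtr0_norm W0) -normrM.
  have -> : (b - a) * W 0 = (y 0 ord0 - x 0 ord0) + (l (g 0) - l (g 1)) + b *
    (W 0 - W 1).
    by rewrite -aE -bE; ring.
  have h1 : `|y 0 ord0 - x 0 ord0| <= r by rewrite distrC.
  have h2 := ll _ _ i0 i1; have h3 := wl _ _ i0 i1.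
  rewrite sub0r normrN normr1 !mulr1 in h2 h3.
  have h4 : `|b * (W 0 - W 1)| <= 2 * k.
    rewrite normrM gtr0_norm// (le_trans _ h3)// ler_piMl//; exact: ltW.
  have := ler_normD (y 0 ord0 - x 0 ord0 + (l (g 0) - l (g 1)))
    (b * (W 0 - W 1)).
  have := ler_normD (y 0 ord0 - x 0 ord0) (l (g 0) - l (g 1)).
  lra.
have baW t : 0 <= t <= 1 -> `|b - a| * W t <= r + 5 * k.
  move=> t01; have h1 : W t <= W 0 + 2 * k.
    have := wl _ _ t01 i0; rewrite subr0 [`|t|]ger0_norm; last
      by case/andP: t01.
    move=> h2; have h3 : 2 * k * t <= 2 * k.
      by rewrite ler_piMr ?mulr_ge0//; case/andP: t01.
    by have := ler_norm (W t - W 0); lra.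
  have h4 : `|b - a| * W t <= `|b - a| * (W 0 + 2 * k) by apply: ler_wpM2l.
  have h5 : `|b - a| * k <= k by rewrite ler_piMl.
  lra.
exists (fun t => cns (tau t) (g t)); split.
- by rewrite /tau /lam /W; ddef.
- move=> t t01; rewrite /band /= cns0 tl_cns; split; first exact: Dg.
  have /andP[q1 q2] := lam01 t t01; have Wt := Wpos t t01.
  have p1 : 0 < lam t * W t by rewrite mulr_gt0.
  have p2 : 0 < (1 - lam t) * W t by rewrite mulr_gt0// subr_gt0.
  have -> : u (g t) = l (g t) + W t by rewrite /W addrC subrK.
  by rewrite /tau; lra.
- by rewrite g0 /tau /lam mulr0 addr0 aE cns_tl.
- by rewrite g1 /tau /lam mulr1 addrC [a + _]addrC subrK addrC bE cns_tl.
move=> s t s01 t01; apply/forall_ordS; rewrite !cns0; split=> [|i]; last first.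
  rewrite !cnsS; apply: le_trans (lg s t s01 t01 i) _; apply: ler_wpM2r => //.
  by apply: ler_wpM2r => //; rewrite ler_nat leq_addr.
have -> : tau s - tau t = (l (g s) - l (g t)) + (b - a) * (s - t) * W s +
    lam t * (W s - W t) by rewrite /tau /lam; ring.
have h1 := ll s t s01 t01; have h2 := wl s t s01 t01.
have h3 : `|(b - a) * (s - t) * W s| <= (r + 5 * k) * `|s - t|.
  rewrite !normrM (gtr0_norm (Wpos s s01)) mulrAC.
  by apply: ler_wpM2r => //; exact: baW.
have h4 : `|lam t * (W s - W t)| <= 2 * k * `|s - t|.
  have /andP[q1 q2] := lam01 t t01.
  rewrite normrM gtr0_norm// (le_trans _ h2)// ler_piMl//; exact: ltW.
have h5 : (c + (1 + 8 * (m * c)))%:R * r = c%:R * r + (r + 8 * k).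
  by rewrite /k !natrD !natrM; ring.
have h6 : 0 <= c%:R * r * `|s - t| by rewrite mulr_ge0.
rewrite h5; have := ler_normD (l (g s) - l (g t) + (b - a) * (s - t) * W s)
  (lam t * (W s - W t)).
have := ler_normD (l (g s) - l (g t)) ((b - a) * (s - t) * W s).
lra.
Qed.

Definition has_arc_pieces n := forall A : set 'rV[K]_n,
  definable M A -> bounded A -> piecewise M (@quasiconvex n) A.

(** The bounding functions of the pieces run in the fibrewise boundary of [A]; the base is split
    until each of them is continuous and stays in a single [N j], which is then used to lift
    arcs. *)
Lemma arc_pieces_of_fibres n (A : set 'rV[K]_n.+1) k (N : nat ->
  set 'rV[K]_n.+1) d :
  has_arc_pieces n -> definable M A -> bounded A -> stdpos d ->
  (forall j, definable M (N j) /\ transversal (N j) e0 d) ->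
  (forall v, bdf A v -> exists j, (j < k)%N /\ N j v) ->
    piecewise M (@quasiconvex n.+1) A.
Proof.
move=> IH dA bA sd hN cov.
have := fibre_pieces omin asat dA (fun x => bounded_fibre x bA).
move=> /piecewise_bind; apply=> B dB BA [D dD leaf].
have bB := bounded_sub BA bA.
have piece l C : dF M l -> definable M C ->
    (forall x, C x -> bdf A (cns (l x) x)) ->
    piecewise M (fun C' => contOn l C' /\ exists j, forall x, C' x ->
      N j (cns (l x) x)) C.
  move=> dl dC lA.
  have dNl j : definable M [set x | N j (cns (l x) x)].
    by have [dNj _] := hN j; apply: definableP; ddef.
  apply: piecewise_bind (cover_pieces dNl dC (fun x Cx => cov _ (lA x Cx))) _.
  move=> E dE EC [j Ej].
  apply: piecewise_mono (contOn_pieces omin asat dl dE) => F dF' FE cF;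
    split=> //.
  by exists j => x /FE/Ej.
case: leaf => [[l dl [BE BN]]|[l [u [dl du BE lu]]]].
  have bD : bounded D.
    by apply: (bounded_base bB) => x Dx; exists (l x);
      rewrite BE /grph /= cns0 tl_cns.
  have pD : piecewise M (fun C => quasiconvex C /\ contOn l C /\ exists j,
    forall x, C x -> N j (cns (l x) x)) D.
    have := piece l D dl dD => /(_ _)/piecewise_bind; apply.
      by move=> x Dx; apply: BN; rewrite BE /grph /= cns0 tl_cns.
    move=> C dC CD [cC [j Cj]].
    (* The arc pieces of the base come last: continuity and the inclusion in [N j] pass to subsets,
       quasiconvexity does not. *)
    apply: piecewise_mono (IH C dC (bounded_sub CD bD)) => E dE EC WE;
      split=> //.
    by split; [exact: contOn_sub cC|exists j => x /EC/Cj].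
  have BD v : B v -> D (tl v) by rewrite BE => -[].
  apply: (piecewise_over dB BD pD) => C dC CD [WC [cC [j Cj]]].
  apply: piecewise_leaf; first exact: definable_over.
  have [dNj TNj] := hN j.
  rewrite (_ : mkset _ = grph C l); first exact: quasiconvex_grph TNj sd Cj WC.
  rewrite BE; apply/seteqP; split=> v [] /=; first by move=> [].
  by move=> Cv h; split=> //; split=> //; exact: CD.
have bD : bounded D.
  apply: (bounded_base bB) => x Dx; have [lux _ _] := lu x Dx.
  by exists ((l x + u x) / 2); rewrite BE /band /= cns0 tl_cns; split=> //; lra.
have pD : piecewise M (fun C => quasiconvex C /\
    (contOn l C /\ exists j, forall x, C x -> N j (cns (l x) x)) /\
    (contOn u C /\ exists j, forall x, C x -> N j (cns (u x) x))) D.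
  have := piece l D dl dD => /(_ _)/piecewise_bind; apply; first
    by move=> x /lu[].
  move=> C dC CD [cC [j Cj]].
  have := piece u C du dC => /(_ _)/piecewise_bind; apply; first
    by move=> x /CD/lu[].
  move=> E dE EC [cE [i Ei]].
  have bE : bounded E by apply: bounded_sub bD; exact: subset_trans CD.
  apply: piecewise_mono (IH E dE bE) => F dF' FE WF; split=> //; split; split.
  - by apply: contOn_sub cC; exact: subset_trans EC.
  - by exists j => x /FE/EC/Cj.
  - exact: contOn_sub cE.
  - by exists i => x /FE/Ei.
have BD v : B v -> D (tl v) by rewrite BE => -[].
apply: (piecewise_over dB BD pD) => C dC CD [WC [[cl [j Cj]] [cu [i Ci]]]].
apply: piecewise_leaf; first exact: definable_over.
have [_ TNj] := hN j; have [_ TNi] := hN i.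
rewrite (_ : mkset _ = band C l u).
  by apply: (quasiconvex_band dl du cl cu TNj TNi sd) => // x /CD/lu[].
rewrite BE; apply/seteqP; split=> v [] /=; first by move=> [].
by move=> Cv h; split=> //; split=> //; exact: CD.
Qed.

(** * The linear change of coordinates which makes the direction vertical *)

Section Shear.
Context n (e : 'rV[K]_n.+1).
Hypothesis se : steep e.

(** The linear map which takes the first basis vector to [e] and fixes the vectors with first
    coordinate 0. *)
Definition shear (y : 'rV[K]_n.+1) : 'rV[K]_n.+1 := y + y 0 ord0 *: (e - e0).
Definition unshear (x : 'rV[K]_n.+1) : 'rV[K]_n.+1 :=
  x + (x 0 ord0 / e 0 ord0) *: (e0 - e).
Local Notation S := shear.
Local Notation T := unshear.

Lemma steep_gt0 : 0 < e 0 ord0.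
Proof. by have [_ /(_ ord0 erefl)] := se; lra. Qed.

Lemma unshearK x : S (T x) = x.
Proof.
have e0n : e 0 ord0 != 0 by rewrite gt_eqF// steep_gt0.
by apply/rowP => i; rewrite !mxE !eqxx /=; field.
Qed.

Lemma shearB y z : S y - S z = S (y - z).
Proof. by rewrite /shear; apply/rowP => i; rewrite !mxE; ring. Qed.

Lemma shearK y : T (S y) = y.
Proof.
have e0n : e 0 ord0 != 0 by rewrite gt_eqF// steep_gt0.
by apply/rowP => i; rewrite !mxE !eqxx /=; field.
Qed.

Lemma unshearB y z : T y - T z = T (y - z).
Proof. by rewrite /unshear; apply/rowP => i; rewrite !mxE; ring. Qed.

Lemma steep_diff i : `|e 0 i - (e0 : 'rV_n.+1) 0 i| <= 3.
Proof.
have [/(_ i) h _] := se; rewrite mxE; set b := (_ && _)%:R.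
have : `|b| <= 1 :> K by rewrite /b normr_nat; case: (_ && _).
have := ler_normB (e 0 i) b; lra.
Qed.

(** Here 4 is 1 + 3, where 3 bounds the coordinates of [e - e0]; for the inverse map, 7 is 1 + 2 *
    3, where 2 bounds the inverse of the first coordinate of [e]. *)
Lemma shear_bound (y : 'rV[K]_n.+1) (r : K) : (forall i, `|y 0 i| <= r) ->
  forall i, `|S y 0 i| <= 4 * r.
Proof.
move=> h i; rewrite /shear mxE mxE mxE [in X in _ + _ * X]mxE.
have := ler_normD (y 0 i) (y 0 ord0 * (e 0 i - (e0 : 'rV_n.+1) 0 i)).
have := h i.
have : `|y 0 ord0 * (e 0 i - (e0 : 'rV_n.+1) 0 i)| <= r * 3 by rewrite normrM;
  apply: ler_pM => //; exact: steep_diff.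
lra.
Qed.

Lemma unshear_bound (x : 'rV[K]_n.+1) (r : K) : (forall i, `|x 0 i| <= r) ->
  forall i, `|T x 0 i| <= 7 * r.
Proof.
move=> h i; have -> : T x 0 i = x 0 i + x 0 ord0 / e 0 ord0 * ((e0 :
  'rV_n.+1) 0 i - e 0 i).
  by rewrite !mxE.
have := ler_normD (x 0 i) (x 0 ord0 / e 0 ord0 * ((e0 : 'rV_n.+1) 0 i - e 0 i)).
have := h i.
have inv2 : (e 0 ord0)^-1 <= 2.
  have [_ /(_ ord0 erefl) h2] := se.
  by rewrite -[leRHS]invrK lef_pV2 ?posrE ?invr_gt0// steep_gt0.
have : `|x 0 ord0 / e 0 ord0 * ((e0 : 'rV_n.+1) 0 i - e 0 i)| <= r * 2 * 3.
  rewrite !normrM distrC; apply: ler_pM => //; last exact: steep_diff.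
  apply: ler_pM => //.
  by rewrite ger0_norm// invr_ge0 ltW// steep_gt0.
lra.
Qed.

Lemma shear_pieces (A : set 'rV[K]_n.+1) : definable M A ->
  piecewise M (@quasiconvex n.+1) [set y | A (S y)] ->
    piecewise M (@quasiconvex n.+1) A.
Proof.
move=> dA pA.
rewrite (_ : A = [set v | A v /\ [set y | A (S y)] (T v)]); last first.
  by apply/seteqP; split=> v /=; rewrite ?unshearK// => -[].
apply: (piecewise_preimage _ pA) => [E dE|B dB BA [c hc]].
  by apply: definableP; rewrite /unshear; ddef.
apply: piecewise_leaf; first by apply: definableP; rewrite /unshear; ddef.
exists (4 * c * 7)%N => x y [Ax Bx] [Ay By] r r0 xyr.
have r70 : 0 <= 7 * r by rewrite mulr_ge0.
have [|g [dg Bg g0 g1 lg]] := hc _ _ Bx By _ r70.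
  move=> i; have := @unshear_bound (x - y) r _ i; rewrite -unshearB !mxE; apply.
  by move=> j; rewrite !mxE.
have BS z : B z -> A (S z) /\ B (T (S z)).
  move=> Bz; split; first exact: BA.
  by rewrite shearK.
exists (fun t => S (g t)); split.
- by rewrite /shear; ddef.
- by move=> t /Bg; exact: BS.
- by rewrite g0 unshearK.
- by rewrite g1 unshearK.
move=> s t s01 t01 i.
have := @shear_bound (g s - g t) (c%:R * (7 * r) * `|s - t|) _ i;
  rewrite -shearB !mxE.
have -> : 4 * (c%:R * (7 * r) * `|s - t|) = (4 * c * 7)%:R * r * `|s - t|.
  by rewrite !natrM; ring.
by apply=> j; rewrite !mxE; exact: lg.
Qed.

Lemma shear_transversal (N : set 'rV[K]_n.+1) d : transversal N e d ->
  transversal [set y | N (S y)] e0 (d / 4).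
Proof.
move=> h p Np; have [r [r0 hr]] := h _ Np.
have near y : box p (r / 5) y -> box (S p) r (S y).
  move=> py i; have := @shear_bound (y - p) (r / 5) _ i;
    rewrite -shearB !mxE => k.
  by apply: le_lt_trans (k _) _; [move=> j; rewrite !mxE; exact: ltW|lra].
exists (r / 5); split=> [|y z Ny Nz py pz t /andP[t0 tr] k]; first
  by rewrite divr_gt0.
apply: (hr _ _ Ny Nz (near _ py) (near _ pz) t); first by rewrite t0/=; lra.
(* [shear_bound] takes a weak inequality; the maximum is attained, so it still satisfies the strict
   one. *)
pose m := \big[Num.max/0]_i `|(y - z - t *: e0) 0 i|.
have mi i : `|(y - z - t *: e0) 0 i| <= m by rewrite /m; apply: le_bigmax.
have md : m < d / 4 * t.
  have [i _ ->] : exists2 i, true & m = `|(y - z - t *: e0) 0 i|.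
    have [i _ E] := @eq_bigmax _ K _ 0 ord0 xpredT (fun i =>
      `|(y - z - t *: e0) 0 i|) isT (fun i _ => normr_ge0 _).
    by exists i.
  by have := k i; rewrite !mxE.
move=> i; have := shear_bound mi i.
have -> : S (y - z - t *: e0) 0 i = S y 0 i - S z 0 i - t * e 0 i.
  by rewrite /shear !mxE !eqxx /=; ring.
lra.
Qed.

Lemma shear_bounded (A : set 'rV[K]_n.+1) : bounded A ->
  bounded [set y | A (S y)].
Proof.
move=> [b hb]; exists (7 * b + 1) => y /hb h i.
have := @unshear_bound (S y) b (fun j => ltW (h j)) i.
rewrite shearK; lra.
Qed.

Lemma shear_definable (A : set 'rV[K]_n.+1) : definable M A ->
  definable M [set y | A (S y)].
Proof. by move=> dA; apply: definableP; rewrite /shear; ddef. Qed.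

End Shear.

Lemma seq_gap (r : seq K) t :
  exists2 d : K, 0 < d & forall s, s \in r -> s != t -> d <= `|s - t|.
Proof.
elim: r => [|a r [d d0 hd]]; first by exists 1.
have [->|at_] := eqVneq a t.
  by exists d => // s; rewrite inE => /predU1P[->|]; [rewrite eqxx|exact: hd].
exists (Num.min d `|a - t|); first by rewrite lt_min d0 normr_gt0 subr_eq0.
move=> s; rewrite inE ge_min => /predU1P[->|sr st]; first by rewrite lexx orbT.
by rewrite hd.
Qed.

(** The fibres are finite, hence closed. *)
Lemma bdf_sub n (A : set 'rV[K]_n.+1) : definable M A ->
  (forall x, ~ open_in (fun t => A (cns t x))) -> bdf A `<=` A.
Proof.
move=> dA nA v bv; apply: contrapT => nv.
have [/nA//|[r hr]] := D1_fin omin (D1_fiber (tl v) dA).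
have [d d0 hd] := seq_gap r (v 0 ord0).
have [[s [sd As]] _] := bv d d0.
have : d <= `|s - v 0 ord0|.
  apply: hd; first exact: hr.
  by apply/eqP => sv; apply: nv; rewrite -(cns_tl v) -sv.
by rewrite leNgt sd.
Qed.

(** Two points of an interval in a fibre span a secant parallel to the forbidden direction. *)
Lemma transversal_fibre n (N : set 'rV[K]_n.+1) d x : 0 < d ->
  transversal N e0 d ->
  ~ open_in (fun t => N (cns t x)).
Proof.
move=> d0 TN [a [b [ab h]]].
have Np : N (cns ((a + b) / 2) x) by apply: h; lra.
have [r [r0 hr]] := TN _ Np.
pose t := Num.min r (b - a) / 4.
have t0 : 0 < t by rewrite divr_gt0// lt_min r0 subr_gt0.
have tr : 4 * t <= r by rewrite mulrC divfK// ge_min lexx.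
have tb : 4 * t <= b - a by rewrite mulrC divfK// ge_min lexx orbT.
have Ny : N (cns ((a + b) / 2 + t) x) by apply: h; lra.
have tt : 0 < t < r by lra.
apply: (hr _ _ Ny Np _ (box_refl _ r0) t tt).
  by apply/box_cns; split; [rewrite addrC addKr gtr0_norm//;
    lra|exact: box_refl].
apply/forall_ordS; rewrite !cns0; split=> [|i].
  rewrite mxE !eqxx mulr1 [_ + t]addrC addrK subrr normr0.
  by rewrite mulr_gt0.
by rewrite !cnsS !mxE /= mulr0 subrr subr0 normr0 mulr_gt0.
Qed.

Theorem arc_pieces n : has_arc_pieces n.
Proof.
elim: n => [|n IH] A dA bA.
  apply: piecewise_leaf => //; exists 0%N => x y Ax Ay r r0 _.
  exists (fun=> x); split=> //; first by ddef.
    by apply/rowP; case.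
  by move=> s t _ _ [].
(* After the shear the fibres of such a piece contain no interval, so its fibrewise boundary lies in
   the piece, which serves as the only [N j]. *)
have direct B e d : definable M B -> bounded B -> stdpos d -> steep e ->
    transversal B e d -> piecewise M (@quasiconvex n.+1) B.
  move=> dB bB sd se TB; apply: (shear_pieces se dB).
  have dB' := shear_definable e dB.
  have TB' := shear_transversal se TB.
  have sd4 := stdpos_div 3 sd.
  apply: (arc_pieces_of_fibres (k := 1) (N :=
    fun=> [set y | B (shear e y)]) IH dB'
    (shear_bounded se bB) sd4) => [//|v bv].
  exists 0%N; split=> //; apply: (bdf_sub dB') bv => x.
  exact: transversal_fibre (stdpos_gt0 sd4) TB'.
apply: piecewise_bind (faced_pieces omin asat e0 dA bA stdpos_half) _ =>
  B dB BA.
have bB := bounded_sub BA bA.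
case=> [nB|[e [d [sd _ ce [oB [k [N [hN cov]]]]]]]].
  apply: piecewise_bind (transversal_pieces omin asat dB nB) _ => C dC CB [nC|].
    by apply: piecewise_leaf => //; exists 0%N => x y /nC.
  by move=> [e [d [sd se TC]]]; apply: direct TC => //; exact: bounded_sub bB.
have se := steep_cube (stdpos_gt0 sd) ce.
apply: (shear_pieces se dB).
have dB' := shear_definable e dB.
have sd4 := stdpos_div 3 sd.
apply: (arc_pieces_of_fibres (k := k) (N := fun j =>
  [set y | N j (shear e y)]) IH dB'
    (shear_bounded se bB) sd4) => [j|v bv].
  have [dN TN] := hN j; split; first exact: shear_definable.
  exact: shear_transversal.
have close (s r : K) : `|s - v 0 ord0| < r / 5 ->
  box (shear e v) r (shear e (cns s (tl v))).
  move=> sv i; have := @shear_bound _ e se (cns s (tl v) - v) (r / 5) _ i.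
  rewrite -shearB !mxE => h; apply: le_lt_trans (h _) _; last first.
    by have := le_lt_trans (normr_ge0 _) sv; lra.
  apply/forall_ordS; split=> [|j]; rewrite !mxE.
    by rewrite unlift_none ltW.
  by rewrite liftK !mxE subrr normr0; have := le_lt_trans (normr_ge0 _) sv; lra.
(* A point of the fibrewise boundary gives a frontier point of [B]: it is a limit of points of [B]
   and, [B] being open, does not belong to it. *)
apply: cov.
  move=> /oB[r [r0 hr]]; have [|_ [s [sv nB]]] := bv (r / 5); first
    by rewrite divr_gt0.
  by apply: nB; apply: hr; exact: close.
move=> r r0; have [|[s [sv Bs]] _] := bv (r / 5); first by rewrite divr_gt0.
by exists (shear e (cns s (tl v))); split=> //; exact: close.
Qed.

End OMinimalArcs.
End Arcs.

(** * Length *)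

Import HBNNSimple.

Section Length.

(* The set D need not be measurable: the integral is a supremum over the simple
   functions below f, and such a function vanishes off a measurable subset. *)
Lemma integral_le_bound d (T : measurableType d) (R : realType)
    (mu : {measure set T -> \bar R}) (D : set T) (f : T -> \bar R) (c :
      \bar R) :
  (0 <= c)%E -> (forall x, D x -> (0 <= f x <= c)%E) ->
  (forall E, measurable E -> E `<=` D -> (mu E <= 1)%E) ->
  (\int[mu]_(x in D) f x <= c)%E.
Proof.
move=> c0 fc muD; case: c c0 fc => [r| |] c0 fc; [|by rewrite leey|by []].
have f0 x : D x -> (0 <= f x)%E by move=> /fc/andP[].
rewrite ge0_integralE//; apply: ge_ereal_sup => _ [h /= hf <-].
pose E := h @^-1` (~` [set 0]).
have mE : measurable E.
  rewrite -[E]setTI; apply: (measurable_funPT h) => //.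
  by apply: measurableC; exact: measurable_set1.
have ED : E `<=` D.
  move=> x /= hx; apply: contrapT => nD; apply: hx.
  have := hf x; rewrite patchE memNset// lee_fin => hx0.
  by apply/eqP; rewrite eq_le hx0 fun_ge0.
have hE : EFin \o h = (EFin \o h) \_ E.
  apply/funext => x; rewrite patchE; case: ifPn => //;
    rewrite notin_setE /E /= => hx.
  by congr EFin; apply: contrapT.
rewrite -integralT_nnsfun (_ : (fun x =>
  (h x)%:E) = EFin \o h)// hE -integral_mkcond.
apply: (@le_trans _ _ (\int[mu]_(x in E) cst r%:E x)%E).
  apply: ge0_le_integral => //.
  - by move=> x _; rewrite lee_fin fun_ge0.
  - by apply/measurable_realfun.measurable_EFinP; exact: measurable_funTS.
  - by move=> x Ex; apply: le_trans (hf x) _; rewrite patchE mem_set;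
      [have /andP[] := fc x (ED x Ex)|exact: ED].
rewrite integral_cst// -[leRHS]mule1; apply: lee_pmul => //; exact: muD.
Qed.

Context (R : realType) {L : language} {K : realFieldType} (M : structure L K).

Lemma le_st (x y : K) : x <= y -> (st R x <= st R y)%E.
Proof.
move=> xy; apply: ereal_sup_le => _ [q /= qx <-]; exists q => //=.
exact: le_trans xy.
Qed.

Lemma st_ge0 (x : K) : 0 <= x -> (0 <= st R x)%E.
Proof.
move=> x0; apply: ereal_sup_ubound; exists 0 => /=; last by rewrite rmorph0.
by rewrite rmorph0.
Qed.

Lemma st_le1 (x : K) : x <= 1 -> (st R x <= 1)%E.
Proof.
move=> x1; apply: ge_ereal_sup => _ [q /= qx <-].
have : ratr q <= ratr 1 :> K by rewrite rmorph1; exact: le_trans x1.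
rewrite ler_rat => q1; rewrite lee_fin.
by have := q1; rewrite -(ler_rat R) rmorph1.
Qed.

Lemma BO_ring_unit : BO_ring (M := M) (`[0%R, 1%R]%classic : set K).
Proof.
split.
  apply: D1_definable1; rewrite /D1.
  apply: (@dP_iff _ _ _ (fun e => 0 <= e 0%N <= 1)); last by ddef.
  by move=> e /=; rewrite in_itv.
exists 1; first by exists 1%N; rewrite normr1.
by move=> x y; rewrite /= !in_itv /= => xb yb; rewrite ler_norml; lra.
Qed.

(** The unit interval covers itself, and its standard part lies in the real unit interval. Only this
    upper bound enters the estimate of lengths. *)
Lemma BO_outer_unit : (BO_outer R (M := M) (`[0%R, 1%R]%classic :
  set K) <= 1)%E.
Proof.
pose A (k : nat) : set (BO_type M) := if k is 0%N then (`[0%R, 1%R]%classic :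
  set K) else set0.
apply: ge_ereal_inf; exists (\sum_(0 <= k <oo) BO_premeasure R (A k))%E.
  exists A => //; split; last by move=> x x01; exists 0%N.
  by case=> [|k]; [exact: BO_ring_unit|exact: BO_ring0].
rewrite nneseries_recl//.
rewrite eseries0 ?adde0; last by case=> // k _ _; rewrite /= BO_premeasure0.
rewrite /= /BO_premeasure asboolT; last first.
  by move=> x /=; rewrite in_itv /= => x01; exists 1%N; rewrite ler_norml; lra.
have -> : (1 = lebesgue_measure (`[0%R, 1%R]%classic : set R))%E.
  by rewrite lebesgue_measure_itv /= lte_fin ltr01 oppr0 adde0.
apply: le_mu_ext => r [_ [x /= + <-]]; rewrite subr0 in_itv /= =>
  /andP[x0 x1] xr.
rewrite in_itv /= -!lee_fin -xr st_ge0// st_le1//.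
Qed.

Lemma curve_length_le n (g : K -> 'rV[K]_n) (c : K) : 0 <= c ->
  (forall t, 0 <= t <= 1 -> 0 <= enorm (derive1 g t) <= c) ->
  (curve_length R M g <= st R c)%E.
Proof.
move=> c0 hg; rewrite /curve_length; apply: integral_le_bound;
  first exact: st_ge0.
  move=> t; rewrite /= in_itv /= => /hg /andP[h1 h2].
  by rewrite st_ge0//= le_st.
move=> E _ ED; apply: le_trans BO_outer_unit; exact: le_outer_measure.
Qed.

End Length.

(** * Square roots and comparison with the sup norm *)

Section EuclideanNorm.
Context {L : language} {K : realFieldType} (M : structure L K).
Hypothesis omin : o_minimal M.

Lemma ksqrtP (x : K) : 0 <= x -> 0 <= ksqrt x /\ ksqrt x ^+ 2 = x.
Proof.
move=> x0; suff ex : exists s : K, 0 <= s /\ s ^+ 2 = x.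
  exact: (@xgetPex _ 0 [set s | 0 <= s /\ s ^+ 2 = x] ex).
pose S s := 0 <= s /\ s * s <= x.
have dS : D1 M S by rewrite /D1 /S; ddef.
have S0 : S 0 by split=> //; rewrite mul0r.
have Sb s : S s -> s <= x + 1.
  move=> [s0 sx]; rewrite leNgt; apply/negP => h.
  have : s * 1 < s * s by rewrite ltr_pM2l; lra.
  lra.
have [c hc] := D1_sup omin dS S0 Sb.
have c0 : 0 <= c by case: hc => + _; apply.
have cc0 : 0 <= c * c by rewrite mulr_ge0.
exists c; split=> //; rewrite expr2; apply/eqP; rewrite eq_le; apply/andP;
  split.
  rewrite leNgt; apply/negP => h.
  have cp : 0 < c by rewrite lt_neqAle c0 andbT; apply/eqP => E;
    rewrite -E mulr0 in h; lra.
  (* The Newton step from [c]: the square of [c - d] is [x + d * d], so [c - d] would be a smaller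
     upper bound. *)
  pose d := (c * c - x) / (2 * c).
  have dd : 2 * c * d = c * c - x by rewrite /d mulrC divfK// gt_eqF// mulr_gt0.
  have d0 : 0 < d by rewrite divr_gt0 ?mulr_gt0// subr_gt0.
  have cd : c - d < c by lra.
  have [s [s0 sx] ds] := isup_lt hc cd.
  have [cd0|cd0] := leP 0 (c - d); last first.
    have : c * c <= c * d by rewrite ler_pM2l//; lra.
    nra.
  have : (c - d) * (c - d) <= s * s by apply: ler_pM => //; exact: ltW.
  have : 0 < d * d by rewrite mulr_gt0.
  have -> : (c - d) * (c - d) = c * c - 2 * c * d + d * d by ring.
  lra.
rewrite leNgt; apply/negP => h.
(* As [d <= 1], the square of [c + d] is at most [c * c + (2 * c + 1) * d], hence at most [x]. *)
pose d := Num.min 1 ((x - c * c) / (2 * c + 1)).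
have c1 : 0 < 2 * c + 1 by lra.
have d0 : 0 < d by rewrite lt_min ltr01 divr_gt0// subr_gt0.
have d1 : d <= 1 by rewrite ge_min lexx.
have dd : (2 * c + 1) * d <= x - c * c.
  by rewrite mulrC -ler_pdivlMr// ge_min lexx orbT.
have : c + d <= c.
  case: hc => + _; apply; split; first lra.
  have : d * d <= 1 * d by rewrite ler_pM2r.
  have -> : (c + d) * (c + d) = c * c + (2 * c + 1) * d - d + d * d by ring.
  lra.
lra.
Qed.

Lemma enorm_ge0 n (v : 'rV[K]_n) : 0 <= enorm v.
Proof. by apply: (proj1 (ksqrtP _)); apply: sumr_ge0 => i _;
  exact: sqr_ge0. Qed.

Lemma enorm_sqr n (v : 'rV[K]_n) : enorm v ^+ 2 = \sum_i v 0 i ^+ 2.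
Proof. by apply: (proj2 (ksqrtP _)); apply: sumr_ge0 => i _;
  exact: sqr_ge0. Qed.

Lemma coord_le_enorm n (v : 'rV[K]_n) i : `|v 0 i| <= enorm v.
Proof.
rewrite -(@ler_pXn2r _ 2) ?nnegrE ?enorm_ge0// enorm_sqr real_normK ?num_real//.
by rewrite (bigD1 i)//= lerDl sumr_ge0// => j _; exact: sqr_ge0.
Qed.

(** The crude factor [n] in place of its square root keeps the final constant a natural number. *)
Lemma enorm_le n (v : 'rV[K]_n) c : 0 <= c -> (forall i, `|v 0 i| <= c) ->
  enorm v <= n%:R * c.
Proof.
move=> c0 h; rewrite -(@ler_pXn2r _ 2) ?nnegrE ?enorm_ge0 ?mulr_ge0// enorm_sqr.
apply: (@le_trans _ _ (\sum_(i < n) c ^+ 2)).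
  apply: ler_sum => i _; rewrite -real_normK ?num_real//.
  by rewrite ler_pXn2r ?nnegrE.
rewrite sumr_const card_ord exprMn -(mulr_natl (c ^+ 2)); apply: ler_wpM2r;
  first exact: sqr_ge0.
by rewrite -natrX ler_nat; case: (n) => // m;
  rewrite expnS leq_pmulr// expn_gt0.
Qed.

End EuclideanNorm.

(** * Speed and continuity of Lipschitz curves *)

Section Smoothness.
Context {K : realFieldType}.

(* Where the difference quotient has no limit, [derive1] takes the junk value 0;
   hence differentiability of definable curves is not needed. *)
Lemma derive1_le n (g : K -> 'rV[K]_n) k t i : 0 <= k -> lipschitz g k ->
  0 <= t <= 1 -> `|derive1 g t 0 i| <= k.
Proof.
move=> k0 lg t01; rewrite /derive1.
have [cv|ncv] := pselect (cvg (h^-1 *: (g (h + t) - g t) @[h --> 0^']));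
  last first.
  by rewrite dvgP// mxE normr0.
set l := lim _; have cl : h^-1 *: (g (h + t) - g t) @[h --> 0^'] --> l
  by exact: cv.
rewrite leNgt; apply/negP => kl.
have lk0 : 0 < `|l 0 i| - k by rewrite subr_gt0.
move/cvg_ballP : cl => /(_ _ lk0) /nbhs_ballP[d /= d0 hd].
pose m := Num.min (d / 2) (1 / 2).
have m0 : 0 < m by rewrite lt_min; lra.
have md : m <= d / 2 by rewrite ge_min lexx.
have m1 : m <= 1 / 2 by rewrite ge_min lexx orbT.
(* The increment points to the farther end of the unit interval, outside of which nothing is known
   about [g]. *)
have [h [hn0 hm h01]] : exists h : K, [/\ h != 0, `|h| = m & 0 <= h + t <= 1].
  have [t2|t2] := leP t (1 / 2).
    by exists m; split; [rewrite gt_eqF|rewrite gtr0_norm|lra].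
  by exists (- m); split; [rewrite oppr_eq0 gt_eqF|rewrite normrN
    gtr0_norm|lra].
have bh : ball (0 : K) d h by rewrite /ball /= sub0r normrN hm; lra.
have [_ /(_ 0 i)] := hd h bh hn0; rewrite /ball /= !mxE.
have := lg _ _ h01 t01 i; rewrite addrK hm => gk.
have : `|h^-1 * (g (h + t) 0 i - g t 0 i)| <= k.
  by rewrite normrM normfV hm mulrC ler_pdivrMr.
set q := h^-1 * _; move=> qk; have := ler_normD (l 0 i - q) q; rewrite subrK;
  lra.
Qed.

Lemma lipschitz_continuous n (g : K -> 'rV[K]_n) k : 0 <= k -> lipschitz g k ->
  {within `[0, 1], continuous g}.
Proof.
move=> k0 lg; apply/subspace_continuousP => t /=; rewrite in_itv /= => t01.
apply/cvg_ballP => r r0; apply/nbhs_ballP.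
have k1 : 0 < k + 1 by rewrite ltr_wpDl.
exists (r / (k + 1)); first by rewrite /= divr_gt0.
move=> s /=; rewrite /ball /= => ts; rewrite in_itv /= => s01.
split=> // i j; rewrite (ord1 i) /ball /=.
apply: le_lt_trans (lg _ _ t01 s01 j) _.
rewrite ltr_pdivlMr// in ts; apply: le_lt_trans ts.
by rewrite mulrC; apply: ler_wpM2l => //; rewrite lerDl.
Qed.

End Smoothness.

(** * From quasiconvex pieces to the partition *)

Section Conclusion.
Context (R : realType) {L : language} {K : realFieldType} (M : structure L K).
Hypothesis omin : o_minimal M.

Lemma quasiconvex_whitney_arc n (A : set 'rV[K]_n) : quasiconvex M A ->
  whitney_arc R M A.
Proof.
(* The factor [n] comes from [enorm_le]; the summand 1 makes the constant positive. *)
move=> [c hc]; exists (n%:R * c%:R + 1); split.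
- by exists (n * c + 1)%N; rewrite natrD natrM ger0_norm.
- by rewrite ltr_wpDl// mulr_ge0.
move=> x y Ax Ay; have r0 := enorm_ge0 omin (x - y).
have [|g [dg Ag g0 g1 lg]] := hc x y Ax Ay _ r0.
  by move=> i; have := coord_le_enorm omin (x - y) i; rewrite !mxE.
have cr0 : 0 <= c%:R * enorm (x - y) by rewrite mulr_ge0.
exists g; split=> //.
- rewrite /definable_map_on.
  rewrite (_ : (image _ _) = [set v : 'rV[K]_n.+1 | 0 <= v 0 ord0 <= 1 /\
    tl v = g (v 0 ord0)]).
    apply: definableP; rewrite /=.
    have dg' t : dK M t -> dV M (fun e => g (t e)).
      by move=> dt i; apply: (dK_comp (s := fun=> t) (dg i)).
    by apply: dP_and; [ddef|apply: dP_eqv; [ddef|apply: dg'; ddef]].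
  have E t : row_mx (const_mx t : 'rV[K]_1) (g t) = cns t (g t) :> 'rV[K]_n.+1.
    apply/rowP => i; rewrite !mxE; case: splitP => j ij.
      by rewrite (_ : i = ord0) ?unlift_none ?mxE//; apply: val_inj;
        rewrite /= ij (ord1 j).
    by rewrite (_ : i = lift ord0 j) ?liftK//; exact: val_inj.
  apply/seteqP; split=> v /=.
    by move=> [t t01 <-]; rewrite E cns0 tl_cns; rewrite in_itv /= in t01.
  move=> [v01 vg]; exists (v 0 ord0); first by rewrite in_itv.
  by rewrite E -vg cns_tl.
- exact: lipschitz_continuous lg.
apply: curve_length_le.
  by rewrite mulr_ge0// addr_ge0// mulr_ge0.
move=> t t01; rewrite (enorm_ge0 omin)/=.
apply: le_trans (enorm_le omin cr0 (fun i => derive1_le i cr0 lg t01)) _.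
by rewrite mulrA; apply: ler_wpM2r => //; rewrite lerDl.
Qed.

Lemma piecewise_partition n (Q : set 'rV[K]_n -> Prop) A : piecewise M Q A ->
  exists (k : nat) (B : 'I_k -> set 'rV[K]_n),
    partition [set: 'I_k] B A /\ forall i, definable M (B i) /\ Q (B i).
Proof.
elim=> {A} [A dA QA|A B dB _ [k1 [B1 [[U1 T1 N1] h1]]] _ [k2 [B2 [[U2 T2 N2]
  h2]]]].
  (* A partition has nonempty blocks, so an empty leaf contributes no block. *)
  have [A0|/set0P nA] := eqVneq A set0.
    exists 0%N, (fun=> set0); split; last by case.
    split; [|by case|by case].
    by rewrite A0; apply/seteqP; split=> x // [[]].
  exists 1%N, (fun=> A); split=> //; split=> //.
    by apply/seteqP; split=> [x [_ _]//|x Ax]; exists ord0.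
  by move=> i j _ _ _; rewrite (ord1 i) (ord1 j).
pose F (i : 'I_(k1 + k2)) := match fintype.split i with inl j =>
  B1 j | inr j => B2 j end.
have FE1 j : F (lshift k2 j) = B1 j by rewrite /F (unsplitK (inl j)).
have FE2 j : F (rshift k1 j) = B2 j by rewrite /F (unsplitK (inr j)).
have F1 j x : B1 j x -> A x /\ B x.
  by move=> Bx; suff : (A `&` B) x by []; rewrite -U1; exists j.
have F2 j x : B2 j x -> A x /\ ~ B x.
  by move=> Bx; suff : (A `\` B) x by []; rewrite -U2; exists j.
have case_ord (P : 'I_(k1 + k2) -> Prop) :
    (forall j, P (lshift k2 j)) -> (forall j, P (rshift k1 j)) -> forall i, P i.
  by move=> hl hr i; rewrite -(splitK i); case: (fintype.split i) => j /=;
    [exact: hl|exact: hr].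
exists (k1 + k2)%N, F; split; last first.
  by apply: (case_ord _) => j; rewrite ?FE1 ?FE2.
split.
- apply/seteqP; split=> x.
    move=> [i _]; move: i; apply: (case_ord _) => j; rewrite ?FE1 ?FE2.
      by move=> /F1[].
    by move=> /F2[].
  move=> Ax; have [Bx|nBx] := pselect (B x).
    have : (A `&` B) x by []. rewrite -U1 => -[j _ Bj].
    by exists (lshift k2 j) => //; rewrite FE1.
  have : (A `\` B) x by []. rewrite -U2 => -[j _ Bj].
  by exists (rshift k1 j) => //; rewrite FE2.
- move=> i j _ _ [x [Fi Fj]]; move: i j Fi Fj.
  apply: (case_ord _) => i; apply: (case_ord _) => j; rewrite ?FE1 ?FE2 =>
    Fi Fj.
  + by congr lshift; apply: T1 => //; exists x.
  + by case: (F2 _ _ Fj) => _; case; case: (F1 _ _ Fi).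
  + by case: (F2 _ _ Fi) => _; case; case: (F1 _ _ Fj).
  + by congr rshift; apply: T2 => //; exists x.
- by apply: (case_ord _) => j _; rewrite ?FE1 ?FE2; [exact: N1|exact: N2].
Qed.

(** The inverse of a positive infinitesimal bounds all finite elements at once. *)
Lemma bounded_of_finite n (A : set 'rV[K]_n) : aleph1_saturated M ->
  (forall x, A x -> forall i, finite_elt (x 0 i)) -> bounded A.
Proof.
move=> asat fA; have inv_gt0 (m : nat) : 0 < m.+1%:R^-1 :> K
  by rewrite invr_gt0.
have [d d0 hd] := coinitial asat inv_gt0.
exists d^-1 => x Ax i; have [m hm] := fA x Ax i.
apply: le_lt_trans hm _; rewrite -[ltLHS]invrK.
apply: (@lt_le_trans _ _ m.+1%:R); first by rewrite invrK ltr_nat.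
by rewrite -[leLHS]invrK lef_pV2 ?posrE ?invr_gt0.
Qed.

End Conclusion.

Theorem theorem4p8 (R : realType) (L : language) (K : realFieldType)
    (M : structure L K) (n : nat) (A : set 'rV[K]_n) :
  aleph1_saturated M -> o_minimal M ->
  definable M A -> (forall x, A x -> forall i, finite_elt (x 0 i)) ->
  exists (k : nat) (B : 'I_k -> set 'rV[K]_n),
    partition [set: 'I_k] B A /\
    forall i, definable M (B i) /\ whitney_arc R M (B i).
Proof.
move=> asat omin dA fA.
apply: piecewise_partition; have bA := bounded_of_finite asat fA.
apply: piecewise_mono (arc_pieces omin asat dA bA) => B _ _.
exact: quasiconvex_whitney_arc.
Qed.
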